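(* Let $p_1=p_2=p$ with $p,q\in(0,1)$ and $p\neq q$ fixed. For any fixed $t>0$, in the model $\mathrm{CSBM}(p,q,\alpha)$ with $\alpha=t\log n/n$, the two-step estimator $\hat X(\hat\sigma_{\mathrm{Spec}})$ built from the spectral estimator and the genie-aided estimator $\hat\sigma_{\mathrm{Best}}$ satisfy, as $n\to\infty$, $$\mathrm{Err}\big(\hat X(\hat\sigma_{\mathrm{Spec}})\big)=(1+o(1))\,\mathrm{Err}(\hat\sigma_{\mathrm{Best}})+o(1/n).$$
   Context: Symmetric censored stochastic block model $\mathrm{CSBM}(p,q,\alpha)$ on vertex set $[n]$: the labels $\sigma_0(i)\in\{\pm1\}$, $i\in[n]$, are i.i.d. uniform. Given $\sigma_0$, independently over unordered pairs $i\ne j$, there is an edge between $i$ and $j$ with probability $p$ if $\sigma_0(i)=\sigma_0(j)$ and with probability $q$ if $\sigma_0(i)\neq\sigma_0(j)$ (no self-loops). Independently over pairs, the status of each pair is revealed with probability $\alpha=t\log n/n$ ($n$ large enough that $\alpha\le 1$). The observation $G$ assigns to each pair a status in {present, absent, censored}: ''present'' if revealed and an edge, ''absent'' if revealed and a non-edge, ''censored'' if not revealed. Spectral estimator: let $y=\log\frac{1-q}{1-p}\big/\log\frac pq$ and let $A$ be the symmetric $n\times n$ matrix with zero diagonal and, for $i\ne j$, $A_{ij}=1$ if $\{i,j\}$ is present, $-y$ if absent, $0$ if censored. Let $u_1$ be a unit eigenvector for the largest eigenvalue of $A$ if $p>q$, and of $-A$ if $p<q$. Then $\hat\sigma_{\mathrm{Spec}}=\mathrm{sign}(u_1)$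 entrywise. Two-step estimator: for $\sigma\in\{\pm1\}^n$ and $u\in[n]$ let $D_1(\sigma,u),D_2(\sigma,u)$ be the numbers of present, respectively absent, pairs $\{u,v\}$ with $v\ne u$, $\sigma(v)=+1$, and $D_3(\sigma,u),D_4(\sigma,u)$ the numbers of present, respectively absent, pairs $\{u,v\}$ with $v\neq u$, $\sigma(v)=-1$. Let $$\Gamma(u,\sigma,p_1,p_2,q)=D_1\log\tfrac{p_1}{q}+D_2\log\tfrac{1-p_1}{1-q}+D_3\log\tfrac{q}{p_2}+D_4\log\tfrac{1-q}{1-p_2},\qquad D_k=D_k(\sigma,u).$$ Given an initial estimator $\hat\sigma$, $\hat X(\hat\sigma)\in\{\pm1\}^n$ has entries $\hat X(\hat\sigma,u)=+1$ if $\Gamma(u,\hat\sigma,p_1,p_2,q)\ge0$ and $-1$ otherwise (here with $p_1=p_2=p$). Genie-aided estimator: $\hat\sigma_{\mathrm{Best}}(u)=\arg\max_{r\in\{\pm1\}}\mathbb{P}\big(\sigma_0(u)=r\mid G,(\sigma_0(v))_{v\in[n]\setminus\{u\}}\big)$ for each $u$, ties broken in favour of $+1$. Error rate: $\mathrm{Err}(\hat\sigma)=\mathbb{E}\Big[\min_{s\in\{-1,+1\}}\frac1n\sum_{i=1}^n\mathbf 1\{\hat\sigma(i)\neq s\,\sigma_0(i)\}\Big]$. $\log$ is the natural logarithm. *)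

(* Defs.v *)
From HB Require Import structures.
From mathcomp Require Import all_boot all_order all_algebra.
From mathcomp Require Import all_classical all_reals all_analysis.

Set Implicit Arguments.
Unset Strict Implicit.
Unset Printing Implicit Defensive.

Import Order.TTheory GRing.Theory Num.Theory.
Import numFieldNormedType.Exports.

Local Open Scope ring_scope.

(* Labels in {+1, -1} are booleans: true is +1 and false is -1.  The product
   of two signs is then their boolean equality. *)
Definition labels (n : nat) := {ffun 'I_n -> bool}.

Definition mulsign (s r : bool) : bool := s == r.

(* Unordered pairs of distinct vertices are the two-element vertex sets. *)
Definition vpair (n : nat) := {e : {set 'I_n} | #|e| == 2}.

Definition status := option bool.
Definition present : status := Some true.
Definition absent : status := Some false.
Definition censored : status := None.

Definition observation (n : nat) := {ffun vpair n -> status}.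

(* For i = j, where [set i; j] is not a pair, the value is [censored]. *)
Definition pair_status n (G : observation n) (i j : 'I_n) : status :=
  if insub [set i; j] is Some e then G e else censored.

(* A sample is (true labels, edge indicators, revelation indicators). *)
Definition sample (n : nat) :=
  (labels n * {ffun vpair n -> bool} * {ffun vpair n -> bool})%type.

Definition truth n (w : sample n) : labels n := w.1.1.
Definition is_edge n (w : sample n) : {ffun vpair n -> bool} := w.1.2.
Definition revealed n (w : sample n) : {ffun vpair n -> bool} := w.2.

Definition observe n (w : sample n) : observation n :=
  [ffun e => if revealed w e then Some (is_edge w e) else censored].

Section Law.
Variable R : realType.
Variables p q alpha : R.
Variable n : nat.

Definition bernoulli_weight (x : R) (b : bool) : R := if b then x else 1 - x.

Definition edge_prob (sigma : labels n) (e : vpair n) : R :=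
  if [forall i in val e, forall j in val e, sigma i == sigma j] then p else q.

(* The probability of the sample w; a probability mass function only when
   p, q and alpha lie in [0, 1]. *)
Definition csbm_mass (w : sample n) : R :=
  (\prod_(i < n) bernoulli_weight 2^-1 (truth w i)) *
  (\prod_(e : vpair n)
      bernoulli_weight (edge_prob (truth w) e) (is_edge w e)) *
  (\prod_(e : vpair n) bernoulli_weight alpha (revealed w e)).

Definition csbm_E (X : sample n -> R) : R :=
  \sum_(w : sample n) csbm_mass w * X w.

Definition csbm_Pr (A : pred (sample n)) : R :=
  \sum_(w : sample n | A w) csbm_mass w.

(* Equal to 0 when the conditioning event is null. *)
Definition csbm_cPr (A B : pred (sample n)) : R :=
  csbm_Pr [pred w | A w && B w] / csbm_Pr B.

Definition misclass (s : bool) (sigma sigma0 : labels n) : R :=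
  n%:R^-1 * \sum_(i < n) (sigma i != mulsign s (sigma0 i))%:R.

Definition Err (est : sample n -> labels n) : R :=
  csbm_E (fun w => Num.min (misclass true (est w) (truth w))
                           (misclass false (est w) (truth w))).

(* All that the genie reveals about vertex u when the sample is w. *)
Definition genie_info (w : sample n) (u : 'I_n) : pred (sample n) :=
  [pred w' | (observe w' == observe w) &&
             [forall v, (v != u) ==> (truth w' v == truth w v)]].

Definition genie_posterior (w : sample n) (u : 'I_n) (r : bool) : R :=
  csbm_cPr [pred w' | truth w' u == r] (genie_info w u).

Definition genie (w : sample n) : labels n :=
  [ffun u => genie_posterior w u false <= genie_posterior w u true].

End Law.

Section Estimators.
Variable R : realType.
Variable n : nat.

Definition yparam (p q : R) : R := ln ((1 - q) / (1 - p)) / ln (p / q).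

Definition signed_adjacency (p q : R) (G : observation n) : 'M[R]_n :=
  \matrix_(i, j)
    match pair_status G i j with
    | Some true => 1
    | Some false => - yparam p q
    | None => 0
    end.

Definition spectral_matrix (p q : R) (G : observation n) : 'M[R]_n :=
  if q < p then signed_adjacency p q G else - signed_adjacency p q G.

Definition largest_eigenvalue (M : 'M[R]_n) (lambda : R) : Prop :=
  eigenvalue M lambda /\ (forall mu : R, eigenvalue M mu -> mu <= lambda).

(* Vectors are rows, following [eigenspace]; the matrices above are
   symmetric, so left and right eigenvectors agree.  The Euclidean norm is
   spelled out because the library norm on matrices is the sup norm. *)
Definition top_unit_eigenvector (M : 'M[R]_n) (u : 'rV[R]_n) : Prop :=
  \sum_(i < n) u 0 i ^+ 2 = 1 /\
  exists lambda : R, largest_eigenvalue M lambda /\ u *m M = lambda *: u.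

(* The sign of 0 is taken to be +1. *)
Definition sign_vector (u : 'rV[R]_n) : labels n := [ffun i => 0 <= u 0 i].

Definition degree (G : observation n) (s : status) (r : bool)
    (sigma : labels n) (u : 'I_n) : nat :=
  #|[set v : 'I_n | [&& v != u, pair_status G u v == s & sigma v == r]]|.

Definition Gamma (p1 p2 q : R) (G : observation n) (u : 'I_n)
    (sigma : labels n) : R :=
  (degree G present true sigma u)%:R * ln (p1 / q) +
  (degree G absent true sigma u)%:R * ln ((1 - p1) / (1 - q)) +
  (degree G present false sigma u)%:R * ln (q / p2) +
  (degree G absent false sigma u)%:R * ln ((1 - q) / (1 - p2)).

Definition two_step (p1 p2 q : R) (G : observation n) (sigma : labels n) :
    labels n :=
  [ffun u => 0 <= Gamma p1 p2 q G u sigma].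

End Estimators.

Definition reveal_prob (R : realType) (t : R) (n : nat) : R :=
  t * ln n%:R / n%:R.

(* Main.v *)
(* Let W be the matrix with entries log (p / q), log ((1 - p) / (1 - q)) or 0 on
   present, absent and censored pairs. The two-step estimator is the sign of
   [W s], with s the spectral labelling, and the genie is the sign of [W s0], with
   s0 the truth. They disagree at u only when some revealed neighbour v of u is
   misclassified by s while the true margin of u, its entry of [W s0] signed by
   [s0 u], is bounded.

   A leave-one-out analysis of the top eigenvector shows that a spectral error at
   v forces the margin of v to be small, unless an event of probability O(n^-2)
   occurs. The spectral perturbation it needs comes from a cut-norm bound on the
   bulk coordinates and from the sparsity of small vertex sets. Small margins have
   probability n^-c and are nearly independent of row u.

   Flipping the label of u multiplies the mass of a sample by the exponential of
   minus its margin, so a bounded margin at u is, up to a constant factor, as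
   unlikely as a genie error at u. Hence the two error rates differ by a factor
   1 + O(n^-c) and a term O(n^-2). *)

Require Import Defs.
From HB Require Import structures.
From mathcomp Require Import all_boot all_order all_algebra.
From mathcomp Require Import all_classical all_reals all_analysis.
From mathcomp Require Import ring lra zify.

Set Implicit Arguments.
Unset Strict Implicit.
Unset Printing Implicit Defensive.

Import Order.TTheory GRing.Theory Num.Theory.
Import numFieldNormedType.Exports.

Local Open Scope ring_scope.

(** * Product measures *)

(** For small [t] exact recovery is impossible, so some labels are always misjudged. What survives
    is a statement row by row: spectral errors have margin at most [eB * d], with d = log n and [eB]
    small. Such vertices are so rare that, outside an event of probability O(n^-2), no vertex has
    more than a constant number [k] of them as revealed neighbours. The evidence then moves by a
    constant [C] only, and a constant is what the change of measure can afford.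

    Two details decide whether the factor is really 1 + o(1). A spectral labelling is defined up to
    a global sign, while flipping the label of u compares errors only if the guesses at u ignore
    that label; the sign is therefore read off by a majority over the other vertices. Ties of the
    evidence can be as likely as errors, and the estimators may disagree on them; each errs on
    exactly half of the tied mass, so ties cancel.

    The cut norm replaces the operator norm because it is a maximum over 4^n pairs of sign vectors,
    within reach of a Chernoff and union bound; sparsity of small sets makes up for vectors with
    large entries. *)

Section ProductMeasure.
Context {R : realType} {I T : finType}.
Variable m : I -> T -> R.

Definition pmass (X : {ffun I -> T}) : R := \prod_i m i (X i).

Definition pE (f : {ffun I -> T} -> R) : R := \sum_X pmass X * f X.

Lemma pED f g : pE (fun X => f X + g X) = pE f + pE g.
Proof. by rewrite /pE -big_split; apply: eq_bigr => X _; rewrite mulrDr. Qed.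

Lemma pEZ c f : pE (fun X => c * f X) = c * pE f.
Proof. by rewrite /pE mulr_sumr; apply: eq_bigr => X _; rewrite mulrCA. Qed.

Lemma pE_sum (J : finType) (P : pred J) (f : J -> {ffun I -> T} -> R) :
  pE (fun X => \sum_(j | P j) f j X) = \sum_(j | P j) pE (f j).
Proof.
by rewrite /pE exchange_big /=; apply: eq_bigr => X _; rewrite mulr_sumr.
Qed.

Lemma eq_pE f g : f =1 g -> pE f = pE g.
Proof. by move=> fg; apply: eq_bigr => X _; rewrite fg. Qed.

Hypothesis m_ge0 : forall i x, 0 <= m i x.

Lemma pmass_ge0 X : 0 <= pmass X.
Proof. exact: prodr_ge0. Qed.

Lemma le_pE f g : (forall X, f X <= g X) -> pE f <= pE g.
Proof. by move=> fg; apply: ler_sum => X _; rewrite ler_wpM2l// pmass_ge0. Qed.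

Lemma pE_ge0 f : (forall X, 0 <= f X) -> 0 <= pE f.
Proof. by move=> f0; apply: sumr_ge0 => X _; rewrite mulr_ge0// pmass_ge0. Qed.

Hypothesis m_sum1 : forall i, \sum_x m i x = 1.

Lemma pE_prod1 (h : I -> T -> R) :
  pE (fun X => \prod_i h i (X i)) = \prod_i \sum_x m i x * h i x.
Proof.
by rewrite bigA_distr_bigA; apply: eq_bigr => X _; rewrite -big_split.
Qed.

Lemma pE_cst c : pE (fun=> c) = c.
Proof.
rewrite /pE -mulr_suml -(bigA_distr_bigA (fun i x => m i x)) big1 ?mul1r//.
Qed.

(** Injectivity lets each coordinate carry at most one factor; a coordinate carrying none
    contributes its total mass 1. *)
Lemma pE_prod (J : finType) (P : pred J) (phi : J -> I) (g : J -> T -> R) :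
  {in P &, injective phi} ->
  pE (fun X => \prod_(j | P j) g j (X (phi j))) =
  \prod_(j | P j) \sum_x m (phi j) x * g j x.
Proof.
move=> phiI.
transitivity (pE (fun X => \prod_i \prod_(j | P j && (phi j == i)) g j (X i))).
  apply: eq_pE => X; rewrite (partition_big phi xpredT)//=.
  by apply: eq_bigr => i _; apply: eq_bigr => j /andP[_ /eqP ->].
rewrite (pE_prod1 (fun i x => \prod_(j | P j && (phi j == i)) g j x)).
rewrite [RHS](partition_big phi xpredT)//=; apply: eq_bigr => i _.
case: (pickP [pred j | P j && (phi j == i)]) => [j0 /= /andP[Pj0 /eqP ij0]|e0].
  have E j : P j && (phi j == i) = (j == j0).
    apply/andP/eqP => [[Pj /eqP ij]|->]; last by rewrite Pj0 ij0.
    by apply: phiI => //; rewrite ij0.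
  rewrite [RHS](eq_bigl _ _ E) big_pred1_eq ij0.
  by apply: eq_bigr => x _; rewrite (eq_bigl _ _ E) big_pred1_eq.
rewrite [RHS]big_pred0// -[RHS](m_sum1 i).
by apply: eq_bigr => x _; rewrite big_pred0 ?mulr1.
Qed.

(* Exchanging, between two independent copies, the coordinates outside [D] is
   a measure-preserving involution. *)
Lemma pE_indep (D : pred I) (f g : {ffun I -> T} -> R) :
  (forall X Y : {ffun I -> T}, {in D, X =1 Y} -> f X = f Y) ->
  (forall X Y : {ffun I -> T}, {in predC D, X =1 Y} -> g X = g Y) ->
  pE (fun X => f X * g X) = pE f * pE g.
Proof.
move=> fD gD.
pose mix (X Y : {ffun I -> T}) := [ffun i => if D i then X i else Y i].
pose h (p : {ffun I -> T} * {ffun I -> T}) := (mix p.1 p.2, mix p.2 p.1).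
have hK : involutive h.
  by move=> [X Y]; apply/pair_equal_spec; split; apply/ffunP => i; rewrite !ffunE /=; case: (D i).
transitivity (\sum_(p : {ffun I -> T} * {ffun I -> T})
    pmass p.1 * pmass p.2 * (f p.1 * g p.1)).
  rewrite -[LHS]mulr1 -(pE_cst 1) /pE mulr_suml.
  rewrite -(pair_big xpredT xpredT (fun X Y =>
    pmass X * pmass Y * (f X * g X))) /=.
  apply: eq_bigr => X _; rewrite mulr_sumr.
  by apply: eq_bigr => Y _; rewrite mulr1 mulrAC.
rewrite (reindex_inj (inv_inj hK)) /pE mulr_suml.
rewrite -(pair_big xpredT xpredT (fun X Y =>
    pmass (mix X Y) * pmass (mix Y X) * (f (mix X Y) * g (mix X Y)))) /=.
apply: eq_bigr => X _; rewrite mulr_sumr; apply: eq_bigr => Y _.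
rewrite (fD (mix X Y) X); last by move=> i Di; rewrite ffunE ifT.
rewrite (gD (mix X Y) Y); last first.
  by move=> i Di; rewrite ffunE ifN//; exact: Di.
rewrite [RHS]mulrACA; congr (_ * _).
  suff -> : pmass (mix X Y) * pmass (mix Y X) = pmass X * pmass Y by [].
  rewrite /pmass -!big_split; apply: eq_bigr => i _ /=.
  by rewrite !ffunE; case: ifP => // _; rewrite mulrC.
Qed.

End ProductMeasure.

(** * Independence of the statuses of distinct pairs *)

Section PairLaw.
Context {R : realType} {n : nat}.
Implicit Types (G : observation n) (sigma : labels n) (i j u v : 'I_n).
Variables p q alpha : R.

Lemma sum_status (f : status -> R) :
  \sum_s f s = f None + (f (Some true) + f (Some false)).
Proof.
rewrite (bigD1 None)//=; congr (_ + _).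
rewrite (bigD1 (Some true))//=; congr (_ + _).
by rewrite (big_pred1 (Some false))// => -[[]|].
Qed.

Definition status_law (same : bool) (s : status) : R :=
  if s is Some b then alpha * bernoulli_weight (if same then p else q) b
  else 1 - alpha.

Definition pair_law sigma (e : vpair n) (s : status) : R :=
  if s is Some b then alpha * bernoulli_weight (edge_prob p q sigma e) b
  else 1 - alpha.

Lemma edge_prob_pair sigma (e : vpair n) i j : val e = [set i; j] ->
  edge_prob p q sigma e = if sigma i == sigma j then p else q.
Proof.
move=> eij; rewrite /edge_prob eij; congr (if _ then _ else _).
apply/idP/idP => [/forall_inP/(_ i)|/eqP sij].
  rewrite !inE eqxx => /(_ isT)/forall_inP/(_ j).
  by rewrite !inE eqxx orbT; apply.
apply/forall_inP => a; rewrite !inE => /orP[]/eqP->;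
  by apply/forall_inP => b; rewrite !inE => /orP[]/eqP->; rewrite ?sij.
Qed.

Lemma pair_law_pair sigma (e : vpair n) i j s : val e = [set i; j] ->
  pair_law sigma e s = status_law (sigma i == sigma j) s.
Proof. by move=> eij; rewrite /pair_law (edge_prob_pair _ eij). Qed.

Lemma vpairP (e : vpair n) : exists i j, i != j /\ val e = [set i; j].
Proof. by case/cards2P: (valP e) => i [j [ij eij]]; exists i, j. Qed.

Lemma vpair_neq (e : vpair n) i j : val e = [set i; j] -> i != j.
Proof. by move=> eij; have /eqP := valP e; rewrite eij cards2; case: eqP. Qed.

Lemma pair_status_pair G (e : vpair n) i j : val e = [set i; j] ->
  pair_status G i j = G e.
Proof. by move=> eij; rewrite /pair_status -eij valK. Qed.

Lemma pair_statusC G i j : pair_status G i j = pair_status G j i.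
Proof. by rewrite /pair_status finset.setUC. Qed.

Lemma pair_status_diag G i : pair_status G i i = None.
Proof. by rewrite /pair_status insubF// cards2 eqxx. Qed.

Lemma pair_exists i j : i != j -> exists e : vpair n, val e = [set i; j].
Proof.
move=> ij; have ij2 : #|[set i; j]| == 2 by rewrite cards2 ij.
by exists (Sub [set i; j] ij2); rewrite SubK.
Qed.

Lemma pair_law_sum1 sigma e : \sum_s pair_law sigma e s = 1.
Proof. by rewrite sum_status /=; ring. Qed.

(** Ordered pairs are the convenient indices for row sums. The two conditions on [P] make it name
    each unordered pair at most once, which is what independence needs. *)
Lemma pE_pairs sigma (P : pred ('I_n * 'I_n)) (g : 'I_n * 'I_n -> status -> R) :
  (forall z, P z -> z.1 != z.2) ->
  {in P &, injective (fun z => [set z.1; z.2])} ->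
  pE (pair_law sigma) (fun G => \prod_(z | P z) g z (pair_status G z.1 z.2)) =
  \prod_(z | P z) \sum_s status_law (sigma z.1 == sigma z.2) s * g z s.
Proof.
(* An empty [P] is treated apart: on fewer than two vertices no pair exists to serve as the default
   [e0]. *)
move=> Pne Pinj; have [z0 Pz0|P0] := pickP P; last first.
  rewrite [RHS]big_pred0// (@eq_pE _ _ _ _ _ (fun=> 1)) ?pE_cst//.
    exact: pair_law_sum1.
  by move=> G; rewrite big_pred0.
have [e0 _] := pair_exists (Pne _ Pz0).
pose phi (z : 'I_n * 'I_n) := insubd e0 [set z.1; z.2].
have phiE z : P z -> val (phi z) = [set z.1; z.2].
  by move=> /Pne zz; rewrite /phi insubdK// -topredE/= cards2 zz.
rewrite (@eq_pE _ _ _ _ _ (fun G => \prod_(z | P z) g z (G (phi z)))); last first.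
  by move=> G; apply: eq_bigr => z /phiE/pair_status_pair ->.
rewrite pE_prod; first last.
- move=> z z' Pz Pz' zz'; apply: Pinj => //.
  by rewrite -(phiE z Pz) -(phiE z' Pz') zz'.
- exact: pair_law_sum1.
apply: eq_bigr => z Pz; apply: eq_bigr => s _.
by rewrite (pair_law_pair _ _ (phiE z Pz)).
Qed.

(** A pair containing [u] has a unique other endpoint. This passes from sums over independent
    statuses to the row sums that define margins. *)
Lemma sum_pairs_at u (f : vpair n -> R) (h : 'I_n -> R) :
  (forall (e : vpair n) v, val e = [set u; v] -> f e = h v) ->
  (forall e : vpair n, u \notin val e -> f e = 0) ->
  \sum_e f e = \sum_(v | v != u) h v.
Proof.
move=> fh f0.
transitivity (\sum_(e : vpair n) \sum_(v | v != u)
    (if val e == [set u; v] then h v else 0)).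
  apply: eq_bigr => e _; have [ue|ue] := boolP (u \in val e); last first.
    rewrite f0// big1// => v _; case: eqP => // ev.
    by move: ue; rewrite ev !inE eqxx.
  have [w [wu ew]] : exists w, w != u /\ val e = [set u; w].
    have [i [j [ij eij]]] := vpairP e.
    move: ue; rewrite eij !inE => /orP[]/eqP ->.
      by exists j; rewrite eq_sym ij.
    by exists i; rewrite ij finset.setUC.
  rewrite (bigD1 w)//= ew eqxx (fh _ _ ew) big1 ?addr0// => v /andP[vu vw].
  case: eqP => // /setP/(_ v); rewrite !inE eqxx orbT (negbTE vu) (negbTE vw).
  by [].
rewrite exchange_big /=; apply: eq_bigr => v vu.
have uv : u != v by rewrite eq_sym.
have [e ev] := pair_exists uv.
rewrite (bigD1 e)//= ev eqxx big1 ?addr0// => e' e'e.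
by case: eqP => // e'v; case/eqP: e'e; apply: val_inj; rewrite /= ev; exact: e'v.
Qed.

End PairLaw.

(** * The censored block model *)

Section Model.
Context {R : realType} {n : nat}.
Implicit Types (G : observation n) (sigma : labels n) (i j u v : 'I_n).
Variables p q alpha : R.

Definition model_E (F : labels n -> observation n -> R) : R :=
  2^-n * \sum_sigma pE (pair_law p q alpha sigma) (F sigma).

(** Estimators and errors see a sample only through its labels and its observation. The two coins of
    each pair are zipped into one, samples are grouped by the observation they produce, and the edge
    coin of a censored pair sums out to 1. *)
Lemma csbm_E_observe (F : labels n -> observation n -> R) :
  csbm_E p q alpha (fun w => F (truth w) (observe w)) = model_E F.
Proof.
rewrite /csbm_E /model_E mulr_sumr.
rewrite -(pair_big xpredT xpredT (fun (a : labels n * {ffun vpair n -> bool}) b =>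
  csbm_mass p q alpha (a, b) * F (truth (a, b)) (observe (a, b))))/=.
rewrite -(pair_big xpredT xpredT (fun (s : labels n) (a : {ffun vpair n -> bool}) =>
  \sum_b csbm_mass p q alpha (s, a, b) * F (truth (s, a, b)) (observe (s, a, b))))/=.
apply: eq_bigr => sigma _; rewrite /csbm_mass /truth /is_edge /revealed /=.
have -> : \prod_(i < n) bernoulli_weight (2^-1 : R) (sigma i) = 2^-n.
  rewrite (eq_bigr (fun=> 2^-1)) ?prodr_const ?card_ord ?exprVn// => i _.
  by case: (sigma i) => //=; field.
transitivity (2^-n * \sum_(c : {ffun vpair n -> bool * bool})
  (\prod_e (bernoulli_weight (edge_prob p q sigma e) (c e).1 *
           bernoulli_weight alpha (c e).2)) *
  F sigma [ffun e => if (c e).2 then Some (c e).1 else None]).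
  rewrite mulr_sumr pair_big /=.
  pose f1 (c : {ffun vpair n -> bool * bool}) : {ffun vpair n -> bool} :=
    [ffun e => (c e).1].
  pose f2 (c : {ffun vpair n -> bool * bool}) : {ffun vpair n -> bool} :=
    [ffun e => (c e).2].
  have f1E c e : f1 c e = (c e).1 by rewrite ffunE.
  have f2E c e : f2 c e = (c e).2 by rewrite ffunE.
  rewrite (reindex (fun c => (f1 c, f2 c))); last first.
    exists (fun d : {ffun vpair n -> bool} * {ffun vpair n -> bool} =>
      [ffun e => (d.1 e, d.2 e)]).
      by move=> c _; apply/ffunP => e; rewrite ffunE f1E f2E; case: (c e).
    by move=> [a b] _; apply/pair_equal_spec; split; apply/ffunP => e; rewrite !ffunE.
  apply: eq_bigr => c _; rewrite -!mulrA; congr (_ * _).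
  rewrite !mulrA -big_split; congr (_ * _).
    by apply: eq_bigr => e _; rewrite f1E f2E.
  congr (F _ _); apply/ffunP => e; rewrite !ffunE.
  by [].
congr (_ * _); rewrite /pE.
pose obs (c : {ffun vpair n -> bool * bool}) : observation n :=
  [ffun e => if (c e).2 then Some (c e).1 else None].
rewrite (partition_big obs xpredT)//=; apply: eq_bigr => G _.
rewrite (eq_bigr (fun c : {ffun vpair n -> bool * bool} =>
  (\prod_e (bernoulli_weight (edge_prob p q sigma e) (c e).1 *
           bernoulli_weight alpha (c e).2)) * F sigma G)); last first.
  by move=> c /eqP <-.
rewrite -mulr_suml; congr (_ * _).
pose ob (z : bool * bool) : status := if z.2 then Some z.1 else None.
rewrite (eq_bigl (mem (family (fun e => [pred z | ob z == G e])))); last first.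
  move=> c; apply/eqP/familyP => [<- e|H]; first by rewrite !inE ffunE.
  by apply/ffunP => e; rewrite ffunE; apply/eqP; have := H e; rewrite inE.
rewrite -(bigA_distr_big_dep (fun e => [pred z | ob z == G e])
  (fun e z => bernoulli_weight (edge_prob p q sigma e) z.1 *
           bernoulli_weight alpha z.2)) /pmass.
apply: eq_bigr => e _; rewrite /pair_law.
rewrite -(pair_big_dep xpredT (fun a b => ob (a, b) == G e)
   (fun a b => bernoulli_weight (edge_prob p q sigma e) a *
           bernoulli_weight alpha b))/=.
rewrite big_bool /= /ob /= big_mkcond big_bool /= big_mkcond big_bool /=.
by case: (G e) => [[]|] /=; ring.
Qed.

End Model.

(** * Log-likelihood margins *)

Section Margin.
Context {R : realType} {n : nat}.
Implicit Types (G : observation n) (sigma : labels n) (i j u v : 'I_n).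
Variables p q : R.

Definition sg (b : bool) : R := if b then 1 else -1.

Lemma sgN b : sg (~~ b) = - sg b.
Proof. by case: b; rewrite /sg/= ?opprK. Qed.

Lemma sgM b c : sg b * sg c = sg (b == c).
Proof. by case: b; case: c; rewrite /sg/=; ring. Qed.

Lemma sg_sqr b : sg b * sg b = 1.
Proof. by rewrite sgM eqxx. Qed.

Lemma sg_norm1 b : `|sg b| = 1.
Proof. by case: b; rewrite /sg ?normrN normr1. Qed.

(** Log-likelihood ratio of equal against opposite labels at the two ends of a pair. A censored pair
    is uninformative, as revelation ignores the labels. *)
Definition llr (s : status) : R :=
  match s with
  | Some true => ln (p / q)
  | Some false => ln ((1 - p) / (1 - q))
  | None => 0
  end.

Definition llr_mx G i j : R := llr (pair_status G i j).

(** Log-likelihood ratio of [true] against [false] at [u] when [sigma] gives the other labels. The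
    label of [u] itself does not enter, since a vertex forms no pair with itself. *)
Definition evidence G sigma u : R := \sum_v llr_mx G u v * sg (sigma v).

Definition margin G sigma u : R := sg (sigma u) * evidence G sigma u.

Definition flip u sigma : labels n :=
  [ffun v => if v == u then ~~ sigma v else sigma v].

Lemma flipK u : involutive (flip u).
Proof.
by move=> s; apply/ffunP => v; rewrite !ffunE; case: eqP => // _; rewrite negbK.
Qed.

Lemma evidence_flip G sigma u : evidence G (flip u sigma) u = evidence G sigma u.
Proof.
apply: eq_bigr => v _; rewrite ffunE; case: eqP => // ->.
by rewrite /llr_mx pair_status_diag /= !mul0r.
Qed.

Lemma margin_flip G sigma u : margin G (flip u sigma) u = - margin G sigma u.
Proof. by rewrite /margin evidence_flip ffunE eqxx sgN mulNr. Qed.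

Lemma marginE G sigma u :
  margin G sigma u = \sum_(v | v != u) sg (sigma u == sigma v) * llr_mx G u v.
Proof.
rewrite /margin /evidence mulr_sumr (bigD1 u)//= /llr_mx pair_status_diag /=.
rewrite mul0r mulr0 add0r; apply: eq_bigr => v _.
by rewrite -sgM mulrA -mulrA [_ * sg (sigma v)]mulrC mulrA.
Qed.

End Margin.
Arguments sg {R} b.

(** * Flipping one label *)

Section Flip.
Context {R : realType} {n : nat}.
Implicit Types (G : observation n) (sigma : labels n) (i j u v : 'I_n).
Variables p q alpha : R.
Hypotheses (hp : 0 < p < 1) (hq : 0 < q < 1).

Lemma status_law_swap b s : status_law p q alpha (~~ b) s =
  status_law p q alpha b s * expR (- (sg b * llr p q s)).
Proof.
move: hp hq => /andP[p0 p1] /andP[q0 q1].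
have e1 : expR (ln (p / q)) = p / q by rewrite lnK// posrE divr_gt0.
have e2 : expR (ln ((1 - p) / (1 - q))) = (1 - p) / (1 - q).
  by rewrite lnK// posrE divr_gt0// subr_gt0.
have p_neq0 : p != 0 by rewrite gt_eqF.
have q_neq0 : q != 0 by rewrite gt_eqF.
have p1_neq0 : 1 - p != 0 by rewrite gt_eqF// subr_gt0.
have q1_neq0 : 1 - q != 0 by rewrite gt_eqF// subr_gt0.
case: s => [c|]; last by rewrite /= mulr0 oppr0 expR0 mulr1.
case: b c => [] [] /=; rewrite ?mul1r ?mulN1r ?opprK ?expRN ?e1 ?e2.
all: by field; rewrite ?p_neq0 ?q_neq0 ?p1_neq0 ?q1_neq0.
Qed.

(** Only the pairs at [u] change their law, each by its own likelihood ratio, and the logarithms of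
    these ratios add up to the margin. *)
Lemma pmass_flip G sigma u :
  pmass (pair_law p q alpha (flip u sigma)) G =
  pmass (pair_law p q alpha sigma) G * expR (- margin p q G sigma u).
Proof.
pose r (e : vpair n) := if u \in val e then
  ln (pair_law p q alpha (flip u sigma) e (G e)) else 0.
(* The margin is rewritten as a sum over pairs, to be matched with [pmass] factor by factor. *)
pose x (e : vpair n) : R := if [pick v | val e == [set u; v]] is Some v
  then sg (sigma u == sigma v) * llr p q (G e) else 0.
have xE (e : vpair n) v : val e = [set u; v] ->
    x e = sg (sigma u == sigma v) * llr_mx p q G u v.
  move=> ev; rewrite /x; case: pickP => [w /eqP ew|/(_ v)]; last by rewrite ev eqxx.
  have uv := vpair_neq ev.
  suff -> : w = v by rewrite /llr_mx (pair_status_pair _ ev).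
  move: ew; rewrite ev => /setP/(_ v); rewrite !inE eqxx orbT eq_sym (negbTE uv).
  by move=> /esym/eqP.
have x0 (e : vpair n) : u \notin val e -> x e = 0.
  move=> ue; rewrite /x; case: pickP => // v /eqP ev.
  by move: ue; rewrite ev !inE eqxx.
rewrite marginE -(sum_pairs_at xE x0) -sumrN expR_sum /pmass -big_split.
apply: eq_bigr => e _.
have [ue|ue] := boolP (u \in val e); last first.
  rewrite x0// oppr0 expR0 [RHS]mulr1.
  have [i [j [ij eij]]] := vpairP e; rewrite !(pair_law_pair _ _ _ _ _ eij).
  move: ue; rewrite eij !inE negb_or => /andP[ui uj].
  by rewrite !ffunE ![_ == u]eq_sym (negbTE ui) (negbTE uj).
have [v [uv ev]] : exists v, u != v /\ val e = [set u; v].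
  have [i [j [ij eij]]] := vpairP e.
  move: ue; rewrite eij !inE => /orP[]/eqP ->; first by exists j.
  by exists i; rewrite eq_sym ij finset.setUC.
rewrite !(pair_law_pair _ _ _ _ _ ev) (xE _ _ ev) !ffunE eqxx eq_sym.
rewrite [v == u]eq_sym (negbTE uv) /llr_mx (pair_status_pair _ ev).
have -> : (sigma v == ~~ sigma u) = ~~ (sigma u == sigma v).
  by case: (sigma u); case: (sigma v).
by rewrite status_law_swap.
Qed.

(** Change of measure: labels are uniform and the flip is an involution, so the density of
    [pmass_flip] is the only cost. The comparisons of ties and of small margins with genie errors
    rest on it. *)
Lemma model_E_flip u (F : labels n -> observation n -> R) :
  model_E p q alpha F =
  model_E p q alpha (fun s G => expR (- margin p q G s u) * F (flip u s) G).
Proof.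
rewrite /model_E (reindex_inj (inv_inj (flipK u))); congr (_ * _).
apply: eq_bigr => s _; apply: eq_bigr => G _.
by rewrite pmass_flip mulrA.
Qed.

End Flip.

(** * The genie as a likelihood test; ties and small margins *)

Section Genie.
Context {R : realType} {n : nat}.
Implicit Types (G : observation n) (sigma : labels n) (i j u v : 'I_n).
Implicit Types (F : labels n -> observation n -> R).
Variables p q alpha : R.
Hypotheses (hp : 0 < p < 1) (hq : 0 < q < 1) (ha : 0 < alpha < 1).

Let E F := model_E p q alpha F.

Lemma pair_law_gt0 sigma e s : 0 < pair_law p q alpha sigma e s.
Proof.
move: hp hq ha => /andP[p0 p1] /andP[q0 q1] /andP[a0 a1].
case: s => [b|] /=; last by rewrite subr_gt0.
by rewrite mulr_gt0// /edge_prob; case: ifP; case: b => //=; rewrite subr_gt0.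
Qed.

Lemma pair_law_ge0 sigma e s : 0 <= pair_law p q alpha sigma e s.
Proof. exact/ltW/pair_law_gt0. Qed.

Lemma model_E_ext F F' : (forall s G, F s G = F' s G) -> E F = E F'.
Proof.
by move=> FF; congr (_ * _); apply: eq_bigr => s _; apply: eq_pE => G; exact: FF.
Qed.

Lemma le_model_E F F' : (forall s G, F s G <= F' s G) -> E F <= E F'.
Proof.
move=> FF; rewrite ler_wpM2l ?invr_ge0 ?exprn_ge0//; apply: ler_sum => s _.
by apply: le_pE => // *; exact: pair_law_ge0.
Qed.

Lemma model_E_ge0 F : (forall s G, 0 <= F s G) -> 0 <= E F.
Proof.
move=> F0; rewrite mulr_ge0 ?invr_ge0 ?exprn_ge0//; apply: sumr_ge0 => s _.
by apply: pE_ge0 => // *; exact: pair_law_ge0.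
Qed.

Lemma model_ED F F' : E (fun s G => F s G + F' s G) = E F + E F'.
Proof.
rewrite /E /model_E -mulrDr -big_split; congr (_ * _).
by apply: eq_bigr => s _; exact: pED.
Qed.

Lemma model_EZ c F : E (fun s G => c * F s G) = c * E F.
Proof.
rewrite /E /model_E mulrCA; congr (_ * _); rewrite mulr_sumr.
by apply: eq_bigr => s _; exact: pEZ.
Qed.

Lemma model_E_sum (J : finType) (P : pred J) (f : J -> labels n -> observation n -> R) :
  E (fun s G => \sum_(j | P j) f j s G) = \sum_(j | P j) E (f j).
Proof.
rewrite /E /model_E -mulr_sumr; congr (_ * _); rewrite [RHS]exchange_big.
by apply: eq_bigr => s _; exact: pE_sum.
Qed.

Lemma model_E_le_cond F c :
  (forall s, pE (pair_law p q alpha s) (F s) <= c) -> E F <= c.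
Proof.
move=> Fc; rewrite /E /model_E ler_pdivrMl ?exprn_gt0//.
apply: le_trans (ler_sum _ (fun s _ => Fc s)) _.
by rewrite sumr_const card_ffun card_bool card_ord -[c *+ _]mulr_natl natrX.
Qed.

Lemma csbm_PrE (A : pred (sample n)) (B : labels n -> observation n -> bool) :
  (forall w, A w = B (truth w) (observe w)) ->
  csbm_Pr p q alpha A = E (fun s G => (B s G)%R%:R).
Proof.
move=> AB; rewrite -[RHS]csbm_E_observe /csbm_Pr /csbm_E big_mkcond.
by apply: eq_bigr => w _; rewrite AB; case: ifP; rewrite ?mulr1 ?mulr0.
Qed.

Definition relabel u (r : bool) sigma : labels n :=
  [ffun v => if v == u then r else sigma v].

Lemma relabel_flip u r sigma : relabel u (~~ r) sigma = flip u (relabel u r sigma).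
Proof. by apply/ffunP => v; rewrite !ffunE; case: eqP. Qed.

Lemma evidence_relabel u r sigma G :
  evidence p q G (relabel u r sigma) u = evidence p q G sigma u.
Proof.
apply: eq_bigr => v _; rewrite ffunE; case: eqP => // ->.
by rewrite /llr_mx pair_status_diag /= !mul0r.
Qed.

Lemma model_E_atom sigma G :
  E (fun s H => ((s == sigma) && (H == G))%:R) =
  2^-n * pmass (pair_law p q alpha sigma) G.
Proof.
rewrite /E /model_E (bigD1 sigma)//= [X in _ + X]big1 ?addr0.
  rewrite /pE (bigD1 G)//= big1 ?addr0 ?eqxx ?mulr1// => H /negbTE ->.
  by rewrite andbF mulr0.
move=> s /negbTE ss; rewrite /pE big1// => H _.
by rewrite ss mulr0.
Qed.

(** Given the observation and the other labels only the label of [u] is free, so each of the two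
    hypotheses is a single atom. *)
Lemma genie_infoE w u r w' :
  (truth w' u == r) && genie_info w u w' =
  (truth w' == relabel u r (truth w)) && (observe w' == observe w).
Proof.
rewrite /genie_info /= andbCA andbC; congr (_ && _).
apply/andP/eqP => [[/eqP ur /forallP H]|->].
  apply/ffunP => v; rewrite ffunE; case: eqP => [-> //|/eqP vu].
  by apply/eqP; have := H v; rewrite vu.
rewrite ffunE eqxx; split=> //; apply/forallP => v; apply/implyP => vu.
by rewrite ffunE (negbTE vu).
Qed.

(** The ratio of the two posteriors is the mass ratio of two labellings that differ at [u], which
    [pmass_flip] evaluates. *)
Lemma genieE w u : genie p q alpha w u = (0 <= evidence p q (observe w) (truth w) u).
Proof.
rewrite ffunE /genie_posterior /csbm_cPr.
pose at_ r := 2^-n * pmass (pair_law p q alpha (relabel u r (truth w))) (observe w).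
have PrE r : csbm_Pr p q alpha
    [pred w' | [pred w'' | truth w'' u == r] w' && genie_info w u w'] = at_ r.
  rewrite (@csbm_PrE _ (fun s H => (s == relabel u r (truth w)) && (H == observe w))).
    exact: model_E_atom.
  by move=> w'; exact: genie_infoE.
(* Every atom has positive mass, so the null-event convention of [csbm_cPr] never intervenes. *)
have at_gt0 r : 0 < at_ r.
  by rewrite mulr_gt0 ?invr_gt0 ?exprn_gt0//; apply: prodr_gt0 => e _; exact: pair_law_gt0.
have PrB : csbm_Pr p q alpha (genie_info w u) = at_ true + at_ false.
  rewrite -!PrE /csbm_Pr [LHS]big_mkcond [X in _ = X + _]big_mkcond.
  rewrite [X in _ = _ + X]big_mkcond -big_split; apply: eq_bigr => w' _ /=.
  by case: (truth w' u) => /=; case: ifP; rewrite ?addr0 ?add0r.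
rewrite !PrE PrB ler_pM2r ?invr_gt0 ?addr_gt0//.
rewrite /at_ ler_pM2l ?invr_gt0 ?exprn_gt0//.
rewrite -[X in relabel u X]/(~~ true) relabel_flip pmass_flip//.
rewrite ger_pMr; last by apply: prodr_gt0 => e _; exact: pair_law_gt0.
rewrite -[leRHS]expR0 ler_expR oppr_le0 /margin evidence_relabel ffunE eqxx.
by rewrite /sg mul1r.
Qed.

Lemma degreeE G s r sigma u :
  (degree G s r sigma u)%:R =
  \sum_v ((v != u) && (pair_status G u v == s) && (sigma v == r))%:R :> R.
Proof.
rewrite /degree -sum1_card natr_sum big_mkcond /=.
by apply: eq_bigr => v _; rewrite inE -andbA; case: ifP.
Qed.

(** With both intra-class probabilities equal to [p], the weights of the [false] neighbours are the
    negatives of those of the [true] ones. *)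
Lemma GammaE G sigma u : Gamma p p q G u sigma = evidence p q G sigma u.
Proof.
move: hp hq => /andP[p0 p1] /andP[q0 q1].
have e1 : ln (q / p) = - ln (p / q) by rewrite !ln_div ?posrE// opprB.
have e2 : ln ((1 - q) / (1 - p)) = - ln ((1 - p) / (1 - q)).
  by rewrite !ln_div ?posrE ?subr_gt0// opprB.
rewrite /Gamma e1 e2 !degreeE !mulr_suml -!big_split; apply: eq_bigr => v _ /=.
have [->|vu] := eqVneq v u; first by rewrite /llr_mx pair_status_diag /=; ring.
rewrite /llr_mx; case: (pair_status G u v) => [[]|] /=; case: (sigma v);
  rewrite /sg/=; ring.
Qed.

Lemma two_stepE G sigma u : two_step p p q G sigma u = (0 <= evidence p q G sigma u).
Proof. by rewrite ffunE GammaE. Qed.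

Definition genie_wrong u sigma G : bool :=
  (0 <= evidence p q G sigma u) != sigma u :> bool.

(** On a tie the flip at [u] preserves the mass. A guess that does not see the label of [u] is right
    for exactly one of the two labellings. *)
Lemma tie_half u (h : labels n -> observation n -> bool) :
  (forall s G, h (flip u s) G = h s G) ->
  E (fun s G => ((margin p q G s u == 0) && (h s G != s u :> bool))%:R) =
  2^-1 * E (fun s G => (margin p q G s u == 0)%R%:R).
Proof.
move=> hflip; set A := E _; suff : A + A = E (fun s G => (margin p q G s u == 0)%R%:R).
  by move=> <-; field.
rewrite {2}/A /E (@model_E_flip _ _ _ _ _ _ _ u)// -/(E _) -model_ED; apply: model_E_ext => s G.
rewrite margin_flip oppr_eq0 hflip ffunE eqxx; case: eqP => [->|_] /=.
  by rewrite oppr0 expR0 mul1r; case: (h s G); case: (s u) => /=; ring.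
by rewrite mulr0 addr0.
Qed.

(** A negative margin is always a genie error, a zero margin is one on half of its mass; the factor
    2 pays for the ties. *)
Lemma margin_le0_genie u :
  E (fun s G => (margin p q G s u <= 0)%R%:R) <=
  2 * E (fun s G => (genie_wrong u s G)%:R).
Proof.
have -> : E (fun s G => (margin p q G s u <= 0)%R%:R) =
    E (fun s G => (margin p q G s u < 0)%R%:R) + E (fun s G => (margin p q G s u == 0)%R%:R).
  rewrite -model_ED; apply: model_E_ext => s G.
  by case: ltgtP => _; rewrite /= ?addr0 ?add0r.
have -> : E (fun s G => (margin p q G s u == 0)%R%:R) =
    2 * E (fun s G => ((margin p q G s u == 0) && genie_wrong u s G)%R%:R).
  rewrite (@tie_half u (fun s G => 0 <= evidence p q G s u)); first by field.
  by move=> s G; rewrite evidence_flip.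
have -> : E (fun s G => (genie_wrong u s G)%:R) =
    E (fun s G => (margin p q G s u < 0)%R%:R) +
    E (fun s G => ((margin p q G s u == 0) && genie_wrong u s G)%R%:R).
  rewrite -model_ED; apply: model_E_ext => s G; rewrite /margin /genie_wrong.
  case: (s u); rewrite ?eqb_id ?eqbF_neg.
    by rewrite mul1r; case: ltgtP => _; rewrite ?addr0 ?add0r.
  by rewrite negbK mulN1r oppr_lt0 oppr_eq0; case: ltgtP => _; rewrite ?addr0 ?add0r.
have : 0 <= E (fun s G => (margin p q G s u < 0)%R%:R) by apply: model_E_ge0.
lra.
Qed.

(* The likelihood ratio of the two labels of [u] is the exponential of the
   margin, so small positive margins are at most a constant times likelier
   than nonpositive ones. *)
Lemma small_margin_genie u C : 0 <= C ->
  E (fun s G => (`|margin p q G s u| <= C)%R%:R) <=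
  2 * (1 + expR C) * E (fun s G => (genie_wrong u s G)%:R).
Proof.
move=> C0.
apply: (@le_trans _ _ ((1 + expR C) * E (fun s G => (margin p q G s u <= 0)%R%:R))).
  apply: (@le_trans _ _ (E (fun s G => (margin p q G s u <= 0)%R%:R) +
     E (fun s G => (0 <= margin p q G s u <= C)%R%:R))).
    rewrite -model_ED; apply: le_model_E => s G; rewrite ler_norml.
    rewrite -natrD ler_nat.
    case: (lerP (margin p q G s u) 0) => [m0|/ltW ->]; first by case: (_ && _).
    by case: (_ <= C)%R; rewrite ?andbT ?andbF// leq_b1.
  rewrite [leRHS]mulrDl mul1r lerD2l.
  rewrite [leLHS](@model_E_flip _ _ _ _ _ _ _ u)// -/(E _) -model_EZ.
  apply: le_model_E => s G; rewrite margin_flip oppr_ge0.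
  case: (lerP (margin p q G s u) 0) => m0 /=; last by rewrite !mulr0.
  rewrite mulr1; case: (lerP _ C) => mC /=; last by rewrite mulr0 expR_ge0.
  by rewrite mulr1 ler_expR.
rewrite -[2 * _]mulrC -mulrA ler_wpM2l ?addr_ge0 ?expR_ge0//.
exact: margin_le0_genie.
Qed.

End Genie.

(** * Quadratic forms of sparse and of cut-bounded matrices *)

Section Vectors.
Context {R : realType} {n : nat}.
Implicit Types (x y z s : 'I_n -> R) (M N W E B : 'I_n -> 'I_n -> R).

Definition dot x y : R := \sum_i x i * y i.
Definition nrm2 x : R := \sum_i x i ^+ 2.
Definition qf M x : R := \sum_i \sum_j M i j * x i * x j.

Lemma nrm2_ge0 x : 0 <= nrm2 x.
Proof. by apply: sumr_ge0 => i _; exact: sqr_ge0. Qed.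

Lemma dotC x y : dot x y = dot y x.
Proof. by apply: eq_bigr => i _; exact: mulrC. Qed.

Lemma dotxx x : dot x x = nrm2 x.
Proof. by []. Qed.

Lemma nrm2_addZ x y a : nrm2 (fun i => x i + a * y i) =
  nrm2 x + 2 * a * dot x y + a ^+ 2 * nrm2 y.
Proof.
rewrite /nrm2 /dot !mulr_sumr -!big_split; apply: eq_bigr => i _ /=; ring.
Qed.

Lemma nrm2_eq0 x : nrm2 x = 0 -> forall i, x i = 0.
Proof.
move=> x0 i; suff /eqP : x i ^+ 2 = 0 by rewrite sqrf_eq0 => /eqP.
apply/eqP; rewrite eq_le sqr_ge0 andbT -x0 /nrm2 (bigD1 i)//= lerDl.
by apply: sumr_ge0 => *; exact: sqr_ge0.
Qed.

Lemma cauchy_schwarz x y : dot x y ^+ 2 <= nrm2 x * nrm2 y.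
Proof.
have [y0|y_neq0] := eqVneq (nrm2 y) 0.
  suff -> : dot x y = 0 by rewrite expr0n mulr_ge0// nrm2_ge0.
  by apply: big1 => i _; rewrite (nrm2_eq0 y0) mulr0.
have y_gt0 : 0 < nrm2 y by rewrite lt_neqAle eq_sym y_neq0 nrm2_ge0.
have := nrm2_ge0 (fun i => x i + (- (dot x y / nrm2 y)) * y i).
rewrite nrm2_addZ => h.
have : 0 <= nrm2 x - dot x y ^+ 2 / nrm2 y.
  by apply: le_trans h _; rewrite le_eqVlt; apply/orP; left; apply/eqP; field.
by rewrite subr_ge0 ler_pdivrMr.
Qed.

Lemma dotDl x y z : dot (fun i => x i + y i) z = dot x z + dot y z.
Proof. by rewrite /dot -big_split; apply: eq_bigr => i _; rewrite mulrDl. Qed.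

Lemma dotZl a x y : dot (fun i => a * x i) y = a * dot x y.
Proof. by rewrite /dot mulr_sumr; apply: eq_bigr => i _; rewrite mulrA. Qed.

Lemma nrm2Z a x : nrm2 (fun i => a * x i) = a ^+ 2 * nrm2 x.
Proof. by rewrite /nrm2 mulr_sumr; apply: eq_bigr => i _; rewrite exprMn. Qed.

Lemma qf_dot M x : qf M x = dot x (fun i => \sum_j M i j * x j).
Proof.
apply: eq_bigr => i _; rewrite mulr_sumr; apply: eq_bigr => j _.
by rewrite mulrCA mulrA.
Qed.

Lemma qfZ M a x : qf M (fun i => a * x i) = a ^+ 2 * qf M x.
Proof.
rewrite /qf mulr_sumr; apply: eq_bigr => i _; rewrite mulr_sumr.
by apply: eq_bigr => j _; ring.
Qed.

(* Vertices of small degree are removed one at a time: each pair is charged to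
   the endpoint removed first, through [2 x y <= beta x^2 + y^2 / beta]. *)
Lemma peeling N e beta x (S : {set 'I_n}) :
  (forall i j, 0 <= N i j) -> (forall i j, N i j = N j i) ->
  (forall i, N i i = 0) -> 0 < beta ->
  (forall S' : {set 'I_n}, S' \subset S ->
     \sum_(i in S') \sum_(j in S') N i j <= e * #|S'|%:R) ->
  \sum_(i in S) \sum_(j in S) N i j * x i * x j <=
  beta * e * (\sum_(i in S) x i ^+ 2) +
  beta^-1 * \sum_(i in S) (\sum_(j in S) N i j) * x i ^+ 2.
Proof.
move=> N0 Nsym Ndiag beta0.
have [k] := ubnP #|S|; elim: k S => // k IH S; rewrite ltnS => Sk sparse.
have [->|/set0Pn[v0 v0S]] := eqVneq S finset.set0.
  by rewrite !big_set0 !mulr0 addr0.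
(* By averaging, some vertex of [S] has inner degree at most [e]. *)
have [v vS dv] : exists2 v, v \in S & \sum_(j in S) N v j <= e.
  apply/exists_inP; apply: contraT; rewrite negb_exists_in => /forall_inP H.
  have := sparse S (subxx _); rewrite leNgt => /negP; case.
  rewrite mulr_natr -sumr_const; apply: ltr_sum.
    by apply/hasP; exists v0; rewrite ?mem_index_enum.
  by move=> i iS; rewrite ltNge; exact: H.
have vS' : v \notin S :\ v by rewrite !inE eqxx.
have SE (F : 'I_n -> R) : \sum_(i in S) F i = F v + \sum_(i in S :\ v) F i.
  by rewrite (big_setD1 v).
have sub : S :\ v \subset S by exact: subD1set.
have {}IH := IH (S :\ v) (leq_trans (proper_card (properD1 vS)) Sk)
  (fun S' h => sparse S' (fintype.subset_trans h sub)).
rewrite SE [X in X + _]SE Ndiag !mul0r add0r.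
under [X in _ + X <= _]eq_bigr do rewrite SE.
rewrite big_split /=.
rewrite [X in _ <= _ * X + _]SE mulrDr.
have -> : \sum_(i in S) (\sum_(j in S) N i j) * x i ^+ 2 =
  (\sum_(j in S :\ v) N v j) * x v ^+ 2 +
  (\sum_(i in S :\ v) N i v * x i ^+ 2 +
  \sum_(i in S :\ v) (\sum_(j in S :\ v) N i j) * x i ^+ 2).
  rewrite SE SE Ndiag add0r; congr (_ + _); rewrite -big_split.
  by apply: eq_bigr => i _; rewrite SE mulrDl.
have -> : \sum_(i in S :\ v) N i v * x i * x v = \sum_(i in S :\ v) N v i * x v * x i.
  by apply: eq_bigr => i _; rewrite Nsym mulrAC.
have amgm : \sum_(i in S :\ v) N v i * x v * x i + \sum_(i in S :\ v) N v i * x v * x i <=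
   beta * (\sum_(i in S :\ v) N v i) * x v ^+ 2 +
   beta^-1 * \sum_(i in S :\ v) N i v * x i ^+ 2.
  rewrite mulr_sumr [_ * x v ^+ 2]mulr_suml mulr_sumr -!big_split /=.
  apply: ler_sum => i _; rewrite [N i v]Nsym -subr_ge0.
  have -> : beta * N v i * x v ^+ 2 + beta^-1 * (N v i * x i ^+ 2) -
     (N v i * x v * x i + N v i * x v * x i) =
     N v i * beta^-1 * (beta * x v - x i) ^+ 2 by field; rewrite gt_eqF.
  by apply: mulr_ge0; [apply: mulr_ge0; [exact: N0|rewrite invr_ge0 ltW]|exact: sqr_ge0].
have dv' : \sum_(i in S :\ v) N v i <= e by move: dv; rewrite SE Ndiag add0r.
have h1 : beta * (\sum_(i in S :\ v) N v i) * x v ^+ 2 <= beta * e * x v ^+ 2.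
  by rewrite ler_wpM2r ?sqr_ge0// ler_wpM2l// ltW.
have h2 : 0 <= beta^-1 * ((\sum_(j in S :\ v) N v j) * x v ^+ 2).
  apply: mulr_ge0; first by rewrite invr_ge0 ltW.
  by apply: mulr_ge0; [exact: sumr_ge0|exact: sqr_ge0].
rewrite !mulrDr; move: IH; lra.
Qed.


(* Pairs of very different sizes cost at most [Delta / rho]; pairs of small
   entries are controlled by the cut norm; the remaining ones lie within the few
   vertices carrying large entries, where the graph is sparse. *)
Lemma qf_bound W E N Y Delta rho T beta e cE kappa x :
  (0 < n)%N ->
  (forall i j, 0 <= N i j) -> (forall i j, N i j = N j i) ->
  (forall i, N i i = 0) -> (forall i, \sum_j N i j <= Delta) ->
  0 <= Y -> 1 <= rho -> 0 < T -> 0 < beta -> 0 <= e -> 0 <= cE ->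
  (forall S : {set 'I_n}, #|S|%:R * T ^+ 2 <= rho ^+ 2 * n%:R ->
     \sum_(i in S) \sum_(j in S) N i j <= e * #|S|%:R) ->
  (forall i j, `|W i j| <= Y * N i j) ->
  (forall i j, `|E i j| <= cE / n%:R) ->
  (forall a b : 'I_n -> R, (forall i, `|a i| <= 1) -> (forall i, `|b i| <= 1) ->
     `|\sum_i \sum_j (W i j - E i j) * a i * b j| <= kappa * n%:R) ->
  `|qf (fun i j => W i j - E i j) x| <=
  (Y * (beta * e + beta^-1 * Delta) + 2 * Y * Delta / rho + 2 * cE / T +
   T ^+ 2 * kappa) * nrm2 x.
Proof.
move=> n0 N0 Nsym Ndiag NDelta Y0 rho1 T0 beta0 e0 cE0 sparse WN En cut.
have [s0|s_neq0] := eqVneq (nrm2 x) 0.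
  rewrite s0 mulr0 /qf big1 ?normr0// => i _; rewrite big1// => j _.
  by rewrite (nrm2_eq0 s0 i) mulr0 mul0r.
have s_gt0 : 0 < nrm2 x by rewrite lt_neqAle eq_sym s_neq0 nrm2_ge0.
have n_gt0 : 0 < n%:R :> R by rewrite ltr0n.
have n_neq0 : n%:R != 0 :> R by rewrite gt_eqF.
(* [r] is the root mean square of [x]. Entries up to [T * r] form the bulk [b]; those above
   [T * r / rho] form [S], whose subsets meet the size condition of [sparse] by Chebyshev's
   inequality. *)
pose r := Num.sqrt (nrm2 x / n%:R).
have r_gt0 : 0 < r by rewrite sqrtr_gt0 divr_gt0.
have r_neq0 : r != 0 by rewrite gt_eqF.
have T_neq0 : T != 0 by rewrite gt_eqF.
have rho_gt0 : 0 < rho by exact: lt_le_trans rho1.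
have rho_neq0 : rho != 0 by rewrite gt_eqF.
have r2 : nrm2 x = n%:R * r ^+ 2.
  by rewrite sqr_sqrtr ?divr_ge0 ?nrm2_ge0// mulrCA divff// mulr1.
have Tr_gt0 : 0 < T * r by rewrite mulr_gt0.
pose b i := if `|x i| <= T * r then x i else 0.
pose S := [set i | T * r / rho < `|x i|].
pose D i j := W i j - E i j.
have -> : qf D x = qf D b + \sum_i \sum_j (D i j * x i * x j - D i j * b i * b j).
  rewrite /qf -big_split; apply: eq_bigr => i _; rewrite -big_split.
  by apply: eq_bigr => j _ /=; rewrite addrC subrK.
have bulk : `|qf D b| <= T ^+ 2 * kappa * nrm2 x.
  have -> : b = (fun i => (T * r) * (b i / (T * r))).
    by apply/funext => i; rewrite mulrC divfK// gt_eqF.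
  rewrite qfZ normrM ger0_norm ?sqr_ge0// r2 exprMn.
  rewrite [leRHS](_ : _ = T ^+ 2 * r ^+ 2 * (kappa * n%:R)); last by ring.
  have hb i : `|b i / (T * r)| <= 1.
    rewrite /b normrM normfV (gtr0_norm Tr_gt0) ler_pdivrMr// mul1r.
    by case: ifP; rewrite ?normr0 ?(ltW Tr_gt0).
  rewrite ler_wpM2l//; first by apply: mulr_ge0; exact: sqr_ge0.
  exact: (cut _ _ hb hb).
have sumx : \sum_i `|x i| <= n%:R * r.
  have : \sum_i `|x i| <= \sum_(i < n) (r^-1 * x i ^+ 2 + r) / 2.
    apply: ler_sum => i _; rewrite -subr_ge0 -[x i ^+ 2]real_normK ?num_real//.
    have -> : (r^-1 * `|x i| ^+ 2 + r) / 2 - `|x i| = (`|x i| - r) ^+ 2 / (2 * r).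
      by field.
    by rewrite divr_ge0 ?sqr_ge0 ?mulr_ge0// ltW.
  rewrite -mulr_suml big_split /= -mulr_sumr sumr_const card_ord -[r *+ n]mulr_natl.
  rewrite -/(nrm2 x) r2 => /le_trans; apply.
  by rewrite le_eqVlt; apply/orP; left; apply/eqP; field.
have Spairs : \sum_i \sum_j (if (i \in S) && (j \in S) then N i j * `|x i| * `|x j| else 0)
    <= (beta * e + beta^-1 * Delta) * nrm2 x.
  have -> : \sum_i \sum_j (if (i \in S) && (j \in S) then N i j * `|x i| * `|x j| else 0) =
      \sum_(i in S) \sum_(j in S) N i j * `|x i| * `|x j|.
    rewrite [RHS]big_mkcond; apply: eq_bigr => i _; case: (i \in S) => /=.
      by rewrite [RHS]big_mkcond.
    by rewrite big1.
  have xS : \sum_(i in S) `|x i| ^+ 2 <= nrm2 x.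
    rewrite big_mkcond; apply: ler_sum => i _; rewrite real_normK ?num_real//.
    by case: ifP => // _; exact: sqr_ge0.
  have card_le (S' : {set 'I_n}) : S' \subset S -> #|S'|%:R * T ^+ 2 <= rho ^+ 2 * n%:R.
    move=> S'S; have : \sum_(i in S') (T * r / rho) ^+ 2 <= nrm2 x.
      apply: le_trans xS; apply: (@le_trans _ _ (\sum_(i in S') `|x i| ^+ 2)).
        apply: ler_sum => i /(fintype.subsetP S'S); rewrite inE => /ltW xi.
        by rewrite lerXn2r// nnegrE ?divr_ge0// ltW.
      rewrite [leLHS]big_mkcond [leRHS]big_mkcond; apply: ler_sum => i _.
      case: ifP => [/(fintype.subsetP S'S) ->//|_]; case: ifP => // _; exact: sqr_ge0.
    rewrite sumr_const -[_ *+ #|S'|]mulr_natl r2 expr_div_n exprMn.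
    rewrite [leLHS](_ : _ = (#|S'|%:R * T ^+ 2) / rho ^+ 2 * r ^+ 2); last by ring.
    by rewrite ler_pM2r ?exprn_gt0// ler_pdivrMr ?exprn_gt0// [n%:R * _]mulrC.
  apply: le_trans (@peeling N e beta (fun i => `|x i|) S N0 Nsym Ndiag beta0 _) _.
    by move=> S' /card_le/sparse.
  rewrite mulrDl lerD ?ler_wpM2l ?mulr_ge0 ?(ltW beta0)//.
  rewrite -mulrA ler_wpM2l ?invr_ge0 ?(ltW beta0)//.
  apply: (@le_trans _ _ (\sum_(i in S) Delta * `|x i| ^+ 2)).
    apply: ler_sum => i _; rewrite ler_wpM2r ?sqr_ge0//.
    apply: le_trans (NDelta i); rewrite [leLHS]big_mkcond; apply: ler_sum => j _.
    by case: ifP.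
  rewrite -mulr_sumr ler_wpM2l//.
  by apply: le_trans (NDelta (Ordinal n0)); exact: sumr_ge0.
have Nsum : \sum_i \sum_j N i j * (x i ^+ 2 + x j ^+ 2) / rho <= 2 * Delta / rho * nrm2 x.
  have h : \sum_i \sum_j N i j * x i ^+ 2 <= Delta * nrm2 x.
    rewrite /nrm2 mulr_sumr; apply: ler_sum => i _; rewrite -mulr_suml.
    by rewrite ler_wpM2r ?sqr_ge0.
  have h' : \sum_i \sum_j N i j * x j ^+ 2 <= Delta * nrm2 x.
    rewrite exchange_big; apply: le_trans h; rewrite le_eqVlt; apply/orP; left.
    by apply/eqP; apply: eq_bigr => i _; apply: eq_bigr => j _; rewrite Nsym.
  rewrite [leLHS](_ : _ = (\sum_i \sum_j N i j * x i ^+ 2 +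
      \sum_i \sum_j N i j * x j ^+ 2) / rho).
    rewrite [leRHS](_ : _ = (Delta * nrm2 x + Delta * nrm2 x) / rho); last by ring.
    by rewrite ler_pM2r ?invr_gt0// lerD.
  rewrite -big_split mulr_suml; apply: eq_bigr => i _; rewrite -big_split mulr_suml.
  by apply: eq_bigr => j _ /=; rewrite mulrDr.
have Esum : \sum_i \sum_j cE / n%:R * ((x i ^+ 2 * `|x j| + x j ^+ 2 * `|x i|) / (T * r))
    <= 2 * cE / T * nrm2 x.
  rewrite [leLHS](_ : _ = cE / n%:R / (T * r) * (2 * (nrm2 x * \sum_i `|x i|))).
    rewrite [leRHS](_ : _ = cE / n%:R / (T * r) * (2 * (nrm2 x * (n%:R * r)))); last first.
      by field; rewrite ?r_neq0 ?n_neq0 ?T_neq0.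
    rewrite ler_wpM2l ?divr_ge0 ?(ltW Tr_gt0) ?ler0n//.
    by rewrite ler_wpM2l// ler_wpM2l// nrm2_ge0.
  rewrite [2 * _](_ : _ = \sum_i \sum_j x i ^+ 2 * `|x j| + \sum_i \sum_j x j ^+ 2 * `|x i|).
    rewrite -big_split mulr_sumr; apply: eq_bigr => i _.
    rewrite -big_split mulr_sumr; apply: eq_bigr => j _ /=.
    by field; rewrite ?r_neq0 ?n_neq0 ?T_neq0.
  rewrite [X in _ = _ + X]exchange_big /= mulr_natl mulr2n; congr (_ + _);
  by rewrite /nrm2 mulr_suml; apply: eq_bigr => i _; rewrite mulr_sumr.
(* Off the bulk one entry exceeds [T * r]. For the matrix [W], either both vertices lie in [S] or
   the two entries differ by a factor [rho]; the mean part gains a factor [1 / (T * r)]. *)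
have rest : `|\sum_i \sum_j (D i j * x i * x j - D i j * b i * b j)| <=
   \sum_i \sum_j (Y * (if (i \in S) && (j \in S) then N i j * `|x i| * `|x j| else 0)
     + Y * (N i j * (x i ^+ 2 + x j ^+ 2) / rho)
     + cE / n%:R * ((x i ^+ 2 * `|x j| + x j ^+ 2 * `|x i|) / (T * r))).
  apply: le_trans (ler_norm_sum _ _ _) _; apply: ler_sum => i _.
  apply: le_trans (ler_norm_sum _ _ _) _; apply: ler_sum => j _.
  have ge1 : 0 <= Y * (if (i \in S) && (j \in S) then N i j * `|x i| * `|x j| else 0).
    by rewrite mulr_ge0//; case: ifP => // _; rewrite !mulr_ge0.
  have ge2 : 0 <= Y * (N i j * (x i ^+ 2 + x j ^+ 2) / rho).
    by rewrite mulr_ge0// divr_ge0 ?(ltW rho_gt0)// mulr_ge0// addr_ge0// sqr_ge0.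
  have cEn : 0 <= cE / n%:R by rewrite divr_ge0 ?ler0n.
  have ge3 : 0 <= cE / n%:R * ((x i ^+ 2 * `|x j| + x j ^+ 2 * `|x i|) / (T * r)).
    rewrite mulr_ge0// divr_ge0 ?(ltW Tr_gt0)//.
    by rewrite addr_ge0// mulr_ge0// sqr_ge0.
  have [/andP[bi bj]|nb] := boolP ((`|x i| <= T * r) && (`|x j| <= T * r)).
    by rewrite /b bi bj subrr normr0 !addr_ge0.
  have -> : D i j * b i * b j = 0.
    by move: nb; rewrite /b; case: ifP; case: ifP; rewrite //= ?mulr0 ?mul0r.
  rewrite subr0 !normrM.
  have DYE : `|D i j| <= Y * N i j + cE / n%:R.
    by apply: le_trans (ler_normB _ _) _; rewrite lerD.
  apply: (@le_trans _ _ ((Y * N i j + cE / n%:R) * (`|x i| * `|x j|))).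
    by rewrite -mulrA ler_wpM2r// mulr_ge0.
  have prodge0 : 0 <= `|x i| * `|x j| by rewrite mulr_ge0.
  rewrite mulrDl lerD//; last first.
    rewrite ler_wpM2l// ler_pdivlMr//.
    move: nb; rewrite negb_and -!ltNge => /orP[/ltW H|/ltW H].
      apply: (@le_trans _ _ (x i ^+ 2 * `|x j|)); last first.
        by rewrite lerDl mulr_ge0// sqr_ge0.
      apply: le_trans (ler_wpM2l prodge0 H) _; rewrite mulrAC -expr2.
      by rewrite real_normK ?num_real.
    apply: (@le_trans _ _ (x j ^+ 2 * `|x i|)); last first.
      by rewrite lerDr mulr_ge0// sqr_ge0.
    apply: le_trans (ler_wpM2l prodge0 H) _; rewrite -mulrA -expr2 mulrC.
    by rewrite real_normK ?num_real.
  rewrite -mulrA -mulrDr ler_wpM2l//.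
  have cmp (u v : R) : 0 <= u -> T * r < u -> 0 <= v -> v <= T * r / rho ->
      u * v <= (u ^+ 2 + v ^+ 2) / rho.
    move=> u0 uT v0 vT; apply: (@le_trans _ _ (u ^+ 2 / rho)).
      rewrite expr2 -mulrA ler_wpM2l//; apply: le_trans vT _.
      by rewrite ler_pM2r ?invr_gt0// ltW.
    by rewrite ler_pM2r ?invr_gt0// lerDl sqr_ge0.
  have inS k : T * r < `|x k| -> k \in S.
    rewrite inE => H; apply: le_lt_trans H; rewrite ler_pdivrMr//.
    by rewrite ler_peMr// ltW.
  rewrite -[_ * _ / rho]mulrA -[x i ^+ 2]real_normK ?num_real//.
  rewrite -[x j ^+ 2]real_normK ?num_real//.
  move: nb; rewrite negb_and -!ltNge => /orP[H|H].
    rewrite (inS _ H) /=; have [jS|jS] := boolP (j \in S).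
      by rewrite -mulrA lerDl mulr_ge0// divr_ge0 ?(ltW rho_gt0)// addr_ge0// sqr_ge0.
    by rewrite add0r ler_wpM2l// cmp//; move: jS; rewrite inE -leNgt.
  rewrite (inS _ H) andbT; have [iS|iS] := boolP (i \in S).
    by rewrite -mulrA lerDl mulr_ge0// divr_ge0 ?(ltW rho_gt0)// addr_ge0// sqr_ge0.
  rewrite add0r ler_wpM2l// mulrC addrC cmp//; move: iS; rewrite inE -leNgt//.
apply: le_trans (ler_normD _ _) _; rewrite [leRHS]mulrDl addrC lerD//.
apply: le_trans rest _.
under eq_bigr do rewrite big_split big_split /= -!mulr_sumr.
rewrite big_split big_split /= -!mulr_sumr.
rewrite [leRHS]mulrDl [X in _ <= X + _]mulrDl !lerD//.
- by rewrite -mulrA ler_wpM2l.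
- rewrite [leRHS](_ : _ = Y * (2 * Delta / rho * nrm2 x)); last by ring.
  by rewrite ler_wpM2l.
- by move: Esum; under eq_bigr do rewrite -mulr_sumr; rewrite -mulr_sumr.
Qed.

End Vectors.

(** * Eigenvector perturbation *)

Section Spectral.
Context {R : realType} {n : nat}.
Implicit Types (x y z s o : 'I_n -> R) (A B W N : 'I_n -> 'I_n -> R).

Lemma nrm2B x y : nrm2 (fun i => x i - y i) = nrm2 x - 2 * dot x y + nrm2 y.
Proof.
transitivity (nrm2 (fun i => x i + (-1) * y i)); last by rewrite nrm2_addZ; ring.
by apply: eq_bigr => i _; rewrite mulN1r.
Qed.

(** Testing with [s] bounds [lam] from below. Splitting [y] along the nearly orthogonal [s] and [o]
    bounds it from above by an average of [l] and [kp], and the two bounds leave little mass off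
    [s]. As [k] may be negative, [kp] is a nonnegative bound for it. *)
Lemma top_eigenvector_close B s o y l k kp e bal lam :
  nrm2 s = 1 -> nrm2 o = 1 -> `|dot s o| <= bal -> bal <= 1 ->
  nrm2 y = 1 -> qf B y = lam -> (forall x, qf B x <= lam * nrm2 x) ->
  (forall x, `|qf B x - (l * dot s x ^+ 2 + k * dot o x ^+ 2)| <= e * nrm2 x) ->
  k <= kp -> 0 <= kp -> kp < l ->
  l - `|k| * bal - e <= lam /\
  exists r : bool, nrm2 (fun i => sg r * y i - s i) <=
    2 * (2 * e + `|k| * bal + 3 * kp * bal) / (l - kp).
Proof.
move=> s1 o1 so bal1 y1 By top approx kkp kp0 kpl.
have bal0 : 0 <= bal by exact: le_trans so.
have lam_ge : l - `|k| * bal - e <= lam.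
  have := top s; have := approx s; rewrite s1 !mulr1 dotxx s1 [dot o s]dotC.
  rewrite ler_norml => /andP[h _] h2.
  have : `|k * dot s o ^+ 2| <= `|k| * bal.
    rewrite normrM ler_wpM2l// normrX expr2 -[leRHS]mulr1 ler_pM//.
    exact: le_trans bal1.
  by rewrite ler_norml => /andP[h3 _]; lra.
split=> //.
set a := dot s y.
have a2 : a ^+ 2 <= 1 by rewrite (le_trans (cauchy_schwarz _ _))// s1 y1 mulr1.
have a1 : `|a| <= 1 by rewrite -(@expr_le1 _ 2)// real_normK ?num_real.
pose z i := y i + (- a) * s i.
have z2 : nrm2 z = 1 - a ^+ 2 by rewrite nrm2_addZ y1 s1 [dot y s]dotC -/a; ring.
have oy : dot o y = a * dot s o + dot o z.
  rewrite [dot o z]dotC /z dotDl dotZl [dot y o]dotC; ring.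
have oz2 : dot o z ^+ 2 <= 1 - a ^+ 2.
  by apply: le_trans (cauchy_schwarz _ _) _; rewrite o1 z2 mul1r.
have oz1 : `|dot o z| <= 1.
  rewrite -(@expr_le1 _ 2)// real_normK ?num_real//; have := sqr_ge0 a; lra.
have oy2 : dot o y ^+ 2 <= 1 - a ^+ 2 + 3 * bal.
  have t1 : `|a * dot s o| <= bal.
    by rewrite normrM -[leRHS]mul1r ler_pM.
  have t2 : (a * dot s o) ^+ 2 <= bal.
    rewrite -real_normK ?num_real// expr2 -[leRHS]mulr1 ler_pM//.
    exact: le_trans bal1.
  have t3 : a * dot s o * dot o z <= bal.
    apply: le_trans (ler_norm _) _; rewrite normrM -[leRHS]mulr1 ler_pM//.
  rewrite oy sqrrD; lra.
have main : (l - kp) * (1 - a ^+ 2) <= 2 * e + `|k| * bal + 3 * kp * bal.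
  have := approx y; rewrite y1 mulr1 By -/a ler_norml => /andP[_ h].
  have h1 : k * dot o y ^+ 2 <= kp * (1 - a ^+ 2 + 3 * bal).
    apply: (@le_trans _ _ (kp * dot o y ^+ 2)); first by rewrite ler_wpM2r ?sqr_ge0.
    by rewrite ler_wpM2l.
  have h2 : lam <= l * a ^+ 2 + kp * (1 - a ^+ 2 + 3 * bal) + e by lra.
  have e1 : (l - kp) * (1 - a ^+ 2) = l - kp - l * a ^+ 2 + kp * a ^+ 2 by ring.
  have e2 : kp * (1 - a ^+ 2 + 3 * bal) = kp - kp * a ^+ 2 + 3 * kp * bal by ring.
  rewrite e1; rewrite e2 in h2; lra.
(* With the sign of [a] the squared distance is [2 - 2 * |a|], at most [2 * (1 - a ^ 2)] since
   [|a| <= 1]. *)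
exists (0 <= a); rewrite nrm2B nrm2Z dotZl [dot y s]dotC -/a y1 s1 mulr1.
rewrite expr2 sg_sqr.
have -> : sg (0 <= a) * a = `|a|.
  rewrite /sg; case: (lerP 0 a) => ha; first by rewrite mul1r ger0_norm.
  by rewrite mulN1r ltr0_norm.
apply: (@le_trans _ _ (2 * (1 - a ^+ 2))).
  rewrite -[a ^+ 2]real_normK ?num_real//.
  have : `|a| ^+ 2 <= `|a| by rewrite expr2 -[leRHS]mulr1 ler_wpM2l.
  lra.
by rewrite -mulrA ler_wpM2l// ler_pdivlMr ?subr_gt0// mulrC.
Qed.

(** Orthogonality to [y] makes the component of [z] along the nearby [s] small, so only the second
    eigenvalue and the error remain. This supplies the spectral gap that [eigenvector_perturbation]
    asks for. *)
Lemma qf_perp B s o y z l k kp e eps :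
  nrm2 o = 1 ->
  (forall x, `|qf B x - (l * dot s x ^+ 2 + k * dot o x ^+ 2)| <= e * nrm2 x) ->
  k <= kp -> 0 <= kp -> 0 <= l -> nrm2 (fun i => y i - s i) <= eps -> dot y z = 0 ->
  qf B z <= (l * eps + kp + e) * nrm2 z.
Proof.
move=> o1 approx kkp kp0 l0 ys yz.
have sz : dot s z ^+ 2 <= eps * nrm2 z.
  have -> : dot s z = dot (fun i => s i - y i) z.
    rewrite (_ : (fun i => s i - y i) = (fun i => s i + (-1) * y i)); last first.
      by apply/funext => i; rewrite mulN1r.
    by rewrite dotDl dotZl yz mulr0 addr0.
  apply: le_trans (cauchy_schwarz _ _) _; rewrite ler_wpM2r ?nrm2_ge0//.
  apply: le_trans ys; rewrite le_eqVlt; apply/orP; left; apply/eqP.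
  by apply: eq_bigr => i _; ring.
have oz : dot o z ^+ 2 <= nrm2 z.
  by apply: le_trans (cauchy_schwarz _ _) _; rewrite o1 mul1r.
have := approx z; rewrite ler_norml => /andP[_ h].
have h1 : k * dot o z ^+ 2 <= kp * nrm2 z.
  apply: (@le_trans _ _ (kp * dot o z ^+ 2)); first by rewrite ler_wpM2r ?sqr_ge0.
  by rewrite ler_wpM2l.
have h2 : l * dot s z ^+ 2 <= l * (eps * nrm2 z) by rewrite ler_wpM2l.
rewrite !mulrDl -[l * eps * _]mulrA; lra.
Qed.

(* Davis-Kahan: the component of [x] orthogonal to [y] is bounded by testing
   [B x] against it. *)
Lemma eigenvector_perturbation A B x y lA lB g :
  (forall i, \sum_j A i j * x j = lA * x i) ->
  (forall i, \sum_j B i j * y j = lB * y i) ->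
  (forall i j, B i j = B j i) -> nrm2 x = 1 -> nrm2 y = 1 -> 0 < g ->
  (forall z, dot y z = 0 -> qf B z <= (lA - g) * nrm2 z) -> 0 <= dot x y ->
  nrm2 (fun i => x i - y i) <=
  2 / g ^+ 2 * nrm2 (fun i => \sum_j (A i j - B i j) * x j).
Proof.
move=> Ax By Bsym x1 y1 g0 gap xy0.
set D := fun i => \sum_j (A i j - B i j) * x j.
set a := dot x y.
pose z i := x i + (- a) * y i.
have yz : dot y z = 0 by rewrite dotC dotDl dotZl dotxx y1 -/a; ring.
have xz : dot x z = nrm2 z.
  have : dot z z = dot x z + (- a) * dot y z by rewrite {1}/z dotDl dotZl.
  by rewrite yz mulr0 addr0 dotxx.
(* [B z] is expressed through both eigenvalue equations; the product with [z] kills the multiple of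
   [y]. *)
have key : qf B z = lA * nrm2 z - dot z D.
  have Bz i : \sum_j B i j * z j = lA * x i - D i - a * (lB * y i).
    rewrite -By -Ax /D mulr_sumr -!sumrB; apply: eq_bigr => j _; rewrite /z; ring.
  rewrite qf_dot; transitivity (dot z (fun i => lA * x i - D i - a * (lB * y i))).
    by apply: eq_bigr => i _; rewrite Bz.
  transitivity (lA * dot x z - dot z D - a * lB * dot y z).
    rewrite /dot !mulr_sumr -!sumrB; apply: eq_bigr => i _; ring.
  by rewrite xz yz mulr0 subr0.
have zD : g * nrm2 z <= dot z D by have := gap _ yz; rewrite key mulrBl; lra.
have gz : g ^+ 2 * nrm2 z <= nrm2 D.
  have [z0|zn0] := eqVneq (nrm2 z) 0; first by rewrite z0 mulr0 nrm2_ge0.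
  have z_gt0 : 0 < nrm2 z by rewrite lt_neqAle eq_sym zn0 nrm2_ge0.
  have : (g * nrm2 z) ^+ 2 <= nrm2 z * nrm2 D.
    apply: le_trans (cauchy_schwarz z D); rewrite lerXn2r// nnegrE.
      by rewrite mulr_ge0 ?nrm2_ge0// ltW.
    by apply: le_trans zD; rewrite mulr_ge0 ?nrm2_ge0// ltW.
  rewrite exprMn [leLHS](_ : _ = nrm2 z * (g ^+ 2 * nrm2 z)); last by ring.
  by rewrite ler_pM2l.
have z2 : nrm2 z = 1 - a ^+ 2 by rewrite nrm2_addZ x1 y1 -/a; ring.
have a1 : a <= 1.
  rewrite -(@expr_le1 _ 2)//; apply: le_trans (cauchy_schwarz x y) _.
  by rewrite x1 y1 mulr1.
rewrite nrm2B x1 y1 -/a.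
apply: (@le_trans _ _ (2 * nrm2 z)).
  rewrite z2; have : a ^+ 2 <= a by rewrite expr2 -[leRHS]mulr1 ler_wpM2l.
  lra.
rewrite -mulrA ler_wpM2l// ler_pdivlMl ?exprn_gt0//.
Qed.

(* Leave-one-out: for each [v] the vector [Y v] (an eigenvector computed
   without row [v]) replaces [X] in row [v] of the eigenvector equation, at a
   relative cost controlled by [X v] itself. *)
Lemma entrywise_approx W N Y X (Z : 'I_n -> 'I_n -> R) s lam c Delta b dl dl' :
  (0 < n)%N ->
  (forall i j, 0 <= N i j) -> (forall i, \sum_j N i j <= Delta) ->
  0 <= Y -> (forall i j, `|W i j| <= Y * N i j) -> (forall i, `|s i| = 1) ->
  0 < lam -> (forall v, \sum_w W v w * X w = lam * X v) ->
  0 <= c -> 0 <= dl' <= 1 -> 0 <= b ->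
  (forall v, nrm2 (fun w => X w - Z v w) <= c ^+ 2 * X v ^+ 2) ->
  (forall v, \sum_(w | dl' < `|Z v w - s w|) N v w <= dl) ->
  (forall v, \sum_j N v j ^+ 2 <= b ^+ 2) ->
  Y * b * c <= lam / 4 -> Y * (1 + c) * dl <= lam / 4 ->
  forall v, `|lam * X v - \sum_w W v w * s w| <=
    Y * b * c * (4 * Y * Delta / lam) +
    Y * (dl * ((1 + c) * (4 * Y * Delta / lam) + 1) + dl' * Delta).
Proof.
move=> n0 N0 ND Y0 WN s1 lam0 WX c0 /andP[dl'0 dl'1] b0 XZ bad Nb hb hdl.
have Delta0 : 0 <= Delta by apply: le_trans (ND (Ordinal n0)); exact: sumr_ge0.
have [v0 _ Xv0] := @arg_maxP _ _ _ (Ordinal n0) xpredT (fun i => `|X i|) isT.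
set M := `|X v0| in Xv0.
have XM v : `|X v| <= M by exact: Xv0.
have M0 : 0 <= M by exact: normr_ge0.
have diff v : \sum_w N v w * `|X w - Z v w| <= b * (c * `|X v|).
  have h : (\sum_w N v w * `|X w - Z v w|) ^+ 2 <= (b * (c * `|X v|)) ^+ 2.
    apply: le_trans (cauchy_schwarz (N v) (fun w => `|X w - Z v w|)) _.
    rewrite exprMn ler_pM ?nrm2_ge0//; first exact: Nb.
    rewrite exprMn real_normK ?num_real//; apply: le_trans (XZ v).
    by apply: ler_sum => w _; rewrite real_normK ?num_real.
  rewrite -(@ler_pXn2r _ 2)// nnegrE; last by rewrite !mulr_ge0.
  by apply: sumr_ge0 => w _; rewrite mulr_ge0.
have Zb v w : `|Z v w| <= (1 + c) * M.
  have h : `|X w - Z v w| <= c * `|X v|.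
    rewrite -(@ler_pXn2r _ 2)// ?nnegrE ?mulr_ge0// exprMn !real_normK ?num_real//.
    apply: le_trans (XZ v); rewrite /nrm2 (bigD1 w)//= lerDl.
    by apply: sumr_ge0 => *; exact: sqr_ge0.
  have -> : Z v w = X w - (X w - Z v w) by ring.
  apply: le_trans (ler_normB _ _) _; rewrite mulrDl mul1r lerD//.
  by apply: le_trans h _; rewrite ler_wpM2l.
have Wsum (v : 'I_n) (f : 'I_n -> R) : `|\sum_w W v w * f w| <= Y * \sum_w N v w * `|f w|.
  apply: le_trans (ler_norm_sum _ _ _) _; rewrite mulr_sumr; apply: ler_sum => w _.
  by rewrite normrM mulrA ler_wpM2r.
(* Vertices where [Z v] is far from [s] get the crude bound [a1] on a total weight [dl]; the others
   get [a2] on the whole degree. *)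
have split_sum v (f : 'I_n -> R) a1 a2 : 0 <= a1 -> 0 <= a2 ->
    (forall w, `|f w| <= a1) ->
    (forall w, `|Z v w - s w| <= dl' -> `|f w| <= a2) ->
    \sum_w N v w * `|f w| <= dl * a1 + Delta * a2.
  move=> a10 a20 fa1 fa2.
  rewrite (bigID (fun w => dl' < `|Z v w - s w|))/= lerD//.
    apply: (@le_trans _ _ ((\sum_(w | dl' < `|Z v w - s w|) N v w) * a1)).
      by rewrite mulr_suml; apply: ler_sum => w _; rewrite ler_wpM2l.
    by rewrite ler_wpM2r.
  apply: (@le_trans _ _ (\sum_w N v w * a2)); last by rewrite -mulr_suml ler_wpM2r.
  rewrite [leLHS]big_mkcond; apply: ler_sum => w _; case: ifP => h.
    by rewrite ler_wpM2l// fa2// leNgt.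
  by rewrite mulr_ge0.
(* Bootstrap on the largest entry: the two contributions proportional to [M] are at most
   [lam * M / 4] each and are absorbed, leaving [lam * M / 2 <= 2 * Y * Delta]. *)
have MB : M <= 4 * Y * Delta / lam.
  have e1 : lam * M <= Y * (b * (c * M)) + Y * (dl * ((1 + c) * M) + Delta * 2).
    rewrite /M -[X in X * _ <= _](gtr0_norm lam0) -normrM -WX.
    have -> : \sum_w W v0 w * X w = \sum_w W v0 w * (X w - Z v0 w) + \sum_w W v0 w * Z v0 w.
      by rewrite -big_split; apply: eq_bigr => w _ /=; ring.
    apply: le_trans (ler_normD _ _) _; rewrite lerD//.
      by apply: le_trans (Wsum _ _) _; rewrite ler_wpM2l.
    apply: le_trans (Wsum _ _) _; rewrite ler_wpM2l//; apply: split_sum => //.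
    - by rewrite mulr_ge0// addr_ge0.
    - move=> w h; have -> : Z v0 w = (Z v0 w - s w) + s w by ring.
      apply: le_trans (ler_normD _ _) _; rewrite s1; lra.
  have e2 : Y * (b * (c * M)) <= lam / 4 * M.
    by rewrite [leLHS](_ : _ = Y * b * c * M); [rewrite ler_wpM2r|ring].
  have e3 : Y * (dl * ((1 + c) * M)) <= lam / 4 * M.
    by rewrite [leLHS](_ : _ = Y * (1 + c) * dl * M); [rewrite ler_wpM2r|ring].
  rewrite ler_pdivlMr// mulrC; rewrite mulrDr in e1.
  have -> : 4 * Y * Delta = 2 * (Y * (Delta * 2)) by ring.
  lra.
set MM := 4 * Y * Delta / lam in MB *.
have MM0 : 0 <= MM by exact: le_trans MB.
move=> v.
have -> : lam * X v - \sum_w W v w * s w =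
   \sum_w W v w * (X w - Z v w) + \sum_w W v w * (Z v w - s w).
  by rewrite -WX -sumrB -big_split; apply: eq_bigr => w _ /=; ring.
apply: le_trans (ler_normD _ _) _; rewrite lerD//.
  apply: le_trans (Wsum _ _) _; rewrite -!mulrA ler_wpM2l//.
  apply: le_trans (diff v) _; rewrite ler_wpM2l// ler_wpM2l//.
  exact: le_trans (XM v) MB.
apply: le_trans (Wsum _ _) _; rewrite ler_wpM2l// [dl' * _]mulrC.
apply: split_sum => // [|w]; first by rewrite addr_ge0// mulr_ge0// addr_ge0.
apply: le_trans (ler_normB _ _) _; rewrite s1 lerD//.
apply: le_trans (Zb v w) _; rewrite ler_wpM2l// addr_ge0//.
Qed.

End Spectral.

(** * Top eigenvector and maximum of the quadratic form *)

Section Rayleigh.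
Context {R : realType} {n : nat}.
Implicit Types (M : 'M[R]_n) (u v : 'rV[R]_n).
Local Open Scope classical_set_scope.

Lemma sum_continuous (T : topologicalType) (I : finType) (f : I -> T -> R) :
  (forall i, continuous (f i)) -> continuous (fun x => \sum_i f i x).
Proof.
move=> fc; rewrite (_ : (fun _ => _) = \sum_i f i); last first.
  by apply/funext => x; rewrite fct_sumE.
elim/big_ind : _ => //; first by move=> x; exact: cvg_cst.
by move=> g h gc hc x; apply: cvgD; [exact: gc|exact: hc].
Qed.

Lemma coord_prod_continuous (c : R) (i j : 'I_n) :
  continuous (fun v : 'rV[R]_n => c * v 0 i * v 0 j).
Proof.
have coord_c k : continuous (fun v : 'rV[R]_n => v 0 k : R).
  by move=> v; exact: coord_continuous.
move=> v; have h1 := @continuousM _ _ (cst c) _ v (@cst_continuous _ _ c v) (coord_c i v).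
exact: (continuousM h1 (coord_c j v)).
Qed.

Lemma qf_continuous (M : 'I_n -> 'I_n -> R) :
  continuous (fun v : 'rV[R]_n => qf M (v 0)).
Proof.
apply: sum_continuous => i; apply: sum_continuous => j.
exact: coord_prod_continuous.
Qed.

Lemma nrm2_continuous : continuous (fun v : 'rV[R]_n => nrm2 (v 0)).
Proof.
apply: sum_continuous => i.
rewrite (_ : (fun _ => _) = (fun v : 'rV[R]_n => 1 * v 0 i * v 0 i)).
  exact: coord_prod_continuous.
by apply/funext => v; rewrite mul1r.
Qed.

Lemma sphere_compact : compact [set v : 'rV[R]_n | nrm2 (v 0) = 1].
Proof.
apply: bounded_closed_compact.
  exists 1; split => // r r1 v /= v1.
  apply: le_trans (ltW r1); rewrite [leLHS]/Num.norm /= mx_normrE.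
  apply: bigmax_le => // -[i j] _ /=; rewrite ord1.
  rewrite -(@expr_le1 _ 2)// real_normK ?num_real// -v1 /nrm2 (bigD1 j)//=.
  by rewrite lerDl sumr_ge0// => *; exact: sqr_ge0.
apply: (@preimage_closed _ _ (fun v : 'rV[R]_n => nrm2 (v 0)) [set x | x = 1]).
  by move=> *; exact: nrm2_continuous.
exact: closed_eq.
Qed.

(** First-order condition at a maximum. The test value [e = b * t] with [t = 1 / (1 + |a|)] is short
    enough for the linear term to dominate. *)
Lemma quadratic_le0 (a b : R) : (forall e, b * e + a * e ^+ 2 <= 0) -> b = 0.
Proof.
move=> H; apply/eqP; rewrite -sqrf_eq0 eq_le sqr_ge0 andbT.
pose t : R := (1 + `|a|)^-1.
have t0 : 0 < t by rewrite invr_gt0 ltr_wpDr.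
have h : 0 < 1 + a * t.
  have : `|a * t| < 1.
    rewrite normrM (gtr0_norm t0) ltr_pdivrMr ?ltr_wpDr// mul1r; lra.
  by rewrite ltr_norml; lra.
have := H (b * t).
rewrite (_ : b * (b * t) + _ = b ^+ 2 * t * (1 + a * t)); last by ring.
by rewrite pmulr_lle0// pmulr_lle0.
Qed.

(** [largest_eigenvalue] only compares eigenvalues, while perturbation theory needs a bound on the
    whole quadratic form. The maximum over the compact sphere is attained, and a maximiser is an
    eigenvector, so the maximum is itself an eigenvalue. *)
Lemma top_eigenvector_rayleigh M u : M^T = M -> top_unit_eigenvector M u ->
  exists lam, (forall i, \sum_j M i j * u 0 j = lam * u 0 i) /\
    forall x : 'I_n -> R, qf M x <= lam * nrm2 x.
Proof.
move=> Msym [u1 [lam [[_ lam_max] uM]]].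
have symE i j : M i j = M j i by rewrite -{1}Msym mxE.
exists lam; split.
  move=> i; have := congr1 (fun w : 'rV_n => w 0 i) uM; rewrite !mxE => <-.
  by apply: eq_bigr => j _; rewrite mulrC symE.
have [c /set_mem /= c1 cmax] : exists2 c : 'rV[R]_n, c \in [set v : 'rV[R]_n | nrm2 (v 0) = 1] &
    forall t, t \in [set v : 'rV[R]_n | nrm2 (v 0) = 1] -> qf M (t 0) <= qf M (c 0).
  apply: (@compact_EVT_max _ _ (fun v : 'rV[R]_n => qf M (v 0))).
  - by exists u; rewrite /= /nrm2.
  - exact: sphere_compact.
  - exact/continuous_subspaceT/qf_continuous.
set mu := qf M (c 0) in cmax.
have mu_max (x : 'I_n -> R) : qf M x <= mu * nrm2 x.
  have [x0|xn0] := eqVneq (nrm2 x) 0.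
    rewrite x0 mulr0 /qf big1// => i _; rewrite big1// => j _.
    by rewrite (nrm2_eq0 x0 j) mulr0.
  have x_gt0 : 0 < nrm2 x by rewrite lt_neqAle eq_sym xn0 nrm2_ge0.
  pose r := Num.sqrt (nrm2 x).
  have r0 : 0 < r by rewrite sqrtr_gt0.
  have r2 : r ^+ 2 = nrm2 x by rewrite sqr_sqrtr// ltW.
  pose t : 'rV[R]_n := \row_i (r^-1 * x i).
  have tE : t 0 = (fun i => r^-1 * x i) by apply/funext => i; rewrite mxE.
  have /cmax : t \in [set v : 'rV[R]_n | nrm2 (v 0) = 1].
    by apply/mem_set; rewrite /= tE nrm2Z exprVn r2 mulVf.
  by rewrite tE qfZ exprVn r2 ler_pdivrMl// mulrC.
have cM : c *m M = mu *: c.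
  (* [r] is the residual at the maximiser. Moving [c] along [r] changes [qf M - mu * nrm2] at first
     order by [2 * e * nrm2 r], which must vanish. *)
  pose r i := \sum_j M i j * c 0 j - mu * c 0 i.
  suff r0 : nrm2 r = 0.
    apply/rowP => i; rewrite !mxE.
    have /eqP := nrm2_eq0 r0 i; rewrite /r subr_eq0 => /eqP <-.
    by apply: eq_bigr => j _; rewrite mulrC symE.
  apply: (@mulfI _ 2); rewrite // mulr0.
  apply: (@quadratic_le0 (qf M r - mu * nrm2 r)) => e.
  have := mu_max (fun i => c 0 i + e * r i); rewrite nrm2_addZ c1.
  have -> : qf M (fun i => c 0 i + e * r i) =
      mu + 2 * e * (\sum_i r i * \sum_j M i j * c 0 j) + e ^+ 2 * qf M r.
    transitivity (mu + (\sum_i \sum_j M i j * c 0 i * (e * r j) +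
        \sum_i \sum_j M i j * (e * r i) * c 0 j) + qf M (fun i => e * r i)).
      rewrite /mu /qf -!big_split; apply: eq_bigr => i _.
      by rewrite -!big_split; apply: eq_bigr => j _ /=; ring.
    rewrite qfZ; congr (_ + _ + _).
    rewrite exchange_big /= -big_split mulr_sumr; apply: eq_bigr => i _ /=.
    rewrite mulr_sumr mulr_sumr -big_split; apply: eq_bigr => j _ /=.
    by rewrite [M j i]symE; ring.
  have -> : nrm2 r = (\sum_i r i * \sum_j M i j * c 0 j) - mu * dot (c 0) r.
    rewrite /nrm2 /dot mulr_sumr -sumrB; apply: eq_bigr => i _.
    by rewrite expr2 {1}/r; ring.
  set X := \sum_i _; set Z := dot _ _; set Q := qf M r.
  lra.
move=> x; apply: le_trans (mu_max x) _; rewrite ler_wpM2r ?nrm2_ge0//.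
apply: lam_max; apply/eigenvalueP; exists c => //.
apply/eqP => c0; have := c1; rewrite c0 /nrm2 big1 => [/esym/eqP|i _].
  by rewrite oner_eq0.
by rewrite mxE expr0n.
Qed.

End Rayleigh.

(** * Chernoff bounds *)

Section RealBounds.
Context {R : realType}.

(** From [exp (- x) >= 1 - x] and [(1 - x) * (1 + x + 2 * x ^ 2) = 1 + x ^ 2 * (1 - 2 * x)]. *)
Lemma expR_le_quadratic (x : R) : `|x| <= 2^-1 -> expR x <= 1 + x + 2 * x ^+ 2.
Proof.
rewrite ler_norml => /andP[_ x2].
have h : 1 - x <= expR (- x) by exact: expR_ge1Dx.
have h0 : 0 < 1 - x by lra.
have -> : expR x = (expR (- x))^-1 by rewrite expRN invrK.
apply: (@le_trans _ _ (1 - x)^-1); first by rewrite lef_pV2// posrE expR_gt0.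
rewrite -[leLHS]div1r ler_pdivrMr// mulrC -subr_ge0.
have -> : (1 - x) * (1 + x + 2 * x ^+ 2) - 1 = x ^+ 2 * (1 - 2 * x) by ring.
by rewrite mulr_ge0 ?sqr_ge0//; lra.
Qed.

Lemma prodr_le_exp (J : finType) (P : pred J) (F : J -> R) c :
  (forall j, P j -> 0 <= F j <= expR c) -> \prod_(j | P j) F j <= expR (c * #|P|%:R).
Proof.
move=> FP; rewrite expRM_natr -prodr_const.
exact: ler_prod.
Qed.

Lemma indicator_le_exp (b : bool) (x : R) : (b -> 0 <= x) -> b%:R <= expR x.
Proof.
case: b => [/(_ isT) x0|_] /=; last exact: expR_ge0.
by rewrite -[leLHS]expR0 ler_expR.
Qed.

End RealBounds.

Section Bounds.
Context {R : realType} {n : nat}.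
Implicit Types (G : observation n) (sigma : labels n) (i j u v w : 'I_n).
Variables p q alpha : R.
Hypotheses (hp : 0 < p < 1) (hq : 0 < q < 1) (ha : 0 < alpha < 1).

Definition rev G i j : bool := pair_status G i j != None.

Lemma revC G i j : rev G i j = rev G j i.
Proof. by rewrite /rev pair_statusC. Qed.

Lemma rev_diag G i : rev G i i = false.
Proof. by rewrite /rev pair_status_diag. Qed.

Definition label_prob (b : bool) : R := if b then p else q.

Lemma label_prob01 b : 0 < label_prob b < 1.
Proof. by case: b. Qed.

Lemma status_law_sum b (f : status -> R) :
  \sum_s status_law p q alpha b s * f s = (1 - alpha) * f None +
   alpha * (label_prob b * f (Some true) + (1 - label_prob b) * f (Some false)).
Proof. by rewrite sum_status /label_prob; case: b => /=; ring. Qed.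

Lemma status_law_ge0 b s : 0 <= status_law p q alpha b s.
Proof.
move: ha (label_prob01 b) => /andP[a0 a1] /andP[l0 l1].
case: s => [c|] /=; last by rewrite subr_ge0 ltW.
by rewrite mulr_ge0 ?(ltW a0)//; case: c => /=; rewrite ?subr_ge0 ltW.
Qed.

(** Each revelation has exponential moment [1 + alpha * (exp theta - 1)], at most
    [exp (alpha * exp theta)]. *)
Lemma revealed_exp sigma (P : pred ('I_n * 'I_n)) theta :
  (forall z, P z -> z.1 != z.2) ->
  {in P &, injective (fun z => [set z.1; z.2])} -> 0 <= theta ->
  pE (pair_law p q alpha sigma) (fun G => expR (theta * \sum_(z | P z) (rev G z.1 z.2)%:R)) <=
  expR (alpha * expR theta * #|P|%:R).
Proof.
move=> Pne Pinj th0.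
pose g (z : 'I_n * 'I_n) (s : status) : R := expR (theta * (s != None)%:R).
rewrite (@eq_pE _ _ _ _ _ (fun G => \prod_(z | P z) g z (pair_status G z.1 z.2))); last first.
  by move=> G; rewrite mulr_sumr expR_sum.
rewrite (@pE_pairs R n p q alpha sigma P g)//; apply: prodr_le_exp => z Pz.
rewrite status_law_sum /g /= mulr0 expR0 !mulr1.
have -> : 1 - alpha + alpha * (label_prob (sigma z.1 == sigma z.2) * expR theta +
    (1 - label_prob (sigma z.1 == sigma z.2)) * expR theta) =
   1 + alpha * (expR theta - 1) by ring.
move: ha => /andP[a0 a1]; apply/andP; split.
  rewrite addr_ge0// mulr_ge0 ?(ltW a0)// subr_ge0 -[leLHS]expR0 ler_expR//.
apply: le_trans (expR_ge1Dx _) _; rewrite ler_expR ler_wpM2l ?(ltW a0)//.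
by rewrite lerBlDr lerDl.
Qed.

Lemma revealed_chernoff sigma (P : pred ('I_n * 'I_n)) theta a :
  (forall z, P z -> z.1 != z.2) ->
  {in P &, injective (fun z => [set z.1; z.2])} -> 0 <= theta ->
  pE (pair_law p q alpha sigma)
    (fun G => (a < \sum_(z | P z) (rev G z.1 z.2)%:R)%R%:R) <=
  expR (alpha * expR theta * #|P|%:R - theta * a).
Proof.
move=> Pne Pinj th0.
apply: (@le_trans _ _ (pE (pair_law p q alpha sigma) (fun G =>
   expR (- (theta * a)) * expR (theta * \sum_(z | P z) (rev G z.1 z.2)%:R)))).
  apply: le_pE => [e s|G]; first exact: pair_law_ge0.
  rewrite -expRD; apply: indicator_le_exp => /ltW h.
  by rewrite addrC -mulrBr mulr_ge0// subr_ge0.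
rewrite pEZ addrC expRD ler_wpM2l ?expR_ge0//; exact: revealed_exp.
Qed.

(** [kl true] is the relative entropy of Bernoulli(p) with respect to Bernoulli(q); [kl false] is
    minus the relative entropy with the roles exchanged. *)
Definition kl (b : bool) : R :=
  label_prob b * llr p q (Some true) + (1 - label_prob b) * llr p q (Some false).

Definition llr_bound : R := `|llr p q (Some true)| + `|llr p q (Some false)|.

Lemma normr_llr s : `|llr p q s| <= llr_bound.
Proof.
case: s => [[]|]; rewrite /llr_bound ?lerDl ?lerDr//.
by rewrite /= normr0 addr_ge0.
Qed.

(** Conditional mean of [llr_mx] off the diagonal. On the diagonal, where [llr_mx] is 0, the same
    formula is kept so that the matrix has rank at most two. *)
Definition mean_mx sigma i j : R := alpha * kl (sigma i == sigma j).

Lemma normr_mean_mx sigma i j : `|mean_mx sigma i j| <= alpha * llr_bound.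
Proof.
have /andP[a0 _] := ha; rewrite /mean_mx normrM (gtr0_norm a0) ler_wpM2l ?(ltW a0)//.
set b := sigma i == sigma j; have /andP[b0 b1] := label_prob01 b.
have h1 := normr_llr (Some true); have h0 := normr_llr (Some false).
apply: le_trans (ler_normD _ _) _; rewrite !normrM (gtr0_norm b0).
rewrite (@gtr0_norm _ (1 - _)) ?subr_gt0//.
have e0 := ler_wpM2l (ltW b0) h1.
have b1' : 0 <= 1 - label_prob b by rewrite subr_ge0 ltW.
have e2 := ler_wpM2l b1' h0.
by apply: le_trans (lerD e0 e2) _; rewrite -mulrDl addrC subrK mul1r.
Qed.

(** The exponent stays below 1/2, where [expR_le_quadratic] applies: linear terms cancel against the
    mean, quadratic ones give the variance. Coefficients go up to 2 because a bilinear form in two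
    sign vectors puts two sign products on each unordered pair. *)
Lemma cut_exp sigma (P : pred ('I_n * 'I_n)) (c : 'I_n * 'I_n -> R) theta :
  (forall z, P z -> z.1 != z.2) ->
  {in P &, injective (fun z => [set z.1; z.2])} -> 0 <= theta ->
  (forall z, `|c z| <= 2) -> theta * (2 * llr_bound) <= 2^-1 ->
  pE (pair_law p q alpha sigma) (fun G => expR (theta *
     \sum_(z | P z) c z * (llr_mx p q G z.1 z.2 - mean_mx sigma z.1 z.2))) <=
  expR (alpha * (8 * theta ^+ 2 * llr_bound ^+ 2) * #|P|%:R).
Proof.
move=> Pne Pinj th0 c2 thY.
pose g (z : 'I_n * 'I_n) (s : status) : R :=
  expR (theta * (c z * (llr p q s - mean_mx sigma z.1 z.2))).
rewrite (@eq_pE _ _ _ _ _ (fun G => \prod_(z | P z) g z (pair_status G z.1 z.2))); last first.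
  by move=> G; rewrite mulr_sumr expR_sum.
rewrite (@pE_pairs R n p q alpha sigma P g)//; apply: prodr_le_exp => z Pz.
apply/andP; split.
  by apply: sumr_ge0 => s _; rewrite mulr_ge0 ?status_law_ge0 ?expR_ge0.
set b := sigma z.1 == sigma z.2; pose k := theta * c z.
have kb : `|k| <= theta * 2.
  by rewrite normrM (ger0_norm th0) ler_wpM2l.
have Y0 : 0 <= llr_bound by rewrite addr_ge0.
have kl2 s : `|k * llr p q s| <= 2^-1.
  rewrite normrM; apply: le_trans thY; rewrite [leRHS]mulrA.
  by rewrite ler_pM// normr_llr.
have kl3 s : (k * llr p q s) ^+ 2 <= 4 * theta ^+ 2 * llr_bound ^+ 2.
  rewrite [leRHS](_ : _ = (theta * 2 * llr_bound) ^+ 2); last by ring.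
  rewrite -real_normK ?num_real// lerXn2r ?nnegrE ?mulr_ge0// normrM.
  by rewrite ler_pM// normr_llr.
rewrite (eq_bigr (fun s => expR (- (k * mean_mx sigma z.1 z.2)) *
    (status_law p q alpha b s * expR (k * llr p q s)))); last first.
  by move=> s _; rewrite mulrCA -expRD; congr (_ * expR _); rewrite /k; ring.
rewrite -mulr_sumr status_law_sum /= mulr0 expR0 mulr1.
rewrite -ler_pdivlMl ?expR_gt0// -expRN opprK -expRD.
move: ha => /andP[a0 a1]; have /andP[l0 l1] := label_prob01 b.
set B := 4 * theta ^+ 2 * llr_bound ^+ 2 in kl3.
have quad s : expR (k * llr p q s) <= 1 + k * llr p q s + 2 * B.
  by apply: le_trans (expR_le_quadratic (kl2 s)) _; rewrite lerD2l ler_wpM2l.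
apply: (@le_trans _ _ (1 + alpha * (k * kl b + 2 * B))).
  have -> : 1 + alpha * (k * kl b + 2 * B) = 1 - alpha +
      alpha * (label_prob b * (1 + k * llr p q (Some true) + 2 * B) +
               (1 - label_prob b) * (1 + k * llr p q (Some false) + 2 * B)).
    by rewrite /kl; ring.
  rewrite lerD2l ler_wpM2l ?(ltW a0)//.
  apply: lerD.
    by apply: ler_wpM2l; [exact: (ltW l0)|exact: (quad (Some true))].
  apply: ler_wpM2l; last exact: (quad (Some false)).
  by rewrite subr_ge0; exact: (ltW l1).
apply: le_trans (expR_ge1Dx _) _; rewrite ler_expR /mean_mx -/b /B.
by rewrite le_eqVlt; apply/orP; left; apply/eqP; ring.
Qed.

Lemma cut_chernoff sigma (P : pred ('I_n * 'I_n)) (c : 'I_n * 'I_n -> R) theta a :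
  (forall z, P z -> z.1 != z.2) ->
  {in P &, injective (fun z => [set z.1; z.2])} -> 0 <= theta ->
  (forall z, `|c z| <= 2) -> theta * (2 * llr_bound) <= 2^-1 ->
  pE (pair_law p q alpha sigma) (fun G =>
    (a < \sum_(z | P z) c z * (llr_mx p q G z.1 z.2 - mean_mx sigma z.1 z.2))%R%:R) <=
  expR (alpha * (8 * theta ^+ 2 * llr_bound ^+ 2) * #|P|%:R - theta * a).
Proof.
move=> Pne Pinj th0 c2 thY.
apply: (@le_trans _ _ (pE (pair_law p q alpha sigma) (fun G =>
   expR (- (theta * a)) * expR (theta *
    \sum_(z | P z) c z * (llr_mx p q G z.1 z.2 - mean_mx sigma z.1 z.2))))).
  apply: le_pE => [e s|G]; first exact: pair_law_ge0.
  rewrite -expRD; apply: indicator_le_exp => /ltW h.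
  by rewrite addrC -mulrBr mulr_ge0// subr_ge0.
rewrite pEZ addrC expRD ler_wpM2l ?expR_ge0//; exact: cut_exp.
Qed.

(* Equal to [sqrt (p * q) + sqrt ((1 - p) * (1 - q))]. *)
Definition bhattacharyya : R := p * expR (- (llr p q (Some true) / 2)) +
  (1 - p) * expR (- (llr p q (Some false) / 2)).

Lemma expR_llr : p * expR (- llr p q (Some true)) = q /\
  (1 - p) * expR (- llr p q (Some false)) = 1 - q.
Proof.
move: hp hq => /andP[p0 p1] /andP[q0 q1]; rewrite !expRN /=.
rewrite !lnK ?posrE ?divr_gt0 ?subr_gt0//; split; field.
  by rewrite !gt_eqF.
by rewrite !gt_eqF ?subr_gt0.
Qed.

Lemma bhattacharyya_gt0 : 0 < bhattacharyya.
Proof.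
move: hp => /andP[p0 p1].
by rewrite addr_gt0// mulr_gt0 ?expR_gt0// subr_gt0.
Qed.

(** Arithmetic-geometric mean inequality on each of the two terms, strict on the first because
    [p != q]. *)
Lemma bhattacharyya_lt1 : p != q -> bhattacharyya < 1.
Proof.
move=> pq; move: hp hq => /andP[p0 p1] /andP[q0 q1].
have [e1 e2] := expR_llr.
set L1 := llr p q (Some true) in e1 *; set L0 := llr p q (Some false) in e2 *.
have half (x : R) : expR (- x) = expR (- (x / 2)) ^+ 2.
  by rewrite -expRM_natl; congr expR; field.
rewrite /bhattacharyya -/L1 -/L0; rewrite half in e1; rewrite half in e2.
set a := expR (- (L1 / 2)) in e1 *; set b := expR (- (L0 / 2)) in e2 *.
have a1 : a != 1 by apply: contraNneq pq => a1; rewrite -e1 a1 expr1n mulr1.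
have h1 : p * a < (p + q) / 2.
  rewrite -subr_gt0 -e1 (_ : _ - _ = p * ((a - 1) ^+ 2 / 2)); last by field.
  by rewrite mulr_gt0// divr_gt0// lt_neqAle sqr_ge0 eq_sym sqrf_eq0 subr_eq0 a1.
have h2 : (1 - p) * b <= ((1 - p) + (1 - q)) / 2.
  rewrite -subr_ge0 -e2 (_ : _ - _ = (1 - p) * ((b - 1) ^+ 2 / 2)); last by field.
  by rewrite mulr_ge0 ?subr_ge0 ?(ltW p1)// divr_ge0// sqr_ge0.
lra.
Qed.

(** At the exponent 1/2 the moment is the same for agreeing and for opposite endpoints, so the lower
    tail of a margin is bounded without knowing the labels. *)
Lemma half_llr_mean b :
  \sum_s status_law p q alpha b s * expR (- (sg b * llr p q s / 2)) =
  1 - alpha * (1 - bhattacharyya).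
Proof.
have [e1 e2] := expR_llr; have half (x : R) : expR (- x) * expR (x / 2) = expR (- (x / 2)).
  by rewrite -expRD; congr expR; field.
rewrite status_law_sum /= mulr0 mul0r oppr0 expR0 /bhattacharyya.
case: b => /=; rewrite ?mul1r ?mulN1r ?mulNr ?opprK /sg; first by ring.
rewrite -{1}e1 -{1}e2 -!mulrA !half; ring.
Qed.

End Bounds.

(** * Low margins and neighbours of a fixed vertex *)

Section Rows.
Context {R : realType} {n : nat}.
Implicit Types (G : observation n) (sigma : labels n) (i j u v w : 'I_n).
Variables p q alpha : R.
Hypotheses (hp : 0 < p < 1) (hq : 0 < q < 1) (ha : 0 < alpha < 1).

Let E sigma f := pE (pair_law p q alpha sigma) f.

Let rate : R := 1 - alpha * (1 - bhattacharyya p q).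

Lemma set2_inj (A B : pred 'I_n) : (forall i, A i -> B i -> False) ->
  {in [pred z : 'I_n * 'I_n | A z.1 && B z.2] &, injective (fun z => [set z.1; z.2])}.
Proof.
move=> AB [i j] [k l] /=; rewrite !inE /= => /andP[Ai Bj] /andP[Ak Bl] /setP H.
have {}ik : i = k.
  have := H i; rewrite !inE eqxx /= => /esym/orP[]/eqP // il.
  by case: (AB i); rewrite // il.
subst k; congr pair.
have := H j; rewrite !inE eqxx orbT => /esym/orP[]/eqP // ji.
by case: (AB j); rewrite // ji.
Qed.

Lemma card_notin (U : {set 'I_n}) : #|[pred w | w \notin U]| = (n - #|U|)%N.
Proof.
have cU := cardC (mem U); rewrite card_ord in cU.
apply: (@addnI #|U|); rewrite subnKC; last by rewrite -[leqRHS]cU leq_addr.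
by rewrite -[RHS]cU; congr addn; apply: eq_card => w; rewrite !inE.
Qed.

(** Entries towards [U] are bounded trivially. What remains of the margins of distinct vertices of
    [U] depends on disjoint sets of pairs, which restores independence. *)
Lemma margin_ge sigma G v (U : {set 'I_n}) : v \in U ->
  \sum_(w | w \notin U) sg (sigma v == sigma w) * llr_mx p q G v w -
    llr_bound p q * #|U|%:R <= margin p q G sigma v.
Proof.
move=> vU; rewrite marginE.
pose F w := sg (sigma v == sigma w) * llr_mx p q G v w.
rewrite -[\sum_(w | w != v) _]/(\sum_(w | w != v) F w).
rewrite -[\sum_(w | w \notin U) _]/(\sum_(w | w \notin U) F w).
have -> : \sum_(w | w != v) F w = \sum_(w | (w != v) && (w \in U)) F w +
    \sum_(w | w \notin U) F w.
  rewrite (bigID (mem U)) /=; congr (_ + _); apply: eq_bigl => w.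
  by case: eqP => [->|_]; rewrite ?vU.
rewrite addrC lerD2r.
have Y0 : 0 <= llr_bound p q by rewrite addr_ge0.
rewrite lerNl -sumrN mulr_natr -sumr_const.
apply: (@le_trans _ _ (\sum_(w | (w != v) && (w \in U)) llr_bound p q)).
  apply: ler_sum => w _; apply: le_trans (ler_norm _) _.
  by rewrite normrN /F normrM sg_norm1 mul1r normr_llr.
rewrite [leLHS]big_mkcond [leRHS]big_mkcond; apply: ler_sum => w _.
by case: (w \in U); rewrite ?andbT ?andbF//; case: ifP.
Qed.

(** The pairs from [V] to [u] and from [V] to the complement of [u |: V] are all distinct.
    Revelations and truncated margins therefore factorise, with one [alpha] and one power of [rate]
    for each vertex of [V]. *)
Lemma low_margins_bound sigma u (V : {set 'I_n}) tau : u \notin V ->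
  E sigma (fun G => [forall v in V, rev G u v && (margin p q G sigma v <= tau)%R]%:R) <=
  (alpha * (rate ^+ (n - #|V|.+1) *
     expR ((tau + llr_bound p q * #|V|.+1%:R) / 2))) ^+ #|V|.
Proof.
move=> uV; pose U := u |: V; have cU : #|U| = #|V|.+1 by rewrite cardsU1 uV.
set C := expR _.
pose g (z : 'I_n * 'I_n) (s : status) : R := if z.2 == u then (s != None)%:R
  else expR (- (sg (sigma z.1 == sigma z.2) * llr p q s / 2)).
pose P (z : 'I_n * 'I_n) := (z.1 \in V) && ((z.2 == u) || (z.2 \notin U)).
have disj i : i \in V -> (i == u) || (i \notin U) -> False.
  by move=> iV; rewrite inE inE iV orbT orbF => /eqP iu; rewrite -iu iV in uV.
have Pinj : {in P &, injective (fun z => [set z.1; z.2])} by exact: (set2_inj disj).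
have Pne z : P z -> z.1 != z.2.
  by move=> /andP[zV zU]; apply/eqP => e; apply: (disj z.1); rewrite ?e// -e.
have prodP (f : 'I_n * 'I_n -> R) : \prod_(z | P z) f z =
   \prod_(v in V) (f (v, u) * \prod_(w | w \notin U) f (v, w)).
  transitivity (\prod_(v in V) \prod_(w | (w == u) || (w \notin U)) f (v, w)).
    by rewrite pair_big_dep; apply: eq_bigr => -[].
  apply: eq_bigr => v vV; rewrite (bigD1 u) ?eqxx//=; congr (_ * _).
  apply: eq_bigl => w; have [->|wu] := eqVneq w u; last by rewrite orFb andbT.
  by rewrite andbF !inE eqxx.
apply: (@le_trans _ _ (E sigma (fun G => C ^+ #|V| *
    \prod_(z | P z) g z (pair_status G z.1 z.2)))).
  apply: le_pE => [e s|G]; first exact: pair_law_ge0.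
  have -> : [forall v in V, rev G u v && (margin p q G sigma v <= tau)%R]%:R =
     \prod_(v in V) ((rev G u v && (margin p q G sigma v <= tau)%R)%:R : R).
    case: (boolP [forall v in V, _]) => [/forall_inP h|].
      by rewrite big1// => v vV; rewrite h.
    rewrite negb_forall_in => /exists_inP[v vV /negbTE hv].
    by rewrite (bigD1 v)//= hv mul0r.
  rewrite prodP -prodr_const -big_split /=; apply: ler_prod => v vV.
  rewrite ler0n /= /g eqxx -/(rev G v u) revC.
  rewrite -mulnb natrM mulrCA ler_wpM2l//.
  rewrite (eq_bigr (fun w =>
    expR (- (sg (sigma v == sigma w) * llr_mx p q G v w / 2)))); last first.
    by move=> w wU; rewrite /=; case: eqP => // wu; move: wU; rewrite wu !inE eqxx.
  rewrite -expR_sum -expRD; apply: indicator_le_exp => mt.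
  have vU : v \in U by rewrite !inE vV orbT.
  have := margin_ge sigma G vU; rewrite cU sumrN -mulr_suml; move: mt; lra.
rewrite /E pEZ (@pE_pairs R n p q alpha sigma P g)//.
rewrite (_ : \prod_(z | P z) _ = (alpha * rate ^+ (n - #|V|.+1)) ^+ #|V|).
  by rewrite -exprMn [C * _]mulrC mulrA.
rewrite prodP -prodr_const; apply: eq_bigr => v vV; congr (_ * _).
  by rewrite status_law_sum /g /= eqxx /= mulr0 !mulr1 add0r addrC subrK mulr1.
rewrite (eq_bigr (fun=> rate)).
  rewrite prodr_const; congr (_ ^+ _); rewrite -cU -card_notin.
  by apply: eq_card.
move=> w wU; have wu : (w == u) = false.
  by apply/negbTE; apply: contraNneq wU => ->; rewrite !inE eqxx.
by rewrite /g /= wu; exact: (half_llr_mean alpha hp hq).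
Qed.

Lemma row_measurable u (X Y : observation n) w :
  {in [pred e : vpair n | u \in val e], X =1 Y} ->
  pair_status X u w = pair_status Y u w.
Proof.
move=> XY; rewrite /pair_status; case: insubP => // e _ ew; apply: XY.
by rewrite inE ew !inE eqxx.
Qed.

Lemma off_row_measurable u (X Y : observation n) v w : v != u -> w != u ->
  {in predC [pred e : vpair n | u \in val e], X =1 Y} ->
  pair_status X v w = pair_status Y v w.
Proof.
move=> vu wu XY; rewrite /pair_status; case: insubP => // e _ ew; apply: XY.
by rewrite !inE ew !inE negb_or ![u == _]eq_sym vu wu.
Qed.

(** Truncation removes the pair joining [u] and [v] from the margin of [v], which becomes
    independent of the whole row of [u]. *)
Lemma low_margin_bound_indep sigma u v (f : observation n -> bool) tau : v != u ->
  (forall X Y : observation n, {in [pred e : vpair n | u \in val e], X =1 Y} ->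
     f X = f Y) ->
  E sigma (fun G => (f G && (margin p q G sigma v <= tau)%R)%:R) <=
  rate ^+ (n - 2) * expR ((tau + llr_bound p q * 2) / 2) * E sigma (fun G => (f G)%:R).
Proof.
move=> vu fu; pose U := [set u; v]; have cU : #|U| = 2%N by rewrite cards2 eq_sym vu.
set C := expR _.
pose g (z : 'I_n * 'I_n) (s : status) : R :=
  expR (- (sg (sigma z.1 == sigma z.2) * llr p q s / 2)).
pose P (z : 'I_n * 'I_n) := (z.1 == v) && (z.2 \notin U).
have disj i : i == v -> i \notin U -> False by move=> /eqP ->; rewrite !inE eqxx orbT.
have Pinj : {in P &, injective (fun z => [set z.1; z.2])} by exact: (set2_inj disj).
have Pne z : P z -> z.1 != z.2.
  by move=> /andP[zV zU]; apply/eqP => e; apply: (disj z.1); rewrite ?e// -e.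
have prodP (h : 'I_n * 'I_n -> R) : \prod_(z | P z) h z =
   \prod_(w | w \notin U) h (v, w).
  transitivity (\prod_(i | i == v) \prod_(w | w \notin U) h (i, w)).
    by rewrite pair_big_dep; apply: eq_bigr => -[].
  by rewrite big_pred1_eq.
have Eg : E sigma (fun G => \prod_(z | P z) g z (pair_status G z.1 z.2)) = rate ^+ (n - 2).
  rewrite /E (@pE_pairs R n p q alpha sigma P g)// prodP (eq_bigr (fun=> rate)).
    rewrite prodr_const; congr (_ ^+ _); rewrite -cU -card_notin.
    by apply: eq_card.
  by move=> w wU; exact: (half_llr_mean alpha hp hq).
apply: (@le_trans _ _ (E sigma (fun G => C * ((f G)%:R *
    \prod_(z | P z) g z (pair_status G z.1 z.2))))).
  apply: le_pE => [e s|G]; first exact: pair_law_ge0.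
  rewrite -mulnb natrM mulrCA ler_wpM2l// prodP /=.
  rewrite (eq_bigr (fun w => expR (- (sg (sigma v == sigma w) * llr_mx p q G v w / 2))))//.
  rewrite -expR_sum -expRD; apply: indicator_le_exp => mt.
  have vU : v \in U by rewrite !inE eqxx orbT.
  have := margin_ge sigma G vU; rewrite cU sumrN -mulr_suml; move: mt; lra.
rewrite /E pEZ (@pE_indep _ _ _ _ _ [pred e : vpair n | u \in val e]); last first.
- move=> X Y XY; apply: eq_bigr => -[i w] /andP[/= /eqP -> wU]; congr g.
  have wu : w != u by apply: contraNneq wU => ->; rewrite !inE eqxx.
  exact: (off_row_measurable vu wu).
- by move=> X Y XY; rewrite (fu X Y).
- exact: pair_law_sum1.
have := Eg; rewrite /E => ->.
by rewrite le_eqVlt; apply/orP; left; apply/eqP; ring.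
Qed.

(* The set [f G] is independent of row [u], hence may be treated as fixed. *)
Lemma neighbours_in_indep_set sigma u (f : observation n -> {set 'I_n}) (m theta a : R) :
  0 <= theta ->
  (forall X Y : observation n, {in predC [pred e : vpair n | u \in val e], X =1 Y} ->
     f X = f Y) ->
  E sigma (fun G => ((#|f G|%:R <= m)%R && (a < \sum_(w in f G) (rev G u w)%:R)%R)%:R) <=
  expR (alpha * expR theta * m - theta * a).
Proof.
move=> th0 fu; move: (ha) => /andP[a0 a1]; set C := expR _.
pose N (S : {set 'I_n}) : observation n -> R := fun G => (a < \sum_(w in S) (rev G u w)%:R)%R%:R.
have -> : E sigma (fun G => ((#|f G|%:R <= m)%R && (a < \sum_(w in f G) (rev G u w)%:R)%R)%:R) =
   \sum_(S : {set 'I_n} | #|S|%:R <= m) E sigma (fun G => (f G == S)%:R * N S G).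
  rewrite /E -pE_sum; apply: eq_pE => G.
  case: (boolP (#|f G|%:R <= m)) => fm /=.
    rewrite (bigD1 (f G))//= eqxx mul1r [X in _ = _ + X]big1 ?addr0// => S /andP[_ /negbTE].
    by rewrite eq_sym => ->; rewrite mul0r.
  rewrite [RHS]big1// => S Sm; case: eqP => [e|_]; last by rewrite mul0r.
  by move: fm; rewrite e Sm.
have NC (S : {set 'I_n}) : #|S|%:R <= m -> E sigma (N S) <= C.
  move=> Sm; pose P (z : 'I_n * 'I_n) := (z.1 == u) && ((z.2 \in S) && (z.2 != u)).
  have disj i : i == u -> (i \in S) && (i != u) -> False.
    by move=> /eqP ->; rewrite eqxx andbF.
  have Pinj : {in P &, injective (fun z => [set z.1; z.2])} by exact: (set2_inj disj).
  have Pne z : P z -> z.1 != z.2.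
    by move=> /andP[zV zU]; apply/eqP => e; apply: (disj z.1); rewrite ?e// -e.
  have -> : N S = fun G => (a < \sum_(z | P z) (rev G z.1 z.2)%:R)%R%:R.
    apply/funext => G; rewrite /N; congr ((_ < _)%R%:R).
    transitivity (\sum_(i | i == u) \sum_(w | (w \in S) && (w != u)) (rev G i w)%:R : R);
      last by rewrite pair_big_dep.
    rewrite big_pred1_eq (bigID (fun w => w != u))/= [X in _ + X]big1 ?addr0// => w.
    by rewrite negbK => /andP[_ /eqP ->]; rewrite rev_diag.
  apply: le_trans (revealed_chernoff hp hq ha sigma a Pne Pinj th0) _.
  rewrite ler_expR lerD2r ler_wpM2l ?mulr_ge0 ?expR_ge0 ?(ltW a0)//.
  apply: le_trans Sm; rewrite ler_nat.
  apply: leq_trans (leq_imset_card (fun w => (u, w)) S); apply: subset_leq_card.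
  apply/fintype.subsetP => -[i w]; rewrite unfold_in /P /= => /andP[/eqP -> /andP[wS _]].
  by apply/imsetP; exists w.
apply: (@le_trans _ _ (\sum_(S : {set 'I_n}) E sigma (fun G => (f G == S)%:R) * C)).
  rewrite big_mkcond; apply: ler_sum => S _.
  have fS0 : 0 <= E sigma (fun G => (f G == S)%:R).
    by apply: pE_ge0 => // *; exact: pair_law_ge0.
  case: ifP => [Sm|_]; last by rewrite mulr_ge0// expR_ge0.
  rewrite /E mulrC (@eq_pE _ _ _ _ _ (fun G => N S G * (f G == S)%:R)); last first.
    by move=> G; rewrite mulrC.
  rewrite (@pE_indep _ _ _ _ _ [pred e : vpair n | u \in val e]); last first.
  - by move=> X Y XY; rewrite (fu X Y).
  - move=> X Y XY; rewrite /N; congr ((_ < _)%R%:R).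
    by apply: eq_bigr => w _; rewrite /rev (row_measurable _ XY).
  - exact: pair_law_sum1.
  by rewrite ler_wpM2r//; exact: NC.
rewrite -mulr_suml -[leRHS]mul1r ler_wpM2r ?expR_ge0// /E -pE_sum.
rewrite (@eq_pE _ _ _ _ _ (fun=> 1)); last first.
  move=> G; rewrite (bigD1 (f G))//= eqxx big1 ?addr0// => S /negbTE.
  by rewrite eq_sym => ->.
by rewrite pE_cst//; exact: pair_law_sum1.
Qed.

End Rows.

Section Balance.
Context {R : realType} {n : nat}.

(** Uniform labels are independent signs, each with exponential moment [cosh theta]; [c = 1] and
    [c = -1] serve the two tails of the label sum. *)
Lemma label_exp (c theta : R) : `|c| = 1 -> 0 <= theta <= 2^-1 ->
  \sum_(s : labels n) 2^-n * expR (theta * \sum_i c * sg (s i)) <=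
  expR (2 * theta ^+ 2 * n%:R).
Proof.
move=> c1 /andP[th0 th1].
rewrite (eq_bigr (fun s : labels n => pmass (fun _ _ => 2^-1) s *
    (\prod_i expR (theta * (c * sg (s i)))))); last first.
  move=> s _; rewrite /pmass prodr_const card_ord exprVn; congr (_ * _).
  by rewrite mulr_sumr expR_sum.
rewrite -/(pE _ _) (pE_prod1 _ (fun _ b => expR (theta * (c * sg b)))).
rewrite (eq_bigr (fun=> (expR (theta * c) + expR (- (theta * c))) / 2)); last first.
  by move=> i _; rewrite big_bool /sg /= mulr1 mulrN1 mulrN; field.
rewrite prodr_const card_ord expRM_natr; apply: lerXn2r.
- by rewrite nnegrE mulr_ge0 ?invr_ge0// addr_ge0// expR_ge0.
- by rewrite nnegrE expR_ge0.
have tc : `|theta * c| <= 2^-1 by rewrite normrM c1 mulr1 ger0_norm.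
have tc2 : (theta * c) ^+ 2 = theta ^+ 2.
  by rewrite -real_normK ?num_real// normrM c1 mulr1 real_normK ?num_real.
have h1 := expR_le_quadratic tc.
have h2 : expR (- (theta * c)) <= 1 - theta * c + 2 * (theta * c) ^+ 2.
  by have := @expR_le_quadratic _ (- (theta * c)); rewrite normrN sqrrN => /(_ tc).
apply: le_trans (expR_ge1Dx _); rewrite tc2 in h1 h2; lra.
Qed.

End Balance.

(** * The spectral matrix on the good event *)

Section CutNorm.
Context {R : realType} {n : nat}.

(** A bilinear form on the cube is largest at the vertices: [a] is replaced by the signs of the row
    sums, then [b] by the signs of the resulting column sums. *)
Lemma cut_norm_convex (D : 'I_n -> 'I_n -> R) kappa :
  (forall a b : labels n, \sum_i \sum_j D i j * sg (a i) * sg (b j) <= kappa) ->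
  forall a b : 'I_n -> R, (forall i, `|a i| <= 1) -> (forall i, `|b i| <= 1) ->
  `|\sum_i \sum_j D i j * a i * b j| <= kappa.
Proof.
move=> cut a b a1 b1.
have sgE (x : R) : `|x| = sg (0 <= x) * x.
  rewrite /sg; case: ifP => [x0|/negbT]; first by rewrite mul1r ger0_norm.
  by rewrite -ltNge mulN1r => x0; rewrite ltr0_norm.
have absorb (x y : R) : `|y| <= 1 -> `|x * y| <= `|x|.
  by move=> y1; rewrite normrM -[leRHS]mulr1 ler_wpM2l.
pose a' : labels n := [ffun i => 0 <= \sum_j D i j * b j].
pose b' : labels n := [ffun j => 0 <= \sum_i D i j * sg (a' i)].
apply: le_trans (cut a' b').
apply: (@le_trans _ _ (\sum_i `|\sum_j D i j * b j|)).
  apply: le_trans (ler_norm_sum _ _ _) _; apply: ler_sum => i _.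
  rewrite (eq_bigr (fun j => (D i j * b j) * a i)); last by move=> j _; ring.
  by rewrite -mulr_suml absorb.
rewrite (eq_bigr (fun i => \sum_j D i j * sg (a' i) * b j)); last first.
  by move=> i _; rewrite sgE ffunE mulr_sumr; apply: eq_bigr => j _; ring.
rewrite exchange_big [leRHS]exchange_big /=; apply: ler_sum => j _.
rewrite -mulr_suml -mulr_suml; apply: le_trans (ler_norm _) _.
by apply: le_trans (absorb _ _ (b1 j)) _; rewrite sgE ffunE mulrC.
Qed.

End CutNorm.

(** * From the signed adjacency matrix to log-likelihood ratios *)

Section Reduction.
Context {R : realType} {n : nat}.
Variables p q : R.
Hypotheses (hp : 0 < p < 1) (hq : 0 < q < 1) (hpq : p != q).

Lemma ln_ratio_neq0 : ln (p / q) != 0.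
Proof.
move: hp hq => /andP[p0 _] /andP[q0 _].
rewrite ln_eq0 ?divr_gt0//; apply: contraNneq hpq => h.
by rewrite -(divfK (lt0r_neq0 q0) p) h mul1r.
Qed.

(** [yparam] is such that [yparam p q * ln (p / q) = - ln ((1 - p) / (1 - q))]. The sign convention
    for [p < q] makes the proportionality factor positive, so top eigenvectors are the same. *)
Lemma spectral_llr (G : observation n) i j :
  llr_mx p q G i j = `|ln (p / q)| * spectral_matrix p q G i j.
Proof.
move: hp hq => /andP[p0 p1] /andP[q0 q1].
have yE : yparam p q * ln (p / q) = - ln ((1 - p) / (1 - q)).
  rewrite /yparam divfK ?ln_ratio_neq0// !ln_div ?posrE ?subr_gt0//; ring.
have lnpos : q < p -> `|ln (p / q)| = ln (p / q).
  by move=> qp; rewrite ger0_norm// ln_ge0// ler_pdivlMr// mul1r ltW.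
have lnneg : p <= q -> `|ln (p / q)| = - ln (p / q).
  by move=> pq; rewrite ler0_norm// ln_le0// ler_pdivrMr// mul1r.
rewrite /spectral_matrix /llr_mx; case: (ltrP q p) => [/lnpos|/lnneg] ->;
  rewrite ?mxE; case: (pair_status G i j) => [[]|] /=; rewrite ?mulr1 ?mulr0//.
- by rewrite mulrN [_ * yparam _ _]mulrC yE opprK.
- by rewrite mulrN1 opprK.
- by rewrite mulrNN mulrN [_ * yparam _ _]mulrC yE opprK.
- by rewrite oppr0 mulr0.
Qed.

Lemma llr_mxC (G : observation n) i j : llr_mx p q G i j = llr_mx p q G j i.
Proof. by rewrite /llr_mx pair_statusC. Qed.

Lemma top_eigenvector_llr (G : observation n) (u : 'rV[R]_n) :
  top_unit_eigenvector (spectral_matrix p q G) u ->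
  exists lam, (forall i, \sum_j llr_mx p q G i j * u 0 j = lam * u 0 i) /\
    forall x, qf (llr_mx p q G) x <= lam * nrm2 x.
Proof.
have Mc : (spectral_matrix p q G)^T = spectral_matrix p q G.
  apply/matrixP => i j; rewrite mxE.
  apply: (@mulfI _ `|ln (p / q)|); first by rewrite normr_eq0 ln_ratio_neq0.
  by rewrite -!spectral_llr llr_mxC.
move=> /(top_eigenvector_rayleigh Mc)[lam [eq1 eq2]].
exists (`|ln (p / q)| * lam); split.
  move=> i; rewrite -mulrA -eq1 mulr_sumr; apply: eq_bigr => j _.
  by rewrite spectral_llr mulrA.
move=> x; rewrite -mulrA; apply: le_trans (ler_wpM2l (normr_ge0 _) (eq2 x)).
rewrite le_eqVlt; apply/orP; left; apply/eqP.
rewrite /qf mulr_sumr; apply: eq_bigr => i _; rewrite mulr_sumr.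
by apply: eq_bigr => j _; rewrite spectral_llr; ring.
Qed.

End Reduction.

(** * Leave-one-out by censoring *)

Section Censor.
Context {R : realType} {n : nat}.

(** The vertex set is kept, so that the given choice of eigenvectors also applies to the censored
    observation; its value there no longer depends on the row of [v]. *)
Definition censor (v : 'I_n) (G : observation n) : observation n :=
  [ffun e : vpair n => if v \in val e then None else G e].

Lemma pair_status_censor v G i j : pair_status (censor v G) i j =
  if (v == i) || (v == j) then None else pair_status G i j.
Proof.
rewrite /pair_status; case: insubP => [e _ ew|_]; last by case: ifP.
by rewrite ffunE ew !inE.
Qed.

Lemma censor_measurable v (X Y : observation n) :
  {in predC [pred e : vpair n | v \in val e], X =1 Y} -> censor v X = censor v Y.
Proof.
move=> XY; apply/ffunP => e; rewrite !ffunE; case: ifP => // /negbT ve.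
by apply: XY; rewrite !inE.
Qed.

End Censor.

Section MeanMatrix.
Context {R : realType} {n : nat}.
Variables p q alpha : R.
Implicit Types (sigma : labels n).

(** Half the sum of the two relative entropies, the coefficient of the label part of [mean_mx];
    [kl_diff], half their difference, is that of the constant part. *)
Definition kl_sum : R := (kl p q true - kl p q false) / 2.
Definition kl_diff : R := (kl p q true + kl p q false) / 2.

Lemma klE b : kl p q b = kl_sum * sg b + kl_diff.
Proof. by rewrite /kl_sum /kl_diff; case: b; rewrite /sg; field. Qed.

Lemma mean_mxE sigma i j : mean_mx p q alpha sigma i j =
  alpha * (kl_sum * (sg (sigma i) * sg (sigma j)) + kl_diff).
Proof. by rewrite /mean_mx klE sgM. Qed.

Lemma qf_mean sigma (s o : 'I_n -> R) r x : (0 < n)%N -> r ^+ 2 = n%:R ->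
  (forall i, s i = sg (sigma i) / r) -> (forall i, o i = 1 / r) ->
  qf (mean_mx p q alpha sigma) x =
  alpha * n%:R * kl_sum * dot s x ^+ 2 + alpha * n%:R * kl_diff * dot o x ^+ 2.
Proof.
move=> n0 r2 sE oE.
have rn0 : r != 0 by rewrite -sqrf_eq0 r2 pnatr_eq0 -lt0n.
have -> : dot s x = (\sum_i sg (sigma i) * x i) / r.
  by rewrite mulr_suml; apply: eq_bigr => i _; rewrite sE mulrAC.
have -> : dot o x = (\sum_i x i) / r.
  by rewrite mulr_suml; apply: eq_bigr => i _; rewrite oE mul1r mulrC.
rewrite !expr_div_n r2.
have n_neq0 : n%:R != 0 :> R by rewrite pnatr_eq0 -lt0n.
rewrite [RHS](_ : _ = alpha * kl_sum * ((\sum_i sg (sigma i) * x i) ^+ 2) +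
    alpha * kl_diff * ((\sum_i x i) ^+ 2)); last by field.
rewrite /qf !expr2 2!big_distrlr /= !mulr_sumr -big_split; apply: eq_bigr => i _.
rewrite !mulr_sumr -big_split; apply: eq_bigr => j _ /=.
by rewrite mean_mxE; ring.
Qed.

End MeanMatrix.

(** * Spectral errors on a deterministic good event *)

Section GoodEvent.
Context {R : realType} {n : nat}.
Variables (p q t d alpha : R) (sigma : labels n) (G : observation n).
Variable u1 : observation n -> 'rV[R]_n.
Hypotheses (hp : 0 < p < 1) (hq : 0 < q < 1) (hpq : p != q) (ha : 0 < alpha < 1).
Hypotheses (n_gt0 : (0 < n)%N) (d_ge1 : 1 <= d) (t_gt0 : 0 < t).
Hypothesis alphaE : alpha * n%:R = t * d.
Hypothesis u1P : forall H, top_unit_eigenvector (spectral_matrix p q H) (u1 H).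

Let Y := llr_bound p q.
Let l0 := t * kl_sum p q.
Let k0 := t * kl_diff p q.
Variables (kp0 K bal : R).
Hypotheses (k0_le : k0 <= kp0) (kp0_ge0 : 0 <= kp0) (kp0_lt : kp0 < l0).
Hypotheses (K_ge0 : 0 <= K) (bal_le1 : bal <= 1).

Let rt : R := Num.sqrt n%:R.
Let s i : R := sg (sigma i) / rt.
Let o (i : 'I_n) : R := 1 / rt.
Let W (H : observation n) := llr_mx p q H.
Let N (H : observation n) i j : R := (rev H i j)%:R.

Hypothesis balanced : `|\sum_i sg (sigma i)| <= bal * n%:R :> R.
Hypothesis degrees : forall i, \sum_j N G i j <= K * d.

Let rt_gt0 : 0 < rt.
Proof. by rewrite sqrtr_gt0 ltr0n. Qed.

Let rt2 : rt ^+ 2 = n%:R.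
Proof. by rewrite sqr_sqrtr// ler0n. Qed.

Let d_gt0 : 0 < d. Proof. exact: lt_le_trans d_ge1. Qed.

Let n_gt0R : 0 < n%:R :> R. Proof. by rewrite ltr0n. Qed.

Let Y_ge0 : 0 <= Y. Proof. by rewrite addr_ge0. Qed.

Let l0_gt0 : 0 < l0. Proof. exact: le_lt_trans kp0_lt. Qed.

Let s1 : nrm2 s = 1.
Proof.
rewrite /nrm2 (eq_bigr (fun=> n%:R^-1)).
  by rewrite sumr_const card_ord -[_ *+ n]mulr_natl divff// gt_eqF.
by move=> i _; rewrite expr_div_n rt2 expr2 sg_sqr mul1r.
Qed.

Let o1 : nrm2 o = 1.
Proof.
rewrite /nrm2 (eq_bigr (fun=> n%:R^-1)).
  by rewrite sumr_const card_ord -[_ *+ n]mulr_natl divff// gt_eqF.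
by move=> i _; rewrite expr_div_n rt2 expr1n mul1r.
Qed.

Let so : `|dot s o| <= bal.
Proof.
have -> : dot s o = (\sum_i sg (sigma i)) / n%:R.
  rewrite mulr_suml; apply: eq_bigr => i _; rewrite -rt2 /s /o; field.
  by rewrite gt_eqF.
by rewrite normrM normfV (gtr0_norm n_gt0R) ler_pdivrMr.
Qed.

Let N_ge0 H i j : 0 <= N H i j. Proof. exact: ler0n. Qed.

Let W_le H i j : `|W H i j| <= Y * N H i j.
Proof.
rewrite /W /llr_mx /N /rev; case: eqP => [->|_] /=; first by rewrite normr0 mulr0.
by rewrite mulr1; exact: normr_llr.
Qed.

(** At scale [d] the mean matrix has weight [l0] on the normalised labels [s] and [k0] on the
    constant vector [o]; these two vectors are only nearly orthogonal. *)
Definition near_rank_two (e : R) (B : 'I_n -> 'I_n -> R) := forall x,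
  `|qf B x - (l0 * d * dot s x ^+ 2 + k0 * d * dot o x ^+ 2)| <= e * d * nrm2 x.

Lemma near_rank_two_llr e1 eS beta rho T kappa :
  1 <= rho -> 0 < T -> 0 < beta -> 0 <= eS ->
  (forall S : {set 'I_n}, #|S|%:R * T ^+ 2 <= rho ^+ 2 * n%:R ->
     \sum_(i in S) \sum_(j in S) N G i j <= eS * d * #|S|%:R) ->
  (forall a b : labels n, \sum_i \sum_j
     (W G i j - mean_mx p q alpha sigma i j) * sg (a i) * sg (b j) <= kappa * d * n%:R) ->
  Y * (beta * eS + beta^-1 * K) + 2 * Y * K / rho + 2 * (t * Y) / T + T ^+ 2 * kappa <= e1 ->
  near_rank_two e1 (W G).
Proof.
move=> rho1 T0 beta0 eS0 sparse cut e1E x.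
have Emx i j : `|mean_mx p q alpha sigma i j| <= t * d * Y / n%:R.
  by rewrite ler_pdivlMr// -alphaE mulrAC ler_wpM2r ?ler0n// normr_mean_mx.
have cut' : forall a b : 'I_n -> R, (forall i, `|a i| <= 1) -> (forall i, `|b i| <= 1) ->
    `|\sum_i \sum_j (W G i j - mean_mx p q alpha sigma i j) * a i * b j| <= kappa * d * n%:R.
  exact: cut_norm_convex.
have tdY : 0 <= t * d * Y by rewrite !mulr_ge0// ltW.
have Nsym i j : N G i j = N G j i by rewrite /N revC.
have Ndiag i : N G i i = 0 by rewrite /N rev_diag.
have eSd : 0 <= eS * d by rewrite mulr_ge0// ltW.
have := @qf_bound R n (W G) (mean_mx p q alpha sigma) (N G) Y (K * d) rho T beta (eS * d)
  (t * d * Y) (kappa * d) x n_gt0 (N_ge0 G) Nsym Ndiag degrees Y_ge0 rho1 T0 beta0 eSd tdY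
  sparse (W_le G) Emx cut'.
move=> /le_trans H; have {H} := H (e1 * d * nrm2 x).
have -> : qf (fun i j => W G i j - mean_mx p q alpha sigma i j) x =
    qf (W G) x - qf (mean_mx p q alpha sigma) x.
  rewrite /qf -sumrB; apply: eq_bigr => i _; rewrite -sumrB.
  by apply: eq_bigr => j _; ring.
rewrite (@qf_mean _ _ _ _ _ _ s o rt)// alphaE -!/(_ * d).
rewrite [t * d * kl_sum p q]mulrAC [t * d * kl_diff p q]mulrAC; apply.
rewrite ler_wpM2r ?nrm2_ge0//.
rewrite [leLHS](_ : _ = (Y * (beta * eS + beta^-1 * K) + 2 * Y * K / rho +
  2 * (t * Y) / T + T ^+ 2 * kappa) * d); last by ring.
by rewrite ler_wpM2r// ltW.
Qed.

Lemma dot_le (a x : 'I_n -> R) : nrm2 a = 1 -> `|dot a x| <= Num.sqrt (nrm2 x).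
Proof.
move=> a1; rewrite -sqrtr_sqr ler_wsqrtr//.
by apply: le_trans (cauchy_schwarz _ _) _; rewrite a1 mul1r.
Qed.

(** Censoring the row of [v] amounts to deleting the coordinate [v] of [x]. As [s] and [o] have
    entries of size [1 / rt], the rank-two part moves by a relative amount O(1 / rt). *)
Lemma near_rank_two_censor v e1 e2 : near_rank_two e1 (W G) ->
  e1 + 2 * (l0 + `|k0|) / rt <= e2 -> 0 <= e1 ->
  near_rank_two e2 (W (censor v G)).
Proof.
move=> h e12 e10 x; pose x' i := if i == v then 0 else x i.
have -> : qf (W (censor v G)) x = qf (W G) x'.
  apply: eq_bigr => i _; apply: eq_bigr => j _.
  rewrite /W /llr_mx pair_status_censor /x' ![v == _]eq_sym.
  by case: (i == v); case: (j == v); rewrite /= ?mulr0 ?mul0r.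
have xv : nrm2 x' <= nrm2 x.
  apply: ler_sum => i _; rewrite /x'; case: ifP => // _.
  by rewrite expr0n sqr_ge0.
set X := Num.sqrt (nrm2 x).
have X0 : 0 <= X by exact: sqrtr_ge0.
have X2 : X ^+ 2 = nrm2 x by rewrite sqr_sqrtr// nrm2_ge0.
have chg (a : 'I_n -> R) : nrm2 a = 1 -> (forall i, `|a i| = rt^-1) ->
    `|dot a x' ^+ 2 - dot a x ^+ 2| <= 2 * nrm2 x / rt.
  move=> a1 ai.
  have -> : dot a x' ^+ 2 - dot a x ^+ 2 = (dot a x' - dot a x) * (dot a x' + dot a x).
    by ring.
  have -> : dot a x' - dot a x = - (a v * x v).
    rewrite /dot -sumrB (bigD1 v)//= big1 /x' ?eqxx ?mulr0 ?sub0r ?addr0//.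
    by move=> i /negbTE ->; rewrite subrr.
  rewrite normrM normrN normrM ai -X2.
  have -> : 2 * X ^+ 2 / rt = rt^-1 * X * (X + X) by ring.
  apply: ler_pM; rewrite ?mulr_ge0 ?invr_ge0 ?(ltW rt_gt0)//.
    rewrite ler_wpM2l ?invr_ge0 ?(ltW rt_gt0)// -sqrtr_sqr ler_wsqrtr//.
    by rewrite /nrm2 (bigD1 v)//= lerDl sumr_ge0// => *; exact: sqr_ge0.
  apply: le_trans (ler_normD _ _) _; rewrite lerD ?dot_le//.
  by apply: le_trans (dot_le _ a1) _; rewrite ler_wsqrtr.
have := h x'.
have sC := chg s s1; have oC := chg o o1.
have {}sC : `|dot s x' ^+ 2 - dot s x ^+ 2| <= 2 * nrm2 x / rt.
  by apply: sC => i; rewrite /s normrM sg_norm1 mul1r normfV gtr0_norm.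
have {}oC : `|dot o x' ^+ 2 - dot o x ^+ 2| <= 2 * nrm2 x / rt.
  by apply: oC => i; rewrite /o normrM normr1 mul1r normfV gtr0_norm.
move=> hx'; set Q := qf _ _ in hx' *.
have -> : Q - (l0 * d * dot s x ^+ 2 + k0 * d * dot o x ^+ 2) =
   (Q - (l0 * d * dot s x' ^+ 2 + k0 * d * dot o x' ^+ 2)) +
   (l0 * d * (dot s x' ^+ 2 - dot s x ^+ 2) + k0 * d * (dot o x' ^+ 2 - dot o x ^+ 2)).
  by ring.
apply: le_trans (ler_normD _ _) _.
apply: (@le_trans _ _ (e1 * d * nrm2 x + (l0 * d * (2 * nrm2 x / rt) +
    `|k0| * d * (2 * nrm2 x / rt)))); last first.
  rewrite [leLHS](_ : _ = (e1 + 2 * (l0 + `|k0|) / rt) * d * nrm2 x); last by ring.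
  by rewrite ler_wpM2r ?nrm2_ge0// ler_wpM2r// ltW.
rewrite lerD//.
  by apply: le_trans hx' _; rewrite ler_wpM2l// mulr_ge0// ltW.
apply: le_trans (ler_normD _ _) _; rewrite [`|l0 * d * _|]normrM [`|k0 * d * _|]normrM.
rewrite [`|l0 * d|]normrM [`|k0 * d|]normrM (gtr0_norm d_gt0) (gtr0_norm l0_gt0).
by rewrite lerD// ler_wpM2l// mulr_ge0// ltW.
Qed.

Lemma top_llr_close e eps H : near_rank_two e (W H) -> 0 <= e ->
  2 * (2 * e + `|k0| * bal + 3 * kp0 * bal) <= eps * (l0 - kp0) ->
  exists lam (r : bool), [/\
    forall i, \sum_j W H i j * (sg r * u1 H 0 j) = lam * (sg r * u1 H 0 i),
    (l0 - `|k0| * bal - e) * d <= lam, lam <= (l0 + `|k0| + e) * d,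
    nrm2 (fun i => sg r * u1 H 0 i) = 1 &
    nrm2 (fun i => sg r * u1 H 0 i - s i) <= eps].
Proof.
move=> near e0 epsE.
have [lam [eigen top]] := top_eigenvector_llr hp hq hpq (u1P H).
have u1n : nrm2 (u1 H 0) = 1 by case: (u1P H).
have bal0 : 0 <= bal by exact: le_trans so.
have Qu : qf (W H) (u1 H 0) = lam.
  rewrite qf_dot -[RHS]mulr1 -u1n /dot mulr_sumr; apply: eq_bigr => i _.
  by rewrite eigen; ring.
have near' x : `|qf (W H) x - (l0 * d * dot s x ^+ 2 + k0 * d * dot o x ^+ 2)| <=
    e * d * nrm2 x by exact: near.
have kpld : kp0 * d < l0 * d by rewrite ltr_pM2r.
have [lam_ge [r close]] := @top_eigenvector_close R n (W H) s o (u1 H 0) (l0 * d) (k0 * d)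
  (kp0 * d) (e * d) bal lam s1 o1 so bal_le1 u1n Qu top near'
  (ler_wpM2r (ltW d_gt0) k0_le) (mulr_ge0 kp0_ge0 (ltW d_gt0)) kpld.
exists lam, r; split.
- move=> i; rewrite mulrCA -eigen mulr_sumr; apply: eq_bigr => j _.
  by rewrite mulrCA.
- apply: le_trans lam_ge; rewrite [`|k0 * d|]normrM (gtr0_norm d_gt0) !mulrBl.
  by rewrite [_ * bal * d]mulrAC.
- have := near (u1 H 0); rewrite Qu u1n mulr1 ler_norml => /andP[_ h].
  have sq1 (a : 'I_n -> R) : nrm2 a = 1 -> dot a (u1 H 0) ^+ 2 <= 1.
    by move=> a1; apply: le_trans (cauchy_schwarz _ _) _; rewrite a1 u1n mulr1.
  have ld0 : 0 <= l0 * d by apply: mulr_ge0; exact: ltW.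
  have kd0 : 0 <= `|k0| * d by apply: mulr_ge0 => //; exact: ltW.
  have h1 : l0 * d * dot s (u1 H 0) ^+ 2 <= l0 * d.
    by rewrite -[leRHS]mulr1; exact: (ler_wpM2l ld0 (sq1 _ s1)).
  have h2 : k0 * d * dot o (u1 H 0) ^+ 2 <= `|k0| * d.
    apply: (@le_trans _ _ (`|k0| * d * dot o (u1 H 0) ^+ 2)).
      by rewrite ler_wpM2r ?sqr_ge0// ler_wpM2r ?(ltW d_gt0)// ler_norm.
    by rewrite -[leRHS]mulr1; exact: (ler_wpM2l kd0 (sq1 _ o1)).
  rewrite !mulrDl; lra.
- by rewrite nrm2Z expr2 sg_sqr mul1r.
- apply: le_trans close _; rewrite ler_pdivrMr; last by rewrite subr_gt0 ltr_pM2r.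
  rewrite [`|k0 * d|]normrM (gtr0_norm d_gt0).
  rewrite [leRHS](_ : _ = eps * (l0 - kp0) * d); last by ring.
  rewrite [leLHS](_ : _ = 2 * (2 * e + `|k0| * bal + 3 * kp0 * bal) * d); last by ring.
  by rewrite ler_pM2r.
Qed.

Variables (e2 eps c dl dl' eB : R).
Hypotheses (near0 : near_rank_two e2 (W G))
  (nearv : forall v, near_rank_two e2 (W (censor v G))) (e2_ge0 : 0 <= e2).
Hypotheses (epsE : 2 * (2 * e2 + `|k0| * bal + 3 * kp0 * bal) <= eps * (l0 - kp0))
  (eps_small : 4 * eps <= 1)
  (gapE : l0 * eps + 2 * e2 + `|k0| * bal <= (l0 - kp0) / 2)
  (lamE : `|k0| * bal + e2 <= l0 / 2)
  (cE : 8 / (l0 - kp0) ^+ 2 * (Y ^+ 2 * K + (l0 + `|k0| + e2) ^+ 2) <= c ^+ 2)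
  (c_ge0 : 0 <= c) (dl_ge0 : 0 <= dl) (dl'01 : 0 < dl' <= 1).
(** Both signs are covered, since the one that brings the censored eigenvector close to the labels
    is not known in advance. *)
Hypothesis isolated : forall v (r : bool),
  #|[set w | dl' < `|rt * (sg r * u1 (censor v G) 0 w) - sg (sigma w)| ]|%:R <=
    eps / dl' ^+ 2 * n%:R ->
  \sum_(w in [set w | dl' < `|rt * (sg r * u1 (censor v G) 0 w) - sg (sigma w)| ])
     N G v w <= dl * d.
Hypotheses (large1 : Y * Num.sqrt (K * d) * c <= l0 * d / 8)
  (dlE : Y * (1 + c) * dl <= l0 / 8)
  (large2 : Y * Num.sqrt (K * d) * c * (8 * Y * K / l0) <= eB * d / 2)
  (dlE' : Y * (dl * ((1 + c) * (8 * Y * K / l0) + 1) + dl' * K) <= eB / 2).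

(* Censoring row [v] changes the matrix only in row and column [v]; on the
   eigenvector the change is proportional to its entry at [v]. *)
Lemma leave_one_out v lam lamv (x y : 'I_n -> R) :
  (forall i, \sum_j W G i j * x j = lam * x i) ->
  (forall i, \sum_j W (censor v G) i j * y j = lamv * y i) ->
  nrm2 x = 1 -> nrm2 y = 1 ->
  nrm2 (fun i => x i - s i) <= eps -> nrm2 (fun i => y i - s i) <= eps ->
  (l0 - `|k0| * bal - e2) * d <= lam -> lam <= (l0 + `|k0| + e2) * d ->
  nrm2 (fun i => x i - y i) <= c ^+ 2 * x v ^+ 2.
Proof.
move=> Ax By x1 y1 xs ys lam_ge lam_le.
have g0 : 0 < l0 - kp0 by rewrite subr_gt0.
have xy : 0 <= dot x y.
  have h : nrm2 (fun i => x i - y i) <=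
      2 * nrm2 (fun i => x i - s i) + 2 * nrm2 (fun i => y i - s i).
    rewrite /nrm2 !mulr_sumr -big_split; apply: ler_sum => i _ /=.
    rewrite -subr_ge0 (_ : _ - _ = (x i - s i + (y i - s i)) ^+ 2) ?sqr_ge0//; ring.
  have h' := le_trans h (lerD (ler_wpM2l (ler0n _ 2) xs) (ler_wpM2l (ler0n _ 2) ys)).
  rewrite nrm2B x1 y1 in h'; have e4 := eps_small; lra.
have gap z : dot y z = 0 -> qf (W (censor v G)) z <= (lam - (l0 - kp0) * d / 2) * nrm2 z.
  move=> yz; have near' : forall x0 : 'I_n -> R, `|qf (W (censor v G)) x0 -
    (l0 * d * dot s x0 ^+ 2 + k0 * d * dot o x0 ^+ 2)| <= e2 * d * nrm2 x0 by exact: nearv.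
  have kd : k0 * d <= kp0 * d by rewrite ler_wpM2r// ltW.
  have kpd : 0 <= kp0 * d by rewrite mulr_ge0// ltW.
  have ld : 0 <= l0 * d by rewrite mulr_ge0// ltW.
  apply: le_trans (qf_perp o1 near' kd kpd ld ys yz) _.
  rewrite ler_wpM2r ?nrm2_ge0//.
  have := ler_wpM2r (ltW d_gt0) gapE; move: lam_ge; lra.
have Wsym H i j : W H i j = W H j i by exact: llr_mxC.
have g1 : 0 < (l0 - kp0) * d / 2 by rewrite divr_gt0// mulr_gt0.
have := eigenvector_perturbation Ax By (Wsym _) x1 y1 g1 gap xy.
move=> /le_trans; apply.
have Dv i : \sum_j (W G i j - W (censor v G) i j) * x j =
    if i == v then lam * x v else W G i v * x v.
  case: eqP => [->|/eqP iv].
    rewrite -Ax; apply: eq_bigr => j _.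
    by rewrite /W /llr_mx pair_status_censor eqxx /= subr0.
  rewrite (bigD1 v)//= big1 ?addr0.
    by rewrite /W /llr_mx pair_status_censor eqxx orbT /= subr0.
  move=> j jv; rewrite /W /llr_mx pair_status_censor ![v == _]eq_sym.
  by rewrite (negbTE iv) (negbTE jv) subrr mul0r.
have lam_ge0 : 0 <= lam.
  apply: le_trans lam_ge; rewrite mulr_ge0 ?(ltW d_gt0)//.
  by move: lamE l0_gt0; lra.
have Dn : nrm2 (fun i => \sum_j (W G i j - W (censor v G) i j) * x j) <=
   (((l0 + `|k0| + e2) * d) ^+ 2 + Y ^+ 2 * (K * d)) * x v ^+ 2.
  rewrite /nrm2 (bigD1 v)//= Dv eqxx mulrDl lerD//.
    rewrite exprMn ler_wpM2r ?sqr_ge0// lerXn2r// nnegrE.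
    exact: le_trans lam_le.
  apply: (@le_trans _ _ (\sum_i Y ^+ 2 * N G v i * x v ^+ 2)).
    rewrite [leLHS]big_mkcond; apply: ler_sum => i _; case: ifP => [iv|_].
      rewrite Dv (negbTE iv) exprMn ler_wpM2r ?sqr_ge0//.
      have NN : N G v i = N G i v ^+ 2.
        by rewrite /N revC; case: (rev G i v); rewrite ?expr1n ?expr0n.
      rewrite NN -exprMn -real_normK ?num_real// lerXn2r ?nnegrE//.
      by rewrite mulr_ge0.
    by rewrite mulr_ge0 ?sqr_ge0// mulr_ge0 ?sqr_ge0.
  rewrite -mulr_suml -mulr_sumr ler_wpM2r ?sqr_ge0// ler_wpM2l ?sqr_ge0//.
apply: (@le_trans _ _ (2 / ((l0 - kp0) * d / 2) ^+ 2 *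
   ((((l0 + `|k0| + e2) * d) ^+ 2 + Y ^+ 2 * (K * d)) * x v ^+ 2))).
  by rewrite ler_wpM2l// divr_ge0// sqr_ge0.
rewrite [leLHS]mulrA ler_wpM2r ?sqr_ge0//; apply: le_trans cE.
have g_neq0 : l0 - kp0 != 0 by rewrite gt_eqF.
have d_neq0 : d != 0 by rewrite gt_eqF.
rewrite [leLHS](_ : _ = 8 / (l0 - kp0) ^+ 2 * (Y ^+ 2 * (K / d) + (l0 + `|k0| + e2) ^+ 2)).
  rewrite ler_wpM2l ?divr_ge0 ?sqr_ge0// lerD2r ler_wpM2l ?sqr_ge0//.
  by rewrite ler_pdivrMr// ler_peMr.
by field; rewrite d_neq0 g_neq0.
Qed.

(** After rescaling by [rt], [entrywise_approx] puts [lam * x v] within [eB * d] of the evidence at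
    [v]. At a sign error [lam * x v] points against the label, which leaves at most [eB * d] for the
    margin. *)
Lemma spectral_errors : exists r : bool, forall v,
  sign_vector (u1 G) v != mulsign r (sigma v) -> margin p q G sigma v <= eB * d.
Proof.
have [lam [r [Ax lam_ge lam_le x1 xs]]] := top_llr_close near0 e2_ge0 epsE.
have yv v : exists y : 'I_n -> R, nrm2 (fun w => rt * (sg r * u1 G 0 w) - rt * y w) <=
    c ^+ 2 * (rt * (sg r * u1 G 0 v)) ^+ 2 /\
    \sum_(w | dl' < `|rt * y w - sg (sigma w)|) N G v w <= dl * d.
  have [lamv [rv [By _ _ y1 ys]]] := top_llr_close (nearv v) e2_ge0 epsE.
  exists (fun w => sg rv * u1 (censor v G) 0 w); split.
    have h := ler_wpM2l (sqr_ge0 rt) (leave_one_out Ax By x1 y1 xs ys lam_ge lam_le).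
    rewrite -nrm2Z [leRHS]mulrCA -exprMn in h; apply: le_trans h.
    by rewrite le_eqVlt; apply/orP; left; apply/eqP; apply: eq_bigr => w _; ring.
  pose S := [set w | dl' < `|rt * (sg rv * u1 (censor v G) 0 w) - sg (sigma w)|].
  (* Chebyshev's inequality: few coordinates of the censored eigenvector are far from the labels. *)
  have Scard : #|S|%:R <= eps / dl' ^+ 2 * n%:R.
    rewrite [leRHS]mulrAC ler_pdivlMr ?exprn_gt0//; last by case/andP: dl'01.
    rewrite -rt2 [eps * _]mulrC; apply: le_trans (ler_wpM2l (sqr_ge0 rt) ys).
    rewrite -nrm2Z mulr_natl -sumr_const.
    apply: (@le_trans _ _ (\sum_(w in S) (rt * (sg rv * u1 (censor v G) 0 w - s w)) ^+ 2)).
      apply: ler_sum => w; rewrite inE => /ltW h.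
      rewrite -[leRHS]real_normK ?num_real// lerXn2r ?nnegrE//.
        by case/andP: dl'01 => /ltW.
      apply: le_trans h _; rewrite mulrBr /s [rt * (_ / rt)]mulrC divfK//.
      by rewrite gt_eqF.
    rewrite [leLHS]big_mkcond; apply: ler_sum => w _; case: ifP => // _.
    exact: sqr_ge0.
  apply: le_trans (isolated Scard).
  by rewrite le_eqVlt; apply/orP; left; apply/eqP; apply: eq_bigl => w; rewrite inE.
have [Z ZP] := choice yv.
pose x w := rt * (sg r * u1 G 0 w).
have lam_half : l0 * d / 2 <= lam.
  apply: le_trans lam_ge; rewrite mulrAC ler_wpM2r ?(ltW d_gt0)//.
  by move: lamE; lra.
have lam_gt0 : 0 < lam by apply: lt_le_trans lam_half; rewrite divr_gt0// mulr_gt0.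
have Wx v : \sum_w W G v w * x w = lam * x v.
  rewrite /x mulrCA -Ax mulr_sumr; apply: eq_bigr => w _; ring.
have M0E : 4 * Y * (K * d) / lam <= 8 * Y * K / l0.
  rewrite ler_pdivrMr// [leRHS]mulrAC ler_pdivlMr//.
  rewrite [leLHS](_ : _ = 8 * Y * K * (l0 * d / 2)); last by field.
  by rewrite ler_wpM2l// !mulr_ge0.
have Kd0 : 0 <= K * d by rewrite mulr_ge0// ltW.
have main := @entrywise_approx R n (W G) (N G) Y x (fun v w => rt * Z v w)
  (fun w => sg (sigma w)) lam c (K * d) (Num.sqrt (K * d)) (dl * d) dl'
  n_gt0 (N_ge0 G) degrees Y_ge0 (W_le G) (fun w => sg_norm1 (sigma w)) lam_gt0 Wx c_ge0
  _ (sqrtr_ge0 _) (fun v => proj1 (ZP v)) (fun v => proj2 (ZP v)).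
have {}main v : `|lam * x v - \sum_w W G v w * sg (sigma w)| <= eB * d.
  apply: le_trans (main _ _ _ _ v) _.
  - by case/andP: dl'01 => /ltW -> ->.
  - move=> i; rewrite sqr_sqrtr//; apply: le_trans (degrees i); apply: ler_sum => j _.
    by rewrite /N; case: (rev G i j); rewrite ?expr1n ?expr0n.
  - by move: large1 lam_half; lra.
  - by have := ler_wpM2r (ltW d_gt0) dlE; move: lam_half; lra.
  have e1 : Y * Num.sqrt (K * d) * c * (4 * Y * (K * d) / lam) <= eB * d / 2.
    by apply: le_trans large2; rewrite ler_wpM2l// !mulr_ge0// sqrtr_ge0.
  have e3 : Y * (dl * d * ((1 + c) * (4 * Y * (K * d) / lam) + 1) + dl' * (K * d)) <= eB / 2 * d.
    apply: le_trans (ler_wpM2r (ltW d_gt0) dlE').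
    rewrite [leRHS](_ : _ = Y * (dl * d * ((1 + c) * (8 * Y * K / l0) + 1) + dl' * (K * d)));
      last by ring.
    apply: ler_wpM2l => //; rewrite lerD2r; apply: ler_wpM2l.
      by apply: mulr_ge0 => //; exact: ltW.
    by rewrite lerD2r; apply: ler_wpM2l M0E; rewrite addr_ge0.
  lra.
exists r => v err.
have sgn : sg (sigma v) * (sg r * u1 G 0 v) <= 0.
  move: err; rewrite /sign_vector ffunE; move: (u1 G 0 v) => z; clear.
  rewrite /mulsign /sg; case: (lerP 0 z) => [h|/ltW h]; case: r; case: (sigma v) => //= _;
  by rewrite ?mul1r ?mulN1r ?opprK ?oppr_le0.
have := main v; rewrite ler_norml => /andP[m1 m2].
rewrite /margin /evidence -/(W G).
set A := \sum_w _ in m1 m2 *.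
have xv : lam * (sg (sigma v) * x v) <= 0.
  rewrite /x [sg _ * (rt * _)]mulrCA pmulr_rle0// pmulr_rle0//.
have : sg (sigma v) * A = lam * (sg (sigma v) * x v) - sg (sigma v) * (lam * x v - A) by ring.
move=> ->; have : `|sg (sigma v) * (lam * x v - A)| <= eB * d.
  by rewrite normrM sg_norm1 mul1r.
rewrite ler_norml => /andP[h _]; move: xv h; lra.
Qed.

End GoodEvent.

(** * Comparison of the two estimators *)

Section LowMargins.
Context {R : realType} {n : nat}.
Variables (p q alpha : R) (sigma : labels n) (G : observation n).

(** The cut norm is tested against the labels restricted to the low-margin set on one side and all
    labels on the other. The mean contributes about [alpha * n * kl_sum] per vertex of the set, so
    when [tau] is well below this a large set violates the cut bound. *)
Lemma few_low_margins (kappa bal tau : R) : 0 <= alpha ->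
  `|\sum_i sg (sigma i)| <= bal * n%:R :> R ->
  (forall a b : labels n, \sum_i \sum_j
     (llr_mx p q G i j - mean_mx p q alpha sigma i j) * sg (a i) * sg (b j) <= kappa * n%:R) ->
  #|[set v | margin p q G sigma v <= tau]|%:R *
    (alpha * n%:R * (kl_sum p q - `|kl_diff p q| * bal) - tau) <= kappa * n%:R.
Proof.
move=> a0 balanced cut; set U := [set v | _].
pose a i : R := (i \in U)%:R * sg (sigma i).
have sg1 i : `|sg (sigma i) : R| <= 1 by rewrite sg_norm1.
have a1 i : `|a i| <= 1.
  by rewrite /a; case: (i \in U); rewrite ?mul1r// mul0r normr0.
have := cut_norm_convex cut a1 sg1; rewrite ler_norml => /andP[h _].
have split_sum :
  \sum_i \sum_j (llr_mx p q G i j - mean_mx p q alpha sigma i j) * a i * sg (sigma j) =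
   \sum_(i in U) margin p q G sigma i -
   \sum_(i in U) alpha * (kl_sum p q * n%:R + kl_diff p q * (sg (sigma i) * \sum_j sg (sigma j))).
  rewrite -sumrB [RHS]big_mkcond; apply: eq_bigr => i _.
  rewrite /a; case: (i \in U); last by rewrite big1// => j _; rewrite !mul0r mulr0 mul0r.
  rewrite /margin /evidence !mulr_sumr -[n in kl_sum p q * n%:R]card_ord -sumr_const.
  rewrite mulr_sumr -big_split mulr_sumr -sumrB; apply: eq_bigr => j _ /=.
  rewrite mul1r mean_mxE; have := sg_sqr (sigma j) : _ = 1 :> R.
  have := sg_sqr (sigma i) : _ = 1 :> R.
  set si := sg (sigma i); set sj := sg (sigma j) => ei ej.
  rewrite [LHS](_ : _ = si * (llr_mx p q G i j * sj) -
    alpha * (kl_sum p q * ((si * si) * (sj * sj)) +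
    kl_diff p q * (si * sj))); last by ring.
  by rewrite ei ej !mulr1.
have up : \sum_(i in U) margin p q G sigma i <= #|U|%:R * tau.
  rewrite mulr_natl -sumr_const; apply: ler_sum => i; by rewrite inE.
have low : #|U|%:R * (alpha * n%:R * (kl_sum p q - `|kl_diff p q| * bal)) <=
   \sum_(i in U) alpha * (kl_sum p q * n%:R + kl_diff p q * (sg (sigma i) * \sum_j sg (sigma j))).
  rewrite mulr_natl -sumr_const; apply: ler_sum => i _.
  rewrite -mulrA ler_wpM2l// mulrBr mulrC lerD2l lerNl.
  apply: le_trans (ler_norm _) _; rewrite normrN !normrM sg_norm1 mul1r.
  rewrite mulrCA ler_wpM2l// mulrC//.
by rewrite split_sum in h; rewrite mulrBr; lra.
Qed.

End LowMargins.

(** * Error counts up to a global sign *)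

Section Misclass.
Context {R : realType} {n : nat}.
Implicit Types (est s : labels n).

Definition errors (r : bool) est s := [set u | est u != mulsign r (s u)].

Lemma misclassE r est s : misclass R r est s = #|errors r est s|%:R / n%:R.
Proof.
rewrite /misclass mulrC; congr (_ / _); rewrite -natr_sum; congr (_%:R).
by rewrite -sum1_card [RHS]big_mkcond; apply: eq_bigr => u _; rewrite inE; case: ifP.
Qed.

Lemma errorsN r est s : (#|errors r est s| + #|errors (~~ r) est s|)%N = n.
Proof.
have -> : errors (~~ r) est s = ~: errors r est s.
  apply/setP => u; rewrite !inE /mulsign.
  by case: r; case: (est u); case: (s u).
by rewrite cardsC card_ord.
Qed.

Lemma min_misclass r est s : (2 * #|errors r est s| <= n)%N ->
  Num.min (misclass R true est s) (misclass R false est s) = misclass R r est s.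
Proof.
move=> h; have le : misclass R r est s <= misclass R (~~ r) est s.
  rewrite !misclassE ler_wpM2r ?invr_ge0// ler_nat -(leq_add2l #|errors r est s|).
  by rewrite errorsN addnn -mul2n.
by case: r h le => /= _ le; [exact/min_idPl|exact/min_idPr].
Qed.

Lemma misclass01 r est s : 0 <= misclass R r est s <= 1.
Proof.
rewrite misclassE divr_ge0//=; case: (posnP n) => [n0|n0].
  have -> : n%:R = 0 :> R by rewrite n0.
  by rewrite invr0 mulr0.
rewrite ler_pdivrMr ?ltr0n// mul1r ler_nat.
by apply: leq_trans (max_card _) _; rewrite card_ord.
Qed.

Lemma min_misclass01 est s :
  0 <= Num.min (misclass R true est s) (misclass R false est s) <= 1.
Proof.
have /andP[a0 a1] := misclass01 true est s; have /andP[b0 b1] := misclass01 false est s.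
by rewrite le_min a0 b0 ge_min a1.
Qed.

End Misclass.

(** * Disagreements at one vertex and their total *)

Section Comparison.
Context {R : realType} {n : nat}.
Implicit Types (s : labels n) (G : observation n) (u v : 'I_n).
Variables p q alpha : R.
Hypotheses (hp : 0 < p < 1) (hq : 0 < q < 1) (ha : 0 < alpha < 1).
Variable spec : observation n -> labels n.

Let E (F : labels n -> observation n -> R) := model_E p q alpha F.
Let Y := llr_bound p q.

Variables (tau : R) (k : nat) (Delta A b : R).
Variable good : labels n -> observation n -> bool.

Let C := 2 * Y * k%:R.
Let low s G v : bool := margin p q G s v <= tau.

Hypothesis n_ge4 : (4 <= n)%N.
Hypothesis C_le : C <= tau.
Hypothesis good_spec : forall s G, good s G ->
  exists r : bool, forall v, spec G v != mulsign r (s v) -> low s G v.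
Hypothesis good_few : forall s G, good s G -> (8 * #|[set v | low s G v]| <= n)%N.
Hypothesis good_nbr : forall s G, good s G -> forall u,
  (#|[set v | rev G u v && low s G v]| <= k)%N.
Hypothesis good_deg : forall s G, good s G -> forall u,
  \sum_v (rev G u v)%:R <= Delta.
Hypothesis good_prob : E (fun s G => (~~ good s G)%:R) <= b.

(** Ties apart, the only way for a good sample to make the estimators disagree at [u]. The first two
    conditions depend on the row of [u] alone; the degree bound limits a later union over the
    revealed neighbours. *)
Let suspicious u s G : bool := [&& `|margin p q G s u| <= C,
  \sum_v (rev G u v)%:R <= Delta & [exists v, rev G u v && low s G v]].

Hypothesis A_ge0 : 0 <= A.
Hypothesis suspicious_prob : forall u, E (fun s G => (suspicious u s G)%:R) <=
  A * E (fun s G => (`|margin p q G s u| <= C)%R%:R).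

Let two G : labels n := two_step p p q G (spec G).

(* The sign of the spectral labelling is recovered from the other vertices, so
   that it does not depend on the label of [u]. *)
Let majority u s G : bool :=
  (2 * #|[set v | (v != u) && (spec G v != s v)]| <= n)%N.

Let est s G u : bool := two G u == majority u s G.

Lemma majority_flip u s G : majority u (flip u s) G = majority u s G.
Proof.
rewrite /majority; congr (_ * _ <= _)%N; apply: eq_card => v; rewrite !inE ffunE.
by case: eqP.
Qed.

(** At most n/8 errors against [r], and one excluded vertex, leave a clear majority once
    [n >= 4]. *)
Lemma majorityE r u s G : (8 * #|[set v | low s G v]| <= n)%N ->
  (forall v, spec G v != mulsign r (s v) -> low s G v) -> majority u s G = r.
Proof.
move=> few specr.
have sub : (#|errors r (spec G) s| <= #|[set v | low s G v]|)%N.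
  by apply: subset_leq_card; apply/fintype.subsetP => v; rewrite !inE => /specr.
rewrite /majority; set M := [set v | _].
have ME : (#|M| <= #|errors true (spec G) s| <= #|M|.+1)%N.
  have errT v : (v \in errors true (spec G) s) = (spec G v != s v).
    by rewrite inE /mulsign; case: (s v).
  apply/andP; split.
    by apply: subset_leq_card; apply/fintype.subsetP => v; rewrite errT inE => /andP[].
  have : errors true (spec G) s \subset u |: M.
    by apply/fintype.subsetP => v; rewrite errT !inE => ->; case: eqP.
  move=> /subset_leq_card /leq_trans; apply; rewrite cardsU1.
  by rewrite -add1n leq_add2r leq_b1.
have EN := errorsN r (spec G) s.
move: few sub ME EN n_ge4; move: #|[set v | low s G v]| #|M| => a m.
case: r {specr} => /=; move: #|errors true (spec G) s| #|errors false (spec G) s| => e e'.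
  move=> few sub /andP[ME _] _ _; apply/idP; clear -few sub ME; lia.
move=> few sub /andP[_ ME] EN n4; apply/negbTE; rewrite -ltnNge; clear -few sub ME EN n4; lia.
Qed.

(** Only misclassified revealed neighbours move the evidence, each by at most [2 * Y], and at most
    [k] of them exist. *)
Lemma evidence_close r u s G : good s G ->
  (forall v, spec G v != mulsign r (s v) -> low s G v) ->
  `|sg r * evidence p q G (spec G) u - evidence p q G s u| <= C.
Proof.
move=> gd specr.
have -> : sg r * evidence p q G (spec G) u - evidence p q G s u =
   \sum_v llr_mx p q G u v * (sg r * sg (spec G v) - sg (s v)).
  by rewrite /evidence mulr_sumr -sumrB; apply: eq_bigr => v _; ring.
apply: le_trans (ler_norm_sum _ _ _) _.
apply: (@le_trans _ _ (\sum_v (if rev G u v && low s G v then 2 * Y else 0))).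
  apply: ler_sum => v _; rewrite normrM /rev /llr_mx.
  have [->|/eqP rv] := eqVneq (pair_status G u v) None; first by rewrite /= normr0 mul0r.
  have [ok|bad] := eqVneq (spec G v) (mulsign r (s v)).
    have -> : sg r * sg (spec G v) - sg (s v) = 0 :> R.
      rewrite ok /mulsign -sgM mulrA sg_sqr mul1r subrr//.
    by rewrite normr0 mulr0; case: ifP => // _; rewrite mulr_ge0// addr_ge0.
  rewrite (specr _ bad) /= mulrC; apply: ler_pM => //; last exact: normr_llr.
  apply: le_trans (ler_normB _ _) _; rewrite normrM !sg_norm1 mul1r.
  by have := lexx (2 : R); lra.
rewrite -big_mkcond sumr_const -[_ *+ _]mulr_natr /C.
apply: ler_wpM2l; first by rewrite mulr_ge0// addr_ge0.
rewrite ler_nat; apply: leq_trans (good_nbr gd u).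
by apply: subset_leq_card; apply/fintype.subsetP => v; rewrite inE.
Qed.

Lemma evidence_exact r u s G :
  (forall v, spec G v != mulsign r (s v) -> low s G v) ->
  ~~ [exists v, rev G u v && low s G v] ->
  evidence p q G (spec G) u = sg r * evidence p q G s u.
Proof.
move=> specr; rewrite negb_exists => /forallP none.
rewrite /evidence mulr_sumr; apply: eq_bigr => v _.
have := none v; rewrite negb_and /rev negbK => /orP[/eqP rv|nlow].
  by rewrite /llr_mx rv /= !mul0r mulr0.
have ok : spec G v = mulsign r (s v) by apply/eqP; apply: contraNT nlow => /specr.
by rewrite ok /mulsign -sgM; ring.
Qed.

(** Either no revealed neighbour is low and the evidences agree up to the global sign, or the
    evidence exceeds [C] in absolute value and survives the discrepancy. Ties are excluded because
    reversing the global sign does not reverse the convention at 0. *)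
Lemma est_genie u s G : good s G -> ~~ suspicious u s G -> margin p q G s u != 0 ->
  est s G u = (0 <= evidence p q G s u).
Proof.
move=> gd nsus m0.
have [r specr] := good_spec gd.
rewrite /est (majorityE u (good_few gd) specr) /two two_stepE//.
have e0 : evidence p q G s u != 0.
  by apply: contraNneq m0 => e0; rewrite /margin e0 mulr0.
set Lam := evidence p q G s u in e0 *.
have [ex|nex] := boolP [exists v, rev G u v && low s G v]; last first.
  rewrite (evidence_exact specr nex) -/Lam; case: r {specr}; rewrite /sg.
    by rewrite mul1r; case: (0 <= _).
  rewrite mulN1r oppr_ge0; move: e0; case: (ltgtP Lam 0) => //.
have bigC : C < `|Lam|.
  move: nsus; rewrite /suspicious (good_deg gd u) ex !andbT -ltNge.
  by rewrite /margin normrM sg_norm1 mul1r.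
have := evidence_close u gd specr; rewrite -/Lam => /le_lt_trans/(_ bigC) h.
set g := evidence p q G (spec G) u in h *.
case: r h {specr}; rewrite /sg ?mul1r ?mulN1r => h.
  have -> : (0 <= g) = (0 <= Lam).
    case: (lerP 0 Lam) h => L h; rewrite ?(ger0_norm L) ?(ltr0_norm L) ltr_norml in h.
      by apply/idP; case/andP: h; lra.
    by apply/negbTE; rewrite -ltNge; case/andP: h; lra.
  by case: (0 <= Lam).
case: (lerP 0 Lam) h => L h; rewrite ?(ger0_norm L) ?(ltr0_norm L) ltr_norml in h.
  have -> : (0 <= g) = false; last by [].
  by apply/negbTE; rewrite -ltNge; case/andP: h; lra.
have -> : (0 <= g) = true; last by [].
by apply/idP; case/andP: h; lra.
Qed.

(** A vertex on which the two-step estimator errs has margin at most [C], hence is itself low. So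
    the sign [r] of the spectral labelling also attains the minimum in the error of the two-step
    estimator. *)
Lemma two_step_errors_few r s G : good s G ->
  (forall v, spec G v != mulsign r (s v) -> low s G v) ->
  (2 * #|errors r (two G) s| <= n)%N.
Proof.
move=> gd specr; have few := good_few gd.
suff : (#|errors r (two G) s| <= #|[set v | low s G v]|)%N by move: few; lia.
apply: subset_leq_card; apply/fintype.subsetP => u; rewrite !inE => err.
rewrite /low; apply: le_trans C_le.
have := evidence_close u gd specr; rewrite ler_norml => /andP[h1 h2].
move: err; rewrite /two two_stepE// /margin.
set g := evidence p q G (spec G) u in h1 h2 *; set Lam := evidence p q G s u in h1 h2 *.
case: (s u); case: r h1 h2 {specr}; rewrite /sg /mulsign /= ?mul1r ?mulN1r => h1 h2;
  case: (lerP 0 g) => // g0 _; lra.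
Qed.

Let gen s G : labels n := [ffun u => 0 <= evidence p q G s u].

Lemma genie_errors_few s G : good s G -> (2 * #|errors true (gen s G) s| <= n)%N.
Proof.
move=> gd; have few := good_few gd.
suff : (#|errors true (gen s G) s| <= #|[set v | low s G v]|)%N.
  by move: few; lia.
apply: subset_leq_card; apply/fintype.subsetP => u; rewrite !inE ffunE => err.
have Y0 : 0 <= Y by rewrite addr_ge0.
rewrite /low; apply: le_trans C_le; apply: (@le_trans _ _ 0); last by rewrite !mulr_ge0.
move: err; rewrite /margin; set Lam := evidence p q G s u.
by case: (s u); rewrite /sg /mulsign /= ?mul1r ?mulN1r; case: (lerP 0 Lam) => //= h _;
  rewrite ?oppr_le0 // ltW.
Qed.

Let avg (e : labels n -> observation n -> labels n) s G : R :=
  n%:R^-1 * \sum_u (e s G u != s u)%:R.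

Let minerr (e : labels n -> observation n -> labels n) s G : R :=
  Num.min (misclass R true (e s G) s) (misclass R false (e s G) s).

Lemma avg_errors e s G : avg e s G = misclass R true (e s G) s.
Proof.
by rewrite /avg /misclass; congr (_ * _); apply: eq_bigr => u _.
Qed.

Lemma indicator_diff (x y : R) (g : bool) : (g -> x = y) -> 0 <= x <= 1 -> 0 <= y <= 1 ->
  `|x - y| <= (~~ g)%:R.
Proof.
case: g => [/(_ isT) ->|_] /=; first by rewrite subrr normr0.
by move=> /andP[? ?] /andP[? ?]; rewrite ler_norml; lra.
Qed.

Lemma bool_dist (x y : bool) : `|x%:R - y%:R| <= 1 :> R.
Proof.
by case: x; case: y; rewrite ?subrr ?subr0 ?sub0r ?normrN ?normr0 ?normr1.
Qed.

Lemma model_E_dist F F' F'' : (forall s G, `|F s G - F' s G| <= F'' s G) ->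
  `|E F - E F'| <= E F''.
Proof.
move=> h; rewrite ler_norml; apply/andP; split.
  rewrite lerBrDr addrC lerBlDr -(@model_ED _ _ p q alpha).
  apply: (le_model_E hp hq ha) => s G; have := h s G; rewrite ler_norml => /andP[]; lra.
rewrite lerBlDr -(@model_ED _ _ p q alpha).
apply: (le_model_E hp hq ha) => s G; have := h s G; rewrite ler_norml => /andP[]; lra.
Qed.

Let estl s G : labels n := [ffun u => est s G u].

Lemma minerr_two_step : `|E (minerr (fun _ => two)) - E (avg estl)| <= b.
Proof.
apply: le_trans good_prob; apply: model_E_dist => s G.
apply: indicator_diff; rewrite ?avg_errors ?misclass01 ?min_misclass01// => gd.
have [r specr] := good_spec gd.
rewrite /minerr (min_misclass (two_step_errors_few gd specr)) /misclass.
congr (_ * _); apply: eq_bigr => u _; congr (_%:R).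
rewrite [estl s G u]ffunE /est (majorityE u (good_few gd) specr) /mulsign.
by case: r {specr}; case: (two G u); case: (s u).
Qed.

Lemma minerr_genie : `|E (minerr gen) - E (avg gen)| <= b.
Proof.
apply: le_trans good_prob; apply: model_E_dist => s G.
apply: indicator_diff; rewrite ?avg_errors ?misclass01 ?min_misclass01// => gd.
by rewrite /minerr (min_misclass (genie_errors_few gd)).
Qed.

Let err (e : labels n -> observation n -> labels n) u := E (fun s G => (e s G u != s u)%:R).

Lemma E_avg e : E (avg e) = n%:R^-1 * \sum_u err e u.
Proof. by rewrite /E /avg model_EZ model_E_sum. Qed.

Lemma err_genie u : err gen u = E (fun s G => (genie_wrong p q u s G)%:R).
Proof. by apply: model_E_ext => s G; rewrite ffunE. Qed.

(** Neither guess at [u] sees the label of [u], so [tie_half] gives both the same contribution on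
    ties and these cancel. What remains is the bad event and the suspicious one, the latter
    converted into genie errors by [small_margin_genie]. *)
Lemma err_dist u : `|err estl u - err gen u| <= b + A * (2 * (1 + expR C)) * err gen u.
Proof.
have splitE e : err e u = E (fun s G => ((margin p q G s u == 0) && (e s G u != s u))%:R) +
    E (fun s G => ((margin p q G s u != 0) && (e s G u != s u))%:R).
  rewrite -(@model_ED _ _ p q alpha); apply: model_E_ext => s G.
  by case: (_ == 0); case: (_ != _); rewrite /= ?addr0 ?add0r.
have tie e : (forall s G, e (flip u s) G u = e s G u) ->
    E (fun s G => ((margin p q G s u == 0) && (e s G u != s u))%:R) =
    2^-1 * E (fun s G => (margin p q G s u == 0)%R%:R).
  by move=> eflip; exact: (tie_half alpha hp hq (h := fun s G => e s G u) eflip).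
have t1 := tie estl; have t2 := tie gen.
set rhs := b + _; rewrite !splitE {}t1; last by move=> s G; rewrite !ffunE /est majority_flip.
rewrite {}t2; last by move=> s G; rewrite !ffunE evidence_flip.
rewrite opprD addrACA subrr add0r.
have Y0 : 0 <= Y by rewrite addr_ge0.
have C0 : 0 <= C by rewrite !mulr_ge0.
apply: (@le_trans _ _ (E (fun s G => (~~ good s G)%:R + (suspicious u s G)%:R))).
  apply: model_E_dist => s G.
  have [gd|_] := boolP (good s G); last first.
    by apply: le_trans (bool_dist _ _) _; rewrite /= lerDl.
  have [_|nsus] := boolP (suspicious u s G).
    by apply: le_trans (bool_dist _ _) _; rewrite /= lerDr.
  have [m0|m0] := eqVneq (margin p q G s u) 0; first by rewrite /= subrr normr0 addr_ge0.
  by rewrite !ffunE (est_genie gd nsus m0) subrr normr0 addr_ge0.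
rewrite /E (@model_ED _ _ p q alpha) /rhs lerD//.
apply: le_trans (suspicious_prob u) _; rewrite -mulrA ler_wpM2l//.
by rewrite err_genie; exact: small_margin_genie.
Qed.

(** Of the coefficient of [b], one unit comes from [err_dist], two from fixing the global sign in
    the two error rates, and the term with [A] from fixing it inside the relative error. *)
Lemma two_step_genie_dist : 
  `|E (minerr (fun _ => two)) - E (minerr gen)| <=
  A * (2 * (1 + expR C)) * E (minerr gen) + (3 + A * (2 * (1 + expR C))) * b.
Proof.
set a := A * _.
have a0 : 0 <= a by rewrite !mulr_ge0// addr_ge0 ?expR_ge0.
have n0 : 0 < n%:R :> R by rewrite ltr0n (leq_trans _ n_ge4).
have h : `|E (avg estl) - E (avg gen)| <= b + a * E (avg gen).
  rewrite !E_avg -mulrBr normrM ger0_norm ?invr_ge0 ?(ltW n0)//.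
  rewrite -sumrB mulrC ler_pdivrMr//; apply: le_trans (ler_norm_sum _ _ _) _.
  apply: le_trans (ler_sum _ (fun u _ => err_dist u)) _.
  rewrite big_split /= sumr_const card_ord -[_ *+ n]mulr_natr -mulr_sumr -/a mulrDl lerD2l.
  by rewrite le_eqVlt; apply/orP; left; apply/eqP; field; rewrite gt_eqF.
have h1 := minerr_two_step; have h2 := minerr_genie.
move: h h1 h2; rewrite !ler_norml => /andP[h h'] /andP[h1 h1'] /andP[h2 h2'].
have h3 : a * E (avg gen) <= a * (E (minerr gen) + b).
  by rewrite ler_wpM2l//; lra.
by rewrite mulrDr in h3; apply/andP; split; rewrite mulrDl; lra.
Qed.

End Comparison.

(** * Choice of the constants *)

Section Constants.
Context {R : realType}.
Variables p q t : R.
Hypotheses (hp : 0 < p < 1) (hq : 0 < q < 1) (hpq : p != q) (t_gt0 : 0 < t).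

(** Gibbs' inequality, from [exp x >= 1 + x], strict for the present status as [p != q]. *)
Lemma kl_signs : 0 < kl p q true /\ kl p q false < 0.
Proof.
move: (hp) (hq) => /andP[p0 p1] /andP[q0 q1].
have [e1 e2] := expR_llr hp hq.
have L1 : llr p q (Some true) != 0 by exact: ln_ratio_neq0.
rewrite /kl /label_prob; set l1 := llr p q (Some true) in e1 L1 *.
set l2 := llr p q (Some false) in e2 *.
have e3 : q * expR l1 = p by rewrite -e1 -mulrA -expRD addNr expR0 mulr1.
have e4 : (1 - q) * expR l2 = 1 - p by rewrite -e2 -mulrA -expRD addNr expR0 mulr1.
have p1' : 0 <= 1 - p by rewrite subr_ge0 ltW.
have q1' : 0 <= 1 - q by rewrite subr_ge0 ltW.
have Ln1 : - l1 != 0 by rewrite oppr_eq0.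
have h1 : p * (1 - l1) < q by rewrite -[ltRHS]e1 ltr_pM2l//; exact: expR_gt1Dx.
have h2 : (1 - p) * (1 - l2) <= 1 - q by rewrite -[leRHS]e2 ler_wpM2l//; exact: expR_ge1Dx.
have h3 : q * (1 + l1) < p by rewrite -[ltRHS]e3 ltr_pM2l//; exact: expR_gt1Dx.
have h4 : (1 - q) * (1 + l2) <= 1 - p by rewrite -[leRHS]e4 ler_wpM2l//; exact: expR_ge1Dx.
split; lra.
Qed.

Lemma llr_bound_gt0 : 0 < llr_bound p q.
Proof.
rewrite /llr_bound ltr_pwDl// normr_gt0; exact: ln_ratio_neq0.
Qed.

(** Serves to choose the constants: several smallness requirements are met at once by the inverse of
    one plus their sum. *)
Lemma small_scale (a b c e : R) : 0 <= a -> 0 <= b -> 0 <= c -> 0 <= e ->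
  exists x, [/\ 0 < x <= 1, a * x <= 1, b * x <= 1, c * x <= 1 & e * x <= 1].
Proof.
move=> a0 b0 c0 e0; have S0 : 0 < 1 + a + b + c + e by lra.
exists (1 + a + b + c + e)^-1; split; rewrite ?invr_gt0 ?S0//= ?ler_pdivrMr//;
  first rewrite invf_le1//; lra.
Qed.

Lemma sqrt_le_lin (a c d : R) : 0 < c -> 0 < d -> a / c ^+ 2 <= d -> Num.sqrt (a * d) <= c * d.
Proof.
move=> c0 d0; rewrite ler_pdivrMr ?exprn_gt0// => h.
have cd : 0 <= c * d by rewrite mulr_ge0// ltW.
rewrite -[leRHS]ger0_norm// -sqrtr_sqr ler_wsqrtr// exprMn [d ^+ 2]expr2 mulrA.
by rewrite ler_wpM2r ?(ltW d0)// mulrC.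
Qed.

Lemma kl_sum_gt0 : 0 < t * kl_sum p q.
Proof.
have [h1 h2] := kl_signs; rewrite mulr_gt0// /kl_sum; lra.
Qed.

Lemma kl_diff_lt_sum : t * kl_diff p q < t * kl_sum p q.
Proof.
have [h1 h2] := kl_signs; rewrite ltr_pM2l// /kl_sum /kl_diff; lra.
Qed.

End Constants.

(* The constants are chosen in the order dl, dl', eps, e2, bal, eS, T, kappa, each
   small enough (T large enough) in terms of the previous ones.  The cardinals
   [exp (- 8 / eS) / t * n] and [exp (- 5 / dl) / t * n] are those for which
   Chernoff's bound at the parameters 8 / eS and 5 / dl gives a sufficiently
   high power of 1 / n. *)
Lemma spectral_constants (R : realType) (p q t : R) (eB K : R) :
  0 < p < 1 -> 0 < q < 1 -> p != q -> 0 < t -> 0 < eB -> 0 < K ->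
  exists bal kappa eS dl dl' D : R,
    [/\ 0 < bal <= 1 /\ `|t * kl_diff p q| * bal <= t * kl_sum p q / 4,
      0 < kappa /\ kappa <= t * kl_sum p q / 32,
      0 < eS, 0 < dl /\ 0 < dl' &
      forall (n : nat) (d alpha : R) (sigma : labels n) (G : observation n)
      (u1 : observation n -> 'rV[R]_n),
      (0 < n)%N -> 0 < alpha < 1 -> 1 <= d -> D <= d -> D <= Num.sqrt n%:R ->
      alpha * n%:R = t * d ->
      (forall H, top_unit_eigenvector (spectral_matrix p q H) (u1 H)) ->
      `|\sum_i sg (sigma i)| <= bal * n%:R :> R ->
      (forall i, \sum_j (rev G i j)%:R <= K * d) ->
      (forall S : {set 'I_n}, #|S|%:R <= expR (- (8 / eS)) / t * n%:R ->
         \sum_(i in S) \sum_(j in S) (rev G i j)%:R <= eS * d * #|S|%:R) ->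
      (forall a b : labels n, \sum_i \sum_j
       (llr_mx p q G i j - mean_mx p q alpha sigma i j) * sg (a i) * sg (b j) <=
       kappa * d * n%:R) ->
      (forall v (r : bool), let S := [set w | dl' < `|Num.sqrt n%:R *
           (sg r * u1 (censor v G) 0 w) - sg (sigma w)|] in
         #|S|%:R <= expR (- (5 / dl)) / t * n%:R ->
         \sum_(w in S) (rev G v w)%:R <= dl * d) ->
      exists r : bool, forall v, sign_vector (u1 G) v != mulsign r (sigma v) ->
        margin p q G sigma v <= eB * d].
Proof.
move=> hp hq hpq t_gt0 eB0 K0.
set l0 := t * kl_sum p q; set k0 := t * kl_diff p q; pose Y := llr_bound p q.
have Y0 : 0 < Y := llr_bound_gt0 hp hq hpq; have l00 : 0 < l0 := kl_sum_gt0 hp hq hpq t_gt0.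
have kl0 : k0 < l0 := kl_diff_lt_sum hp hq hpq t_gt0.
pose kp0 := Num.max k0 0; have kp00 : 0 <= kp0 by rewrite le_max lexx orbT.
have k0kp : k0 <= kp0 by rewrite le_max lexx.
have kpl : kp0 < l0 by rewrite gt_max kl0.
pose g := l0 - kp0; have g0 : 0 < g by rewrite subr_gt0.
have K0' := ltW K0; have Y0' := ltW Y0; have l0' := ltW l00; have g0' := ltW g0.
have nk0 : 0 <= `|k0| by [].
(* The requirement is on [c ^+ 2], and [c >= 1] gives [c <= c ^+ 2], which avoids a root. The term
   [2 * l0] leaves room for [e2], fixed later below [l0]. *)
pose c := 1 + 8 / g ^+ 2 * (Y ^+ 2 * K + (2 * l0 + `|k0|) ^+ 2).
have c1 : 1 <= c.
  rewrite lerDl mulr_ge0 ?divr_ge0 ?sqr_ge0// addr_ge0 ?sqr_ge0// mulr_ge0// sqr_ge0//.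
have c0 : 0 <= c by apply: le_trans c1.
pose M0 := 8 * Y * K / l0.
have M00 : 0 <= M0 by rewrite /M0 divr_ge0// !mulr_ge0.
have dlA0 : 0 <= 8 * (Y * (1 + c)) / l0 by rewrite divr_ge0// !mulr_ge0// addr_ge0.
have dlB0 : 0 <= 4 * (Y * ((1 + c) * M0 + 1)) / eB.
  by rewrite divr_ge0 ?(ltW eB0)// !mulr_ge0// addr_ge0// mulr_ge0// addr_ge0.
have [dl [/andP[dl0 _] dl1 dl2 _ _]] := small_scale dlA0 dlB0 (lexx 0) (lexx 0).
have dl'A0 : 0 <= 4 * (Y * K) / eB by rewrite divr_ge0 ?(ltW eB0)// !mulr_ge0.
have [dl' [/andP[dl'0 dl'1] dl'2 _ _ _]] := small_scale dl'A0 (lexx 0) (lexx 0) (lexx 0).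
pose eta2 := expR (- (5 / dl)) / t.
have eta20 : 0 < eta2 by rewrite divr_gt0 ?expR_gt0.
(* Brings the number [eps / dl' ^+ 2 * n] of misplaced coordinates below the size [eta2 * n] that
   [isolated] covers. *)
have epsA0 : 0 <= (eta2 * dl' ^+ 2)^-1 by rewrite invr_ge0 mulr_ge0 ?sqr_ge0// ltW.
have epsB0 : 0 <= 4 * l0 / g by rewrite divr_ge0// mulr_ge0.
have [eps [/andP[eps0 _] eps1 eps2 eps3 _]] := small_scale epsA0 epsB0 (ler0n R 4) (lexx 0).
have epsg0 : 0 <= eps * g by rewrite mulr_ge0// ltW.
have e2A0 : 0 <= 8 / (eps * g) by rewrite divr_ge0.
have e2B0 : 0 <= 16 / g by rewrite divr_ge0.
have e2C0 : 0 <= 4 / l0 by rewrite divr_ge0.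
have [e2 [/andP[e20 _] e21 e22 e23 _]] := small_scale e2A0 e2B0 e2C0 (lexx 0).
have balA0 : 0 <= 4 * (`|k0| + 3 * kp0) / (eps * g).
  by rewrite divr_ge0// mulr_ge0// addr_ge0// mulr_ge0.
have balB0 : 0 <= 8 * `|k0| / g by rewrite divr_ge0// mulr_ge0.
have balC0 : 0 <= 4 * `|k0| / l0 by rewrite divr_ge0// mulr_ge0.
have [bal [/andP[bal0 bal1] bal2 bal3 bal4 _]] := small_scale balA0 balB0 balC0 (lexx 0).
pose e1 := e2 / 2; have e10 : 0 < e1 by rewrite divr_gt0.
(* [beta] and [eS] make each of [Y * K / beta] and [Y * beta * eS] equal to [e1 / 8]. *)
pose beta := 8 * Y * K / e1; have beta0 : 0 < beta by rewrite divr_gt0// !mulr_gt0.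
pose eS := e1 / (8 * Y * beta); have eS0 : 0 < eS by rewrite divr_gt0// mulr_gt0// mulr_gt0.
pose rho := 1 + 8 * Y * K / e1.
have rho1 : 1 <= rho by rewrite lerDl divr_ge0 ?(ltW e10)// !mulr_ge0.
pose eta := expR (- (8 / eS)) / t; have eta0 : 0 < eta by rewrite divr_gt0 ?expR_gt0.
(* [T >= 1] gives [T ^+ 2 >= T >= rho ^+ 2 / eta], so the sets in the sparsity condition of
   [qf_bound] have at most [eta * n] elements. *)
pose T := 1 + 8 * t * Y / e1 + rho ^+ 2 / eta.
have TA0 : 0 <= 8 * t * Y / e1 by rewrite divr_ge0 ?(ltW e10)// !mulr_ge0// ltW.
have TB0 : 0 <= rho ^+ 2 / eta by rewrite divr_ge0 ?sqr_ge0// ltW.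
have T1 : 1 <= T by rewrite /T; move: TA0 TB0; clear; lra.
have T0 : 0 < T by apply: lt_le_trans T1.
have kapA0 : 0 <= 4 * T ^+ 2 / e1 by rewrite divr_ge0 ?(ltW e10)// mulr_ge0// sqr_ge0.
have kapB0 : 0 <= 32 / l0 by rewrite divr_ge0.
have [kappa [/andP[kap0 _] kap1 kap2 _ _]] := small_scale kapA0 kapB0 (lexx 0) (lexx 0).
pose D1 := 2 * (l0 + `|k0|) / e1.
pose s1 := l0 / (8 * Y * c); pose s2 := eB / (2 * Y * c * (M0 + 1)).
have c0' : 0 < c by apply: lt_le_trans c1.
have M01 : 0 < M0 + 1 by rewrite ltr_wpDl.
have s10 : 0 < s1 by rewrite divr_gt0// !mulr_gt0.
have s20 : 0 < s2 by rewrite divr_gt0// !mulr_gt0.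
(* [D1] keeps the cost of censoring below [e1]; the other two terms keep [sqrt (K * d)] below
   [s1 * d] and [s2 * d]. *)
pose D := D1 + K / s1 ^+ 2 + K / s2 ^+ 2.
have D10 : 0 <= D1 by rewrite divr_ge0 ?(ltW e10)// mulr_ge0// addr_ge0.
have D20 : 0 <= K / s1 ^+ 2 by rewrite divr_ge0 ?sqr_ge0.
have D30 : 0 <= K / s2 ^+ 2 by rewrite divr_ge0 ?sqr_ge0.
exists bal, kappa, eS, dl, dl', D; split.
- split; first by rewrite bal0.
  by move: bal4; rewrite mulrAC ler_pdivrMr// mul1r; clear; lra.
- by split=> //; move: kap2; rewrite mulrAC ler_pdivrMr// mul1r; clear; lra.
- exact: eS0.
- by [].
move=> n d alpha sigma G u1 n0 ha d1 Dd Dn alphaE u1P balanced degrees sparse cut isolated.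
have d0 : 0 < d by apply: lt_le_trans d1.
have rt0 : 0 < Num.sqrt n%:R :> R by rewrite sqrtr_gt0 ltr0n.
have near1 : near_rank_two p q t d sigma e1 (llr_mx p q G).
  apply: (near_rank_two_llr hp hq ha n0 d1 t_gt0 alphaE degrees rho1 T0 beta0 (ltW eS0)
    (kappa := kappa)).
  - move=> S hS; apply: sparse; rewrite -/eta.
    have T2 : rho ^+ 2 / eta <= T ^+ 2.
      apply: (@le_trans _ _ T); first by rewrite /T; move: TA0; clear; lra.
      by rewrite expr2 ler_peMl// ltW.
    rewrite -(ler_pM2r (exprn_gt0 2 T0)); apply: le_trans hS _.
    rewrite [leRHS]mulrAC ler_wpM2r ?ler0n//.
    by move: T2; rewrite ler_pdivrMr// mulrC.
  - exact: cut.
  have b1 : Y * (beta * eS) = e1 / 8.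
    by rewrite /eS; field; rewrite !gt_eqF.
  have b2 : Y * (beta^-1 * K) = e1 / 8.
    by rewrite /beta; field; rewrite !gt_eqF.
  have b3 : 2 * Y * K / rho <= e1 / 4.
    rewrite ler_pdivrMr; last by apply: lt_le_trans rho1.
    have -> : e1 / 4 * rho = e1 / 4 + 2 * Y * K.
      by rewrite /rho; field; rewrite gt_eqF.
    by rewrite lerDr ltW// divr_gt0.
  have b4 : 2 * (t * Y) / T <= e1 / 4.
    rewrite ler_pdivrMr//; apply: (@le_trans _ _ (e1 / 4 * (8 * t * Y / e1))).
      by rewrite le_eqVlt; apply/orP; left; apply/eqP; field; rewrite gt_eqF.
    rewrite ler_wpM2l//; first by rewrite divr_ge0// ltW.
    by rewrite /T; move: TB0; clear; lra.
  have b5 : T ^+ 2 * kappa <= e1 / 4.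
    by move: kap1; rewrite mulrAC ler_pdivrMr// mul1r; clear; lra.
  rewrite -/Y mulrDr b1 b2; move: b3 b4 b5; clear; lra.
have e120 : e1 + 2 * (l0 + `|k0|) / Num.sqrt n%:R <= e2.
  have : 2 * (l0 + `|k0|) / Num.sqrt n%:R <= e1.
    rewrite ler_pdivrMr//; apply: (@le_trans _ _ (e1 * D1)).
      by rewrite /D1 [e1 * _]mulrC divfK// gt_eqF.
    rewrite ler_wpM2l ?(ltW e10)//; apply: le_trans Dn; rewrite /D; move: D20 D30; clear; lra.
  by rewrite /e1; clear; lra.
have near2 v : near_rank_two p q t d sigma e2 (llr_mx p q (censor v G)).
  exact: (near_rank_two_censor n0 d1 kp00 kpl v near1 e120 (ltW e10)).
have near0 : near_rank_two p q t d sigma e2 (llr_mx p q G).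
  move=> x; apply: le_trans (near1 x) _; rewrite ler_wpM2r ?nrm2_ge0//.
  by rewrite ler_wpM2r ?(ltW d0)// /e1; move: e20; clear; lra.
have q1 : 8 * e2 <= eps * g by move: e21; rewrite mulrAC ler_pdivrMr ?mul1r// mulr_gt0.
have q2 : 16 * e2 <= g by move: e22; rewrite mulrAC ler_pdivrMr ?mul1r.
have q3 : 4 * e2 <= l0 by move: e23; rewrite mulrAC ler_pdivrMr ?mul1r.
have q4 : 4 * (`|k0| + 3 * kp0) * bal <= eps * g.
  by move: bal2; rewrite mulrAC ler_pdivrMr ?mul1r// mulr_gt0.
have q5 : 8 * `|k0| * bal <= g by move: bal3; rewrite mulrAC ler_pdivrMr ?mul1r.
have q6 : 4 * `|k0| * bal <= l0 by move: bal4; rewrite mulrAC ler_pdivrMr ?mul1r.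
have q7 : 4 * l0 * eps <= g by move: eps2; rewrite mulrAC ler_pdivrMr ?mul1r.
have q8 : Y * (1 + c) * dl <= l0 / 8.
  by move: dl1; rewrite mulrAC ler_pdivrMr ?mul1r//; clear; lra.
have q9 : 4 * (Y * ((1 + c) * M0 + 1)) * dl <= eB.
  by move: dl2; rewrite mulrAC ler_pdivrMr ?mul1r.
have q10 : 4 * (Y * K) * dl' <= eB by move: dl'2; rewrite mulrAC ler_pdivrMr ?mul1r.
have bigsqrt s : 0 < s -> K / s ^+ 2 <= D -> Num.sqrt (K * d) <= s * d.
  by move=> s0 sD; apply: sqrt_le_lin => //; apply: le_trans Dd.
apply: (spectral_errors hp hq hpq n0 d1 u1P k0kp kp00 kpl (ltW K0) bal1 balanced degrees
  (e2 := e2) (eps := eps) (c := c) (dl := dl) (dl' := dl') near0 near2 (ltW e20)) => //.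
- rewrite -/k0 -/l0 -/g; move: q1 q4; clear; lra.
- rewrite -/k0 -/l0 -/g; move: q2 q5 q7; clear; lra.
- rewrite -/k0 -/l0; move: q3 q6; clear; lra.
- rewrite -/k0 -/l0 -/g -/Y; apply: (@le_trans _ _ c); last first.
    by rewrite expr2 ler_peMl.
  apply: (@le_trans _ _ (8 / g ^+ 2 * (Y ^+ 2 * K + (2 * l0 + `|k0|) ^+ 2))); last first.
    by rewrite /c lerDr.
  apply: ler_wpM2l; first by rewrite divr_ge0// sqr_ge0.
  rewrite lerD2l; apply: lerXn2r.
  + by rewrite nnegrE; apply: addr_ge0; [exact: addr_ge0|exact: ltW].
  + by rewrite nnegrE addr_ge0// mulr_ge0.
  + by move: q3 l00; clear; lra.
- exact: ltW.
- by rewrite dl'0.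
- move=> v r hS; apply: isolated; apply: le_trans hS _.
  rewrite ler_wpM2r ?ler0n// -/eta2 ler_pdivrMr ?exprn_gt0//.
  move: eps1; rewrite mulrC ler_pdivrMr ?mul1r// mulr_gt0// exprn_gt0//.
- rewrite -/Y -/l0; apply: (@le_trans _ _ (Y * (s1 * d) * c)).
    rewrite ler_wpM2r// ler_wpM2l// bigsqrt// /D; move: D10 D20 D30; clear; lra.
  by rewrite le_eqVlt; apply/orP; left; apply/eqP; rewrite /s1; field; rewrite !gt_eqF.
- rewrite -/Y -/l0 -/M0; apply: (@le_trans _ _ (Y * (s2 * d) * c * (M0 + 1))).
    apply: ler_pM => //; rewrite ?mulr_ge0 ?sqrtr_ge0//; last by rewrite lerDl.
    rewrite ler_wpM2r// ler_wpM2l// bigsqrt// /D; move: D10 D20 D30; clear; lra.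
  by rewrite le_eqVlt; apply/orP; left; apply/eqP; rewrite /s2; field; rewrite !gt_eqF.
- rewrite -/Y -/l0 -/M0; move: q9 q10; clear; lra.
Qed.

(** * Probability of the bad events *)

Section UnorderedPairs.
Context {R : realType} {n : nat}.

(** Picks one representative of each unordered pair, as the Chernoff bounds require. *)
Definition increasing (z : 'I_n * 'I_n) : bool := (z.1 < z.2)%N.

Lemma increasing_neq z : increasing z -> z.1 != z.2.
Proof. by rewrite /increasing => h; apply: contraTneq h => ->; rewrite ltnn. Qed.

Lemma increasing_inj : {in increasing &, injective (fun z : 'I_n * 'I_n => [set z.1; z.2])}.
Proof.
move=> [i j] [k l]; rewrite !unfold_in /increasing /= => ij kl /setP H.
have hi := H i; have hj := H j; have hk := H k.
rewrite !inE !eqxx ?orbT /= in hi hj hk.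
have [ik|ik] := eqVneq i k.
  move: hj; rewrite -ik [j == i]eq_sym (_ : (i == j) = false); last first.
    by apply/negbTE; exact: (@increasing_neq (i, j)).
  by move=> /esym/eqP ->.
move: hi hk; rewrite (negbTE ik) [k == i]eq_sym (negbTE ik) /= => /esym/eqP il /eqP kj.
by move: ij kl; rewrite il kj; lia.
Qed.

Lemma sum_increasing (F : 'I_n -> 'I_n -> R) : \sum_i \sum_j F i j =
  \sum_(z | increasing z) (F z.1 z.2 + F z.2 z.1) + \sum_i F i i.
Proof.
rewrite pair_big /= (bigID increasing)/= big_split -addrA; congr (_ + _).
rewrite [LHS](bigID (fun z : 'I_n * 'I_n => (z.2 < z.1)%N))/=; congr (_ + _).
  rewrite (reindex_inj (h := fun z : 'I_n * 'I_n => (z.2, z.1))) /=; last first.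
    by move=> [i j] [k l] /= [-> ->].
  by apply: eq_bigl => -[i j]; rewrite /increasing /=; lia.
rewrite (eq_bigl (fun z : 'I_n * 'I_n => (z.1 == z.2) && true)); last first.
  by move=> [i j]; rewrite /increasing /= -(inj_eq val_inj) /=; lia.
rewrite -(pair_big_dep xpredT (fun i j : 'I_n => (i == j) && true) (fun i j => F i j)) /=.
by apply: eq_bigr => i _; rewrite (big_pred1 i)// => j; rewrite andbT eq_sym.
Qed.

Lemma card_increasing_le (P : pred ('I_n * 'I_n)) (S : {set 'I_n}) :
  (forall z, P z -> (z.1 \in S) && (z.2 \in S)) -> #|P|%:R <= #|S|%:R ^+ 2 :> R.
Proof.
move=> PS; rewrite -natrX ler_nat expnS expn1 -cardsX; apply: subset_leq_card.
by apply/fintype.subsetP => z /PS; rewrite inE.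
Qed.

End UnorderedPairs.

Section BadEvents.
Context {R : realType} {n : nat}.
Variables p q t d alpha : R.
Hypotheses (hp : 0 < p < 1) (hq : 0 < q < 1) (ha : 0 < alpha < 1) (t_gt0 : 0 < t).
Hypotheses (alphaE : alpha * n%:R = t * d) (nE : n%:R = expR d) (d_ge1 : 1 <= d).
Implicit Types (s : labels n) (G : observation n).

Let E (F : labels n -> observation n -> R) := model_E p q alpha F.
Let Y := llr_bound p q.

Let d0 : 0 < d. Proof. exact: lt_le_trans d_ge1. Qed.
Let a0 : 0 < alpha. Proof. by case/andP: ha. Qed.

Lemma union_bound (J : finType) (P : pred J) (A : labels n -> observation n -> bool)
    (B : J -> labels n -> observation n -> bool) (c : J -> R) :
  (forall s G, A s G -> exists2 j, P j & B j s G) ->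
  (forall j, P j -> E (fun s G => (B j s G)%:R) <= c j) ->
  E (fun s G => (A s G)%:R) <= \sum_(j | P j) c j.
Proof.
move=> AB Bc; apply: (@le_trans _ _ (E (fun s G => \sum_(j | P j) (B j s G)%:R))).
  apply: (le_model_E hp hq ha) => s G; case: (boolP (A s G)) => [/AB[j Pj Bj]|_] /=.
    by rewrite (bigD1 j)//= Bj lerDl sumr_ge0.
  exact: sumr_ge0.
by rewrite /E model_E_sum; apply: ler_sum.
Qed.

Lemma unbalanced_prob (bal : R) : 0 < bal <= 1 -> 16 * d <= bal ^+ 2 * n%:R ->
  E (fun s G => (bal * n%:R < `|\sum_i sg (s i)|)%R%:R) <= 2 * expR (- (2 * d)).
Proof.
move=> /andP[b0 b1] large.
have one_side (c : R) : `|c| = 1 ->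
    \sum_(s : labels n) 2^-n * (bal * n%:R < \sum_i c * sg (s i))%R%:R <= expR (- (2 * d)).
  (* [bal / 4] minimises [2 * th ^+ 2 - th * bal], with value [- bal ^+ 2 / 8]. *)
  move=> c1; pose th := bal / 4.
  have th01 : 0 <= th <= 2^-1 by rewrite /th; apply/andP; split; lra.
  apply: (@le_trans _ _ (\sum_(s : labels n) expR (- (th * (bal * n%:R))) *
     (2^-n * expR (th * \sum_i c * sg (s i))))).
    apply: ler_sum => s _; rewrite mulrCA ler_wpM2l ?invr_ge0 ?exprn_ge0// -expRD.
    apply: indicator_le_exp => /ltW h; rewrite addrC -mulrBr mulr_ge0 ?subr_ge0//.
    by case/andP: th01.
  rewrite -mulr_sumr; apply: le_trans (ler_wpM2l (expR_ge0 _) (label_exp c1 th01)) _.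
  rewrite -expRD ler_expR /th; move: large; rewrite !expr2; lra.
apply: (@le_trans _ _ (\sum_(s : labels n) 2^-n * (bal * n%:R < \sum_i 1 * sg (s i))%R%:R +
   \sum_(s : labels n) 2^-n * (bal * n%:R < \sum_i (-1) * sg (s i))%R%:R)); last first.
  by rewrite mulr2n mulrDl mul1r lerD// one_side ?normrN ?normr1.
rewrite /E /model_E mulr_sumr -big_split; apply: ler_sum => s _ /=.
rewrite pE_cst; last by move=> e; exact: pair_law_sum1.
rewrite -mulrDr ler_wpM2l ?invr_ge0 ?exprn_ge0// -!mulr_sumr mul1r mulN1r.
set x := \sum_i _; rewrite -natrD ler_nat.
case: (lerP 0 x) => hx; first by rewrite ger0_norm// leq_addr.
by rewrite ltr0_norm// leq_addl.
Qed.

Lemma row_prob s u (S : {set 'I_n}) (theta a : R) : 0 <= theta ->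
  pE (pair_law p q alpha s) (fun G => (a < \sum_(w in S) (rev G u w)%:R)%R%:R) <=
  expR (alpha * expR theta * #|S|%:R - theta * a).
Proof.
move=> th0; have := neighbours_in_indep_set hp hq ha s #|S|%:R a (u := u)
  (f := fun _ => S) th0 (fun _ _ _ => erefl).
by apply: le_trans; apply: le_pE => [e x|G]; [exact: pair_law_ge0|rewrite lexx].
Qed.

(** Chernoff at [theta = 1]: the mean term [t * exp 1 * d] cancels, leaving [exp (- 3 d)] per
    vertex, for [n = exp d] vertices. *)
Lemma high_degree_prob : E (fun s G =>
  [exists u, (t * expR 1 + 3) * d < \sum_w (rev G u w)%:R]%:R) <= expR (- (2 * d)).
Proof.
apply: le_trans (@union_bound _ xpredT _ (fun u s G => (t * expR 1 + 3) * d <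
   \sum_(w in [set: 'I_n]%SET) (rev G u w)%:R) (fun=> expR (- (3 * d))) _ _) _.
- move=> s G /existsP[u hu]; exists u => //; apply: lt_le_trans hu _.
  by rewrite le_eqVlt; apply/orP; left; apply/eqP; apply: eq_bigl => w; rewrite inE.
- move=> u _; apply: model_E_le_cond => s; apply: le_trans (row_prob s u [set: 'I_n]%SET _ ler01) _.
  rewrite cardsT card_ord ler_expR mulrAC alphaE; lra.
rewrite sumr_const card_ord -[_ *+ n]mulr_natl nE -expRD ler_expR; lra.
Qed.

(** At [theta = 8 / eS] the size limit makes the mean term at most [d] per vertex, against a gain of
    [4 * d] per vertex, each pair being counted twice in the double sum. A set of size j costs
    [exp (- 3 d j)], and the union over nonempty sets is the binomial expansion of
    [(1 + exp (- 3 d)) ^ n - 1]. *)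
Lemma dense_set_prob eS : 0 < eS ->
  E (fun s G => [exists S : {set 'I_n}, (#|S|%:R <= expR (- (8 / eS)) / t * n%:R)%R &&
      (eS * d * #|S|%:R < \sum_(i in S) \sum_(j in S) (rev G i j)%:R)%R]%:R) <=
  2 * expR (- (2 * d)).
Proof.
move=> eS0.
apply: le_trans (@union_bound _ (fun S : {set 'I_n} => S != finset.set0) _ (fun S s G =>
   (#|S|%:R <= expR (- (8 / eS)) / t * n%:R)%R &&
   (eS * d * #|S|%:R / 2 <
    \sum_(z | increasing z && ((z.1 \in S) && (z.2 \in S))) (rev G z.1 z.2)%:R)%R)
  (fun S => expR (- (3 * d)) ^+ #|S|) _ _) _.
- move=> s G /existsP[S /andP[S1 S2]]; exists S.
    by apply: contraTneq S2 => ->; rewrite big_set0 cards0 mulr0 ltxx.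
  rewrite S1 /= ltr_pdivrMr//; apply: lt_le_trans S2 _.
  pose F i j : R := if (i \in S) && (j \in S) then (rev G i j)%:R else 0.
  have -> : \sum_(i in S) \sum_(j in S) (rev G i j)%:R = \sum_i \sum_j F i j.
    rewrite big_mkcond; apply: eq_bigr => i _; rewrite /F; case: (i \in S) => /=.
      by rewrite big_mkcond.
    by rewrite big1.
  rewrite sum_increasing [X in _ + X]big1 ?addr0; last first.
    by move=> i _; rewrite /F rev_diag; case: ifP.
  rewrite big_mkcondr /= mulr_suml.
  apply: ler_sum => z _; rewrite /F andbC revC.
  by case: ((z.1 \in S) && (z.2 \in S)); rewrite ?addr0 ?mul0r// mulr2n mulrDr mulr1.
- move=> S _; apply: model_E_le_cond => s.
  case: (lerP #|S|%:R (expR (- (8 / eS)) / t * n%:R)) => [Sn|_]; last first.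
    by rewrite pE_cst ?exprn_ge0 ?expR_ge0// => e; exact: pair_law_sum1.
  have th0 : 0 <= 8 / eS by rewrite divr_ge0// ltW.
  apply: le_trans (revealed_chernoff hp hq ha s _ _ _ th0) _.
  + by move=> z /andP[/increasing_neq].
  + move=> z z' /andP[hz _] /andP[hz' _]; exact: increasing_inj.
  rewrite -expRM_natr ler_expR.
  have c1 := @card_increasing_le R n (fun z => increasing z && ((z.1 \in S) && (z.2 \in S))) S
    (fun z h => proj2 (andP h)).
  have c2 : alpha * expR (8 / eS) * #|S|%:R <= d.
    apply: le_trans (ler_wpM2l _ Sn) _; first by rewrite mulr_ge0 ?expR_ge0// ltW.
    rewrite [leLHS](_ : _ = (alpha * n%:R) / t * (expR (8 / eS) * expR (- (8 / eS)))); last by ring.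
    by rewrite expRxMexpNx_1 mulr1 alphaE mulrAC divff ?mul1r// gt_eqF.
  apply: (@le_trans _ _ (alpha * expR (8 / eS) * #|S|%:R ^+ 2 - 8 / eS * (eS * d * #|S|%:R / 2))).
    by rewrite lerD2r ler_wpM2l// mulr_ge0 ?expR_ge0// ltW.
  rewrite expr2 mulrA; apply: (@le_trans _ _ (d * #|S|%:R - 8 / eS * (eS * d * #|S|%:R / 2))).
    by rewrite lerD2r ler_wpM2r.
  rewrite le_eqVlt; apply/orP; left; apply/eqP; field; rewrite gt_eqF//.
have -> : \sum_(S : {set 'I_n} | S != finset.set0) expR (- (3 * d)) ^+ #|S| =
    (1 + expR (- (3 * d))) ^+ n - 1.
  have : \prod_(i < n) (expR (- (3 * d)) + 1) =
    \sum_(S in {set 'I_n}) \prod_(i < n) (if i \in S then expR (- (3 * d)) else 1).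
    exact: bigA_distr.
  rewrite prodr_const card_ord addrC => ->.
  rewrite [in RHS](bigD1 finset.set0) ?inE//=.
  rewrite [X in _ = X + _ - _]big1; last by move=> i _; rewrite finset.in_set0.
  rewrite addrAC subrr add0r; apply: eq_bigr => S _.
  by rewrite -big_mkcond /= prodr_const.
have x0 : 0 < expR (- (2 * d)) by exact: expR_gt0.
have xle : expR (- (2 * d)) <= 2^-1.
  rewrite expRN lef_pV2 ?posrE ?expR_gt0//; apply: le_trans (expR_ge1Dx _); have := d_ge1; lra.
have pw : (1 + expR (- (3 * d))) ^+ n <= expR (expR (- (2 * d))).
  apply: (@le_trans _ _ (expR (expR (- (3 * d))) ^+ n)).
    by rewrite lerXn2r ?nnegrE ?expR_ge0 ?addr_ge0 ?expR_ge0//; exact: expR_ge1Dx.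
  rewrite -expRM_natr nE -expRD ler_expR ler_expR; lra.
have := @expR_le_quadratic R (expR (- (2 * d))); rewrite ger0_norm ?(ltW x0)// => /(_ xle) h.
have : expR (- (2 * d)) ^+ 2 <= expR (- (2 * d)) * 2^-1 by rewrite expr2 ler_wpM2l// ltW.
lra.
Qed.

End BadEvents.

Lemma ffact_le_exp n k : (n ^_ k <= n ^ k)%N.
Proof.
elim: k n => [|k IH] n; first by rewrite ffactn0 expn0.
rewrite ffactnS expnS leq_mul2l; apply/orP; right.
apply: leq_trans (IH _) _; case: k {IH} => [|k]; first by rewrite !expn0.
by rewrite leq_exp2r// leq_pred.
Qed.

(** * Cut norm and misplaced coordinates *)

Section CutAndIsolation.
Context {R : realType} {n : nat}.
Variables p q t d alpha : R.
Hypotheses (hp : 0 < p < 1) (hq : 0 < q < 1) (ha : 0 < alpha < 1) (t_gt0 : 0 < t).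
Hypotheses (alphaE : alpha * n%:R = t * d) (nE : n%:R = expR d) (d_ge1 : 1 <= d).
Implicit Types (s : labels n) (G : observation n).

Let E (F : labels n -> observation n -> R) := model_E p q alpha F.
Let Y := llr_bound p q.

Let d0 : 0 < d. Proof. exact: lt_le_trans d_ge1. Qed.
Let a0 : 0 < alpha. Proof. by case/andP: ha. Qed.
Let Y0 : 0 <= Y. Proof. by rewrite addr_ge0. Qed.

(** Union bound over 4^n pairs of sign vectors, against a Chernoff exponent [4 * n]. The double sum
    is folded onto unordered pairs, and half of the threshold is kept for the diagonal. *)
Lemma cut_norm_prob (kappa theta : R) : 0 <= theta -> theta * (2 * Y) <= 2^-1 ->
  32 * t * Y ^+ 2 * theta <= kappa -> 16 <= theta * kappa * d -> 2 * t * Y <= kappa * n%:R ->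
  E (fun s G => [exists a : labels n, exists b : labels n,
    kappa * d * n%:R < \sum_i \sum_j
     (llr_mx p q G i j - mean_mx p q alpha s i j) * sg (a i) * sg (b j)]%:R) <=
  expR (- (2 * d)).
Proof.
move=> th0 thY thk large1 large2.
pose c (z : labels n * labels n) (y : 'I_n * 'I_n) : R :=
  sg (z.1 y.1) * sg (z.2 y.2) + sg (z.1 y.2) * sg (z.2 y.1).
apply: le_trans (union_bound hp hq ha (P := xpredT) (B := fun z s G =>
   kappa * d * n%:R / 2 < \sum_(y | increasing y) c z y *
     (llr_mx p q G y.1 y.2 - mean_mx p q alpha s y.1 y.2))
  (c := fun=> expR (- (4 * n%:R))) _ _) _.
- move=> s G /existsP[a /existsP[b h]]; exists (a, b) => //.
  move: h; rewrite sum_increasing => h.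
  (* The diagonal of [llr_mx] is 0, but that of [mean_mx] is not. *)
  have diag : \sum_i (llr_mx p q G i i - mean_mx p q alpha s i i) * sg (a i) * sg (b i) <=
      kappa * d * n%:R / 2.
    apply: (@le_trans _ _ (\sum_(i < n) alpha * Y)).
      apply: ler_sum => i _; apply: le_trans (ler_norm _) _.
      rewrite !normrM !sg_norm1 !mulr1 /llr_mx pair_status_diag /= sub0r normrN.
      exact: normr_mean_mx.
    rewrite sumr_const card_ord -[_ *+ n]mulr_natr mulrAC alphaE.
    by have := ler_wpM2r (ltW d0) large2; lra.
  have -> : \sum_(y | increasing y)
      c (a, b) y * (llr_mx p q G y.1 y.2 - mean_mx p q alpha s y.1 y.2) =
    \sum_(z | increasing z)
     ((llr_mx p q G z.1 z.2 - mean_mx p q alpha s z.1 z.2) * sg (a z.1) * sg (b z.2) +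
      (llr_mx p q G z.2 z.1 - mean_mx p q alpha s z.2 z.1) * sg (a z.2) * sg (b z.1)).
    apply: eq_bigr => z _; rewrite /c /= [llr_mx _ _ _ z.2 z.1]llr_mxC.
    by rewrite /mean_mx [s z.2 == s z.1]eq_sym; ring.
  lra.
- move=> z _; apply: model_E_le_cond => s.
  have c2 y : `|c z y| <= 2.
    apply: le_trans (ler_normD _ _) _; rewrite !normrM !sg_norm1 !mulr1.
    by have := lexx (2 : R); lra.
  apply: le_trans (cut_chernoff hp hq ha s _ _ _ th0 c2 thY) _.
  + exact: increasing_neq.
  + exact: increasing_inj.
  rewrite ler_expR -/Y.
  have cN : #|@increasing n|%:R <= n%:R ^+ 2 :> R.
    have := @card_increasing_le R n (@increasing n) [set: 'I_n]%SET.
    by rewrite cardsT card_ord; apply => y _; rewrite !inE.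
  have n0 : 0 <= n%:R :> R by exact: ler0n.
  have e1 : alpha * (8 * theta ^+ 2 * Y ^+ 2) * #|@increasing n|%:R <=
      theta * (kappa * d * n%:R) / 4.
    apply: (@le_trans _ _ (alpha * (8 * theta ^+ 2 * Y ^+ 2) * n%:R ^+ 2)).
      by rewrite ler_wpM2l// !mulr_ge0 ?sqr_ge0// ltW.
    rewrite [leLHS](_ : _ = (alpha * n%:R) * (8 * theta ^+ 2 * Y ^+ 2 * n%:R)); last by ring.
    rewrite alphaE [leLHS](_ : _ = theta * d * n%:R / 4 * (32 * t * Y ^+ 2 * theta)); last by field.
    rewrite [leRHS](_ : _ = theta * d * n%:R / 4 * kappa); last by field.
    by rewrite ler_wpM2l// divr_ge0// !mulr_ge0// ltW.
  have e2 := ler_wpM2r n0 large1.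
  lra.
rewrite sumr_const card_prod card_ffun card_bool card_ord -[_ *+ _]mulr_natl natrM natrX.
have two_le : 2 ^+ n <= expR n%:R :> R.
  rewrite -[X in expR X]mul1r expRM_natr lerXn2r ?nnegrE ?expR_ge0//.
  by apply: le_trans (expR_ge1Dx _); lra.
have p2 : 0 <= 2 ^+ n :> R by exact: exprn_ge0.
apply: (@le_trans _ _ (expR n%:R * expR n%:R * expR (- (4 * n%:R)))).
  by rewrite ler_wpM2r ?expR_ge0// ler_pM.
rewrite -!expRD ler_expR.
have : d <= n%:R by rewrite nE; apply: le_trans (expR_ge1Dx _); lra.
lra.
Qed.

(** Independence from the row of [v] lets [F v r s G] be treated as a fixed set: the Chernoff
    exponent is [d - 5 * d], against a union over [2 * n] choices. *)
Lemma isolated_prob (dl : R) (F : 'I_n -> bool -> labels n -> observation n -> {set 'I_n}) :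
  0 < dl ->
  (forall v r s (G G' : observation n),
    {in predC [pred e : vpair n | v \in val e], G =1 G'} -> F v r s G = F v r s G') ->
  E (fun s G => [exists v, exists r, (#|F v r s G|%:R <= expR (- (5 / dl)) / t * n%:R)%R &&
     (dl * d < \sum_(w in F v r s G) (rev G v w)%:R)%R]%:R) <= 2 * expR (- (2 * d)).
Proof.
move=> dl0 Fv; have th0 : 0 <= 5 / dl by rewrite divr_ge0// ltW.
apply: le_trans (union_bound hp hq ha (P := xpredT) (J := ('I_n * bool)%type) (B := fun z s G =>
   (#|F z.1 z.2 s G|%:R <= expR (- (5 / dl)) / t * n%:R)%R &&
     (dl * d < \sum_(w in F z.1 z.2 s G) (rev G z.1 w)%:R)%R)
  (c := fun=> expR (- (4 * d))) _ _) _.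
- by move=> s G /existsP[v /existsP[r h]]; exists (v, r).
- move=> [v r] _; apply: model_E_le_cond => s /=.
  apply: le_trans (neighbours_in_indep_set hp hq ha s _ _ th0 (Fv v r s)) _.
  rewrite ler_expR.
  rewrite [X in X - _](_ : _ =
    (alpha * n%:R) / t * (expR (5 / dl) * expR (- (5 / dl)))); last by ring.
  rewrite expRxMexpNx_1 mulr1 alphaE [X in X - _]mulrAC divff ?gt_eqF// mul1r.
  rewrite mulrA divfK ?gt_eqF//; lra.
rewrite sumr_const card_prod card_bool card_ord -[_ *+ _]mulr_natl natrM nE mulrAC -expRD mulrC.
by rewrite ler_wpM2l// ler_expR; have := d_ge1; lra.
Qed.

Let cB := t * (1 - bhattacharyya p q).

(** [alpha * n = t * d] turns the product over a row into n to the power [- cB]; each of the [j]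
    omitted vertices costs at most a factor e. *)
Lemma rate_pow j : (j <= n)%N -> p != q ->
  (1 - alpha * (1 - bhattacharyya p q)) ^+ (n - j) <= expR (- (cB * d) + j%:R).
Proof.
move=> jn pq; have b1 := bhattacharyya_lt1 hp hq pq; have b0 := bhattacharyya_gt0 q hp.
set x := alpha * (1 - _).
have x0 : 0 <= x by rewrite mulr_ge0 ?subr_ge0 ?ltW.
have x1 : x <= 1 by rewrite mulr_ile1 ?subr_ge0 ?ltW//; [case/andP: ha|rewrite gtrBl].
have h : 1 - x <= expR (- x) by exact: expR_ge1Dx.
apply: (@le_trans _ _ (expR (- x) ^+ (n - j))).
  by rewrite lerXn2r ?nnegrE ?expR_ge0// subr_ge0.
rewrite -expRM_natr ler_expR natrB// mulNr mulrBr opprB.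
have -> : x * n%:R = cB * d by rewrite /x mulrAC alphaE /cB; ring.
by rewrite addrC lerD2l ler_piMl.
Qed.

End CutAndIsolation.

Lemma subset_of_card (T : finType) (A : {set T}) k : (k <= #|A|)%N ->
  exists2 V : {set T}, V \subset A & #|V| = k.
Proof.
move=> kA; exists [set x in take k (enum A)]%SET.
  by apply/fintype.subsetP => x; rewrite inE => /mem_take; rewrite mem_enum.
rewrite cardsE (card_uniqP _) ?take_uniq ?enum_uniq// size_take -cardE.
by move: kA; rewrite leq_eqVlt => /orP[/eqP->|->//]; rewrite ltnn.
Qed.

(** * Low margins around a vertex *)

Section Clusters.
Context {R : realType} {n : nat}.
Variables p q t d alpha : R.
Hypotheses (hp : 0 < p < 1) (hq : 0 < q < 1) (ha : 0 < alpha < 1) (t_gt0 : 0 < t).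
Hypothesis hpq : p != q.
Hypotheses (alphaE : alpha * n%:R = t * d) (nE : n%:R = expR d) (d_ge1 : 1 <= d).
Implicit Types (s : labels n) (G : observation n).

Let E (F : labels n -> observation n -> R) := model_E p q alpha F.
Let Y := llr_bound p q.
Let cB := t * (1 - bhattacharyya p q).

Variables (eB : R) (k : nat).
Hypotheses (eB_le : eB <= cB / 2) (k_gt0 : (0 < k)%N) (kn : (k.+1 <= n)%N).
Hypothesis d_large : t * d * expR (k.+1%:R * (1 + Y / 2)) <= expR (cB * d / 4).

Let d0 : 0 < d. Proof. exact: lt_le_trans d_ge1. Qed.
Let a0 : 0 < alpha. Proof. by case/andP: ha. Qed.
Let Y0 : 0 <= Y. Proof. by rewrite addr_ge0. Qed.

(** Of the exponent [cB * d], a quarter pays for the margin threshold since [eB <= cB / 2], a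
    quarter for the prefactors by [d_large], and half is left. *)
Lemma low_margin_rate j : (j <= k.+1)%N ->
  t * d * ((1 - alpha * (1 - bhattacharyya p q)) ^+ (n - j) *
    expR ((eB * d + Y * j%:R) / 2)) <= expR (- (cB * d / 2)).
Proof.
move=> jk; have h := rate_pow hp hq ha alphaE (leq_trans jk kn) hpq.
apply: (@le_trans _ _ (t * d * (expR (- (cB * d) + j%:R) * expR ((eB * d + Y * j%:R) / 2)))).
  rewrite ler_wpM2l//; first by rewrite mulr_ge0// ltW.
  by rewrite ler_wpM2r// expR_ge0.
rewrite -expRD.
apply: (@le_trans _ _ (t * d * (expR (k.+1%:R * (1 + Y / 2)) * expR (- (3 / 4 * (cB * d)))))).
  rewrite ler_wpM2l//; first by rewrite mulr_ge0// ltW.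
  rewrite -expRD ler_expR.
  have e1 : eB * d <= cB / 2 * d by rewrite ler_wpM2r// ltW.
  have e2 : j%:R * (1 + Y / 2) <= k.+1%:R * (1 + Y / 2).
    by rewrite ler_wpM2r ?ler_nat// addr_ge0// divr_ge0.
  lra.
rewrite mulrA; apply: le_trans (ler_wpM2r (expR_ge0 _) d_large) _.
by rewrite -expRD ler_expR; lra.
Qed.

(** Choosing [u] and [k] neighbours costs at most n^(k+1), while each neighbour brings [alpha * x],
    and [n * alpha * x] is at most [exp (- cB * d / 2)]. The condition on [k] leaves at most
    [exp (d - 3 * d)]. *)
Lemma cluster_prob : 6 <= k%:R * cB ->
  E (fun s G => [exists u, k < #|[set v | rev G u v && (margin p q G s v <= eB * d)%R]|]%N%:R) <=
  expR (- (2 * d)).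
Proof.
move=> kc.
pose x := (1 - alpha * (1 - bhattacharyya p q)) ^+ (n - k.+1) *
    expR ((eB * d + Y * k.+1%:R) / 2).
have b1 := bhattacharyya_lt1 hp hq hpq; have b0 := bhattacharyya_gt0 q hp.
have x0 : 0 <= x.
  rewrite mulr_ge0 ?expR_ge0// exprn_ge0// subr_ge0 mulr_ile1 ?subr_ge0 ?ltW//.
    by case/andP: ha.
  by rewrite gtrBl.
apply: le_trans (union_bound hp hq ha (J := ('I_n * {set 'I_n})%type)
   (P := fun z => (#|z.2| == k) && (z.1 \notin z.2))
   (B := fun z s G => [forall v in z.2, rev G z.1 v && (margin p q G s v <= eB * d)%R])
   (c := fun=> (alpha * x) ^+ k) _ _) _.
- move=> s G /existsP[u hu].
  have [V VA Vk] := subset_of_card (ltnW hu).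
  exists (u, V) => /=.
    rewrite Vk eqxx /=; apply/negP => /(fintype.subsetP VA); rewrite inE rev_diag.
    by [].
  by apply/forall_inP => v /(fintype.subsetP VA); rewrite inE.
- move=> [u V] /= /andP[/eqP Vk uV]; apply: model_E_le_cond => s.
  by have := low_margins_bound hp hq ha s (eB * d) uV; rewrite Vk.
rewrite sumr_const -[_ *+ _]mulr_natl.
have cN : #|[pred z : 'I_n * {set 'I_n} | (#|z.2| == k) && (z.1 \notin z.2)]|%:R <=
    n%:R * n%:R ^+ k :> R.
  rewrite -natrX -natrM ler_nat.
  apply: (@leq_trans #|finset.setX [set: 'I_n]%SET [set V : {set 'I_n} | #|V| == k]|).
    apply: subset_leq_card; apply/fintype.subsetP => -[u V].
    by rewrite !inE /= => /andP[].
  rewrite cardsX cardsT card_draws card_ord leq_mul2l; apply/orP; right.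
  apply: leq_trans (ffact_le_exp n k); rewrite -bin_ffact.
  by rewrite leq_pmulr// fact_gt0.
apply: le_trans (ler_wpM2r _ cN) _; first by rewrite exprn_ge0// mulr_ge0// ltW.
rewrite -mulrA -exprMn [n%:R * (alpha * x)](_ : _ = t * d * x); last by rewrite -alphaE; ring.
have h := low_margin_rate (leqnn _); rewrite -/x in h.
apply: (@le_trans _ _ (n%:R * expR (- (cB * d / 2)) ^+ k)).
  rewrite ler_wpM2l ?ler0n// lerXn2r ?nnegrE ?expR_ge0// mulr_ge0// mulr_ge0// ltW//.
rewrite -expRM_natr nE -expRD ler_expR.
by have := ler_wpM2r (ltW d0) kc; lra.
Qed.

(** Union over the revealed neighbours of [u]: up to the pair joining them, a low margin at [v] is
    independent of the row of [u], and the degree bound leaves at most [K * d] terms. *)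
Lemma suspicious_prob (K C : R) (u : 'I_n) : 0 <= K ->
  E (fun s G => [&& `|margin p q G s u| <= C, \sum_v (rev G u v)%:R <= K * d &
     [exists v, rev G u v && (margin p q G s v <= eB * d)]]%R%:R) <=
  K / t * expR (- (cB * d / 2)) * E (fun s G => (`|margin p q G s u| <= C)%R%:R).
Proof.
move=> K0.
pose f s G := (`|margin p q G s u| <= C) && (\sum_v (rev G u v)%:R <= K * d).
have fu s (G G' : observation n) : {in [pred e : vpair n | u \in val e], G =1 G'} ->
    f s G = f s G'.
  move=> GG; have st w : pair_status G u w = pair_status G' u w by exact: row_measurable.
  have mE : margin p q G s u = margin p q G' s u.
    by congr (_ * _); apply: eq_bigr => w _; rewrite /llr_mx st.
  have rE : \sum_v (rev G u v)%:R = \sum_v (rev G' u v)%:R :> R.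
    by apply: eq_bigr => w _; rewrite /rev st.
  by rewrite /f mE rE.
pose x := (1 - alpha * (1 - bhattacharyya p q)) ^+ (n - 2) * expR ((eB * d + Y * 2) / 2).
have b1 := bhattacharyya_lt1 hp hq hpq; have b0 := bhattacharyya_gt0 q hp.
have x0 : 0 <= x.
  rewrite mulr_ge0 ?expR_ge0// exprn_ge0// subr_ge0 mulr_ile1 ?subr_ge0 ?ltW//.
    by case/andP: ha.
  by rewrite gtrBl.
have fge s (G : observation n) : 0 <= (f s G)%:R :> R by exact: ler0n.
apply: (@le_trans _ _ (E (fun s G => \sum_(v | v != u)
   ((f s G && rev G u v) && (margin p q G s v <= eB * d))%:R))).
  apply: (le_model_E hp hq ha) => s G.
  rewrite andbA -/(f s G); case: (boolP (f s G)) => [fG|_] /=; last exact: sumr_ge0.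
  case: existsP => [[v /andP[rv lv]]|_]; last exact: sumr_ge0.
  have vu : v != u by apply: contraTneq rv => ->; rewrite rev_diag.
  by rewrite (bigD1 v)//= rv lv lerDl sumr_ge0.
rewrite /E model_E_sum.
apply: (@le_trans _ _ (\sum_(v | v != u) x * E (fun s G => (f s G && rev G u v)%:R))).
  apply: ler_sum => v vu; rewrite /E /model_E mulrCA ler_wpM2l ?invr_ge0 ?exprn_ge0//.
  rewrite mulr_sumr; apply: ler_sum => s _; rewrite /x.
  have fm (G G' : observation n) : {in [pred e : vpair n | u \in val e], G =1 G'} ->
      f s G && rev G u v = f s G' && rev G' u v.
    by move=> GG; rewrite (fu s G G' GG) /rev (row_measurable v GG).
  exact: (low_margin_bound_indep hp hq ha s (eB * d) vu fm).
rewrite -mulr_sumr -model_E_sum.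
apply: (@le_trans _ _ (x * E (fun s G => K * d * (`|margin p q G s u| <= C)%R%:R))).
  rewrite ler_wpM2l//; apply: (le_model_E hp hq ha) => s G.
  apply: (@le_trans _ _ (\sum_v (f s G)%:R * (rev G u v)%:R)).
    rewrite [leLHS]big_mkcond; apply: ler_sum => v _.
    by rewrite -natrM mulnb; case: ifP.
  rewrite -mulr_sumr /f; case: (_ <= C) => /=; last by rewrite mul0r mulr0.
  rewrite mulr1; case: (boolP (\sum_v (rev G u v)%:R <= K * d)) => [h|_]; first by rewrite mul1r.
  by rewrite mul0r mulr_ge0// ltW.
rewrite /E model_EZ mulrA ler_wpM2r//.
  by apply: (model_E_ge0 hp hq ha) => s G; exact: ler0n.
have h := @low_margin_rate 2 k_gt0; rewrite -/x in h.
rewrite [leLHS](_ : _ = K / t * (t * d * x)); last by field; rewrite gt_eqF.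
by rewrite ler_wpM2l// divr_ge0// ltW.
Qed.

End Clusters.

(** * Asymptotics *)

Section Assembly.
Context {R : realType}.

Lemma expR_ge_half_sqr (x : R) : 0 <= x -> x ^+ 2 / 2 <= expR x.
Proof.
move=> x0; have := @expR_ge1Dxn R x 1 x0; rewrite (_ : 2`!%:R = 2 :> R)//.
lra.
Qed.

Lemma natr_expR_ln (n : nat) : 0 < ln n%:R :> R -> n%:R = expR (ln n%:R) :> R.
Proof.
case: n => [|n] d0; last by rewrite lnK// posrE ltr0n.
by rewrite ln0 ?ltxx in d0.
Qed.

Lemma bad_union (a b c d e f : bool) : (~~ [&& a, b, c, d, e & f])%:R <=
  (~~ a)%:R + (~~ b)%:R + (~~ c)%:R + (~~ d)%:R + (~~ e)%:R + (~~ f)%:R :> R.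
Proof. by rewrite -!natrD ler_nat; case: a; case: b; case: c; case: d; case: e; case: f. Qed.

Lemma Err_two_step (p q alpha : R) n (spec : observation n -> labels n) :
  Err p q alpha (fun w : sample n => let G := observe w in two_step p p q G (spec G)) =
  model_E p q alpha (fun (s : labels n) (G : observation n) =>
    Num.min (misclass R true (two_step p p q G (spec G)) s)
            (misclass R false (two_step p p q G (spec G)) s)).
Proof. by rewrite -csbm_E_observe. Qed.

Lemma Err_genie (p q alpha : R) n : 0 < p < 1 -> 0 < q < 1 -> 0 < alpha < 1 ->
  Err p q alpha (@genie R p q alpha n) =
  model_E p q alpha (fun (s : labels n) (G : observation n) =>
    Num.min (misclass R true [ffun u => 0 <= evidence p q G s u] s)
            (misclass R false [ffun u => 0 <= evidence p q G s u] s)).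
Proof.
move=> hp hq ha; rewrite -csbm_E_observe; apply: eq_bigr => w _.
suff -> : genie p q alpha w = [ffun u => 0 <= evidence p q (observe w) (truth w) u] by [].
by apply/ffunP => u; rewrite genieE// ffunE.
Qed.

End Assembly.

Lemma two_step_genie_rate (R : realType) (p q t : R)
    (u1 : forall n : nat, observation n -> 'rV[R]_n) :
  0 < p < 1 -> 0 < q < 1 -> p != q -> 0 < t ->
  (forall (n : nat) (G : observation n), (0 < n)%N ->
       top_unit_eigenvector (spectral_matrix p q G) (u1 n G)) ->
  exists c0 A0 B0 D0 : R, [/\ 0 < c0, 0 <= A0, 0 < B0 & forall n : nat, D0 <= ln n%:R ->
    `|Err p q (reveal_prob t n) (fun w : sample n =>
        let G := observe w in two_step p p q G (sign_vector (u1 n G))) -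
      Err p q (reveal_prob t n) (@genie R p q (reveal_prob t n) n)| <=
    A0 * expR (- (c0 * ln n%:R)) * Err p q (reveal_prob t n) (@genie R p q (reveal_prob t n) n) +
    B0 * expR (- (2 * ln n%:R)) /\
    0 <= Err p q (reveal_prob t n) (@genie R p q (reveal_prob t n) n)].
Proof.
move=> hp hq hpq t0 u1P.
have bc1 := bhattacharyya_lt1 hp hq hpq; have bc0 := bhattacharyya_gt0 q hp.
pose Y := llr_bound p q; have Y0 : 0 < Y := llr_bound_gt0 hp hq hpq.
pose cB := t * (1 - bhattacharyya p q); have cB0 : 0 < cB by rewrite mulr_gt0// subr_gt0.
pose l0 := t * kl_sum p q; have l00 : 0 < l0 := kl_sum_gt0 hp hq hpq t0.
(* [cB / 2] keeps low margins improbable; [l0 / 2] stays below the typical margin [l0 * d], so that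
   low vertices are few. *)
pose eB := Num.min (cB / 2) (l0 / 2).
have eB0 : 0 < eB by rewrite lt_min !divr_gt0.
have eBc : eB <= cB / 2 by rewrite ge_min lexx.
have eBl : eB <= l0 / 2 by rewrite ge_min lexx orbT.
pose K := t * expR 1 + 3.
have K0 : 0 < K by rewrite addr_gt0// mulr_gt0// expR_gt0.
have [bal [kappa [eS [dl [dl' [D [[bal01 bal2] [kap0 kap1] eS0 [dl0 dl'0] spec]]]]]]] :=
  spectral_constants hp hq hpq t0 eB0 K0.
have bal0 : 0 < bal by case/andP: bal01.
(* A constant with [k * cB >= 6], as [cluster_prob] needs for the bound n^-2. *)
pose k := (Num.bound (6 / cB)).+1.
have kc : 6 <= k%:R * cB.
  rewrite -ler_pdivrMr//; have := archi_boundP (_ : 0 <= 6 / cB).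
  move=> /(_ (divr_ge0 (ler0n _ _) (ltW cB0)))/ltW/le_trans; apply.
  by rewrite ler_nat leqnSn.
have thA : 0 <= 4 * Y by rewrite mulr_ge0// ltW.
have thB : 0 <= 32 * t * Y ^+ 2 / kappa by rewrite divr_ge0 ?(ltW kap0)// !mulr_ge0 ?sqr_ge0// ltW.
have [th [/andP[th0 _] th1 th2 _ _]] := small_scale thA thB (lexx 0) (lexx 0).
pose C := 2 * Y * k%:R; have C0 : 0 <= C by rewrite !mulr_ge0// ltW.
pose X := expR (k.+1%:R * (1 + Y / 2)); have X0 : 0 < X by exact: expR_gt0.
pose A0 := K / t * (2 * (1 + expR C)).
have A00 : 0 <= A0.
  by rewrite mulr_ge0 ?divr_ge0 ?(ltW K0) ?(ltW t0)// mulr_ge0// addr_ge0// expR_ge0.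
(* [D0] adds up the lower bounds on [d = ln n] required below, each summand being nonnegative. *)
pose D0 := 3 + 2 * `|D| + 32 / bal ^+ 2 + 16 / (th * kappa) + 2 * t * Y / kappa + k.+1%:R +
  32 * t * X / cB ^+ 2 + 2 * t + C / eB.
have p1 : 0 <= 32 / bal ^+ 2 by rewrite divr_ge0 ?sqr_ge0.
have p2 : 0 <= 16 / (th * kappa) by rewrite divr_ge0// mulr_ge0// ltW.
have p3 : 0 <= 2 * t * Y / kappa by rewrite divr_ge0 ?(ltW kap0)// !mulr_ge0// ltW.
have p4 : 0 <= k.+1%:R :> R by exact: ler0n.
have p5 : 0 <= 32 * t * X / cB ^+ 2 by rewrite divr_ge0 ?sqr_ge0// !mulr_ge0// ltW.
have p6 : 0 <= C / eB by rewrite divr_ge0// ltW.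
have p7 : 0 <= `|D| by [].
exists (cB / 2), A0, ((3 + A0) * 9), D0; split=> //.
- by rewrite divr_gt0.
- by rewrite mulr_gt0// ltr_wpDr.
move=> n; set d := ln n%:R => dD.
have d3 : 3 <= d by move: dD p1 p2 p3 p4 p5 p6 p7 t0; rewrite /D0; clear; lra.
have d0 : 0 < d by move: d3; clear; lra.
have d1 : 1 <= d by move: d3; clear; lra.
have nE : n%:R = expR d by exact: natr_expR_ln.
have nd : 1 + d <= n%:R by rewrite nE; exact: expR_ge1Dx.
have nd2 : d ^+ 2 / 2 <= n%:R by rewrite nE; exact/expR_ge_half_sqr/ltW.
have n0R : 0 < n%:R :> R by rewrite nE expR_gt0.
have n0 : (0 < n)%N by rewrite -(ltr0n R).
have dsq (a : R) : 2 * a <= d -> a * d <= n%:R.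
  move=> ad; apply: le_trans nd2; rewrite expr2 mulrAC ler_wpM2r ?(ltW d0)//.
  by move: ad; clear; lra.
pose alpha := reveal_prob t n.
have alphaE : alpha * n%:R = t * d by rewrite /alpha /reveal_prob divfK// gt_eqF.
have ha : 0 < alpha < 1.
  rewrite -(ltr_pM2r n0R) -[X in _ && X](ltr_pM2r n0R) mul0r mul1r alphaE mulr_gt0//=.
  have h : 2 * (t + 2^-1) <= d.
    by move: dD p1 p2 p3 p4 p5 p6 p7 t0; rewrite /D0; clear; lra.
  by have := dsq _ h; move: d0; clear; lra.
have n4 : (4 <= n)%N.
  by rewrite -(ler_nat R); move: nd d3; clear; lra.
have kn : (k.+1 <= n)%N.
  rewrite -(ler_nat R).
  by move: nd dD p1 p2 p3 p4 p5 p6 p7 t0; rewrite /D0; clear; lra.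
have large_bal : 16 * d <= bal ^+ 2 * n%:R.
  have h : 2 * (16 / bal ^+ 2) <= d.
    by move: dD p1 p2 p3 p4 p5 p6 p7 t0; rewrite /D0; clear; lra.
  by move: (dsq _ h); rewrite mulrAC ler_pdivrMr ?exprn_gt0// [n%:R * _]mulrC.
have large_cut : 16 <= th * kappa * d.
  rewrite mulrC -ler_pdivrMr; last by rewrite mulr_gt0.
  by move: dD p1 p2 p3 p4 p5 p6 p7 t0; rewrite /D0; clear; lra.
have large_cut2 : 2 * t * Y <= kappa * n%:R.
  rewrite mulrC [kappa * _]mulrC -ler_pdivrMr// [Y * _]mulrC.
  by move: nd dD p1 p2 p3 p4 p5 p6 p7 t0; rewrite /D0; clear; lra.
have large_d : t * d * X <= expR (cB * d / 4).
  have cd0 : 0 <= cB * d / 4 by rewrite divr_ge0// mulr_ge0// ltW.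
  apply: le_trans (expR_ge_half_sqr cd0).
  have : 32 * t * X / cB ^+ 2 <= d.
    by move: dD p1 p2 p3 p4 p5 p6 p7 t0; rewrite /D0; clear; lra.
  rewrite ler_pdivrMr ?exprn_gt0// => /(ler_wpM2r (ltW d0)) h.
  rewrite [leRHS](_ : _ = d * cB ^+ 2 * d / 32); last by field.
  by move: h; clear; lra.
have large_C : C <= eB * d.
  rewrite mulrC -ler_pdivrMr//.
  by move: dD p1 p2 p3 p4 p5 p6 p7 t0; rewrite /D0; clear; lra.
have large_D : D <= d.
  apply: le_trans (ler_norm _) _.
  by move: dD p1 p2 p3 p4 p5 p6 p7 t0; rewrite /D0; clear; lra.
have large_sqrt : D <= Num.sqrt n%:R.
  have -> : Num.sqrt n%:R = expR (d / 2) :> R.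
    rewrite nE (_ : expR d = expR (d / 2) ^+ 2) ?sqrtr_sqr ?gtr0_norm ?expR_gt0//.
    by rewrite -expRM_natl; congr expR; field.
  apply: le_trans (expR_ge1Dx _); apply: le_trans (ler_norm _) _.
  by move: dD p1 p2 p3 p4 p5 p6 p7 t0; rewrite /D0; clear; lra.
pose F v (r : bool) (s : labels n) (G : observation n) := [set w | dl' < `|Num.sqrt n%:R *
   (sg r * u1 n (censor v G) 0 w) - sg (s w)|].
pose good (s : labels n) (G : observation n) : bool :=
  [&& `|\sum_i sg (s i)| <= bal * n%:R :> R,
   ~~ [exists u, K * d < \sum_w (rev G u w)%:R],
   ~~ [exists S : {set 'I_n}, (#|S|%:R <= expR (- (8 / eS)) / t * n%:R)%R &&
      (eS * d * #|S|%:R < \sum_(i in S) \sum_(j in S) (rev G i j)%:R)%R],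
   ~~ [exists a : labels n, exists b : labels n, kappa * d * n%:R < \sum_i \sum_j
     (llr_mx p q G i j - mean_mx p q alpha s i j) * sg (a i) * sg (b j)],
   ~~ [exists v, exists r, (#|F v r s G|%:R <= expR (- (5 / dl)) / t * n%:R)%R &&
     (dl * d < \sum_(w in F v r s G) (rev G v w)%:R)%R] &
   ~~ [exists u, k < #|[set v | rev G u v && (margin p q G s v <= eB * d)%R]|]%N].
(* The six bad events contribute 2, 1, 2, 1, 2 and 1 times [exp (- 2 d)]. *)
have good_prob : model_E p q alpha (fun s G => (~~ good s G)%:R) <= 9 * expR (- (2 * d)).
  apply: le_trans (le_model_E hp hq ha (fun s G => bad_union _ _ _ _ _ _)) _.
  rewrite !model_ED.
  have sub (A B : labels n -> observation n -> bool) (x : R) : (forall s G, A s G -> B s G) ->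
      model_E p q alpha (fun s G => (B s G)%:R) <= x ->
      model_E p q alpha (fun s G => (A s G)%:R) <= x.
    move=> AB; apply: le_trans; apply: (le_model_E hp hq ha) => s G.
    by rewrite ler_nat; move: (AB s G); case: (A s G) => // ->.
  have b1 := unbalanced_prob p q alpha bal01 large_bal.
  have b2 := high_degree_prob hp hq ha alphaE nE.
  have b3 := dense_set_prob hp hq ha t0 alphaE nE d1 eS0.
  have th1' : th * (2 * Y) <= 2^-1 by move: th1; clear; lra.
  have th2' : 32 * t * Y ^+ 2 * th <= kappa.
    by move: th2; rewrite mulrAC ler_pdivrMr// mul1r.
  have b4 := cut_norm_prob hp hq ha alphaE nE d1 (ltW th0) th1' th2' large_cut large_cut2.
  have Fv v r (s : labels n) (G G' : observation n) :
      {in predC [pred e : vpair n | v \in val e], G =1 G'} -> F v r s G = F v r s G'.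
    by move=> GG; rewrite /F (censor_measurable GG).
  have b5 := isolated_prob hp hq ha t0 alphaE nE d1 dl0 Fv.
  have b6 := cluster_prob hp hq ha t0 hpq alphaE nE d1 eBc kn large_d kc.
  rewrite [leRHS](_ : _ = 2 * expR (- (2 * d)) + expR (- (2 * d)) + 2 * expR (- (2 * d)) +
     expR (- (2 * d)) + 2 * expR (- (2 * d)) + expR (- (2 * d))); last by ring.
  apply: lerD; [apply: lerD; [apply: lerD; [apply: lerD; [apply: lerD|]|]|]|].
  - by apply: sub b1 => s G; rewrite ltNge.
  - by apply: sub b2 => s G; rewrite negbK.
  - by apply: sub b3 => s G; rewrite negbK.
  - by apply: sub b4 => s G; rewrite negbK.
  - by apply: sub b5 => s G; rewrite negbK.
  - by apply: sub b6 => s G; rewrite negbK.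
have good_spec s G : good s G -> exists r : bool, forall v,
    sign_vector (u1 n G) v != mulsign r (s v) -> margin p q G s v <= eB * d.
  case/and5P => g1 g2 g3 g4 /andP[g5 _].
  apply: (spec n d alpha s G (u1 n)) => //.
  - by move=> H; exact: u1P.
  - move=> i; rewrite leNgt; apply: contra g2 => h.
    by apply/existsP; exists i.
  - move=> S hS; rewrite leNgt; apply: contra g3 => h.
    by apply/existsP; exists S; rewrite hS.
  - move=> a b; rewrite leNgt; apply: contra g4 => h.
    by apply/existsP; exists a; apply/existsP; exists b.
  - move=> v r /= hS; rewrite leNgt; apply: contra g5 => h.
    by apply/existsP; exists v; apply/existsP; exists r; rewrite hS.
have good_few s G : good s G -> (8 * #|[set v | margin p q G s v <= eB * d]%R| <= n)%N.
  case/and5P => g1 _ _ g4 _.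
  have cut (a b : labels n) : \sum_i \sum_j (llr_mx p q G i j - mean_mx p q alpha s i j) *
      sg (a i) * sg (b j) <= (kappa * d) * n%:R.
    rewrite leNgt; apply: contra g4 => h.
    by apply/existsP; exists a; apply/existsP; exists b.
  have := few_low_margins (eB * d) (ltW (proj1 (andP ha))) g1 cut; rewrite alphaE.
  set U := #|_|; rewrite -(ler_nat R) natrM => h.
  have t_kl : `|t * kl_diff p q| = t * `|kl_diff p q| by rewrite normrM gtr0_norm.
  have fac : d * (l0 / 4) <= t * d * (kl_sum p q - `|kl_diff p q| * bal) - eB * d.
    rewrite t_kl in bal2.
    have e1 := ler_wpM2r (ltW d0) bal2; have e2 := ler_wpM2r (ltW d0) eBl.
    by move: e1 e2; rewrite /l0; clear; lra.
  have U0 : 0 <= U%:R :> R by exact: ler0n.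
  have h2 := le_trans (ler_wpM2l U0 fac) h.
  have h3 : kappa * d * n%:R <= l0 / 32 * d * n%:R.
    by rewrite ler_wpM2r ?ler0n// ler_wpM2r// ltW.
  have h4 := le_trans h2 h3.
  have ld : 0 < d * l0 / 32 by rewrite divr_gt0// mulr_gt0.
  rewrite -(ler_pM2l ld); move: h4; clear; lra.
have good_nbr s G : good s G -> forall u,
    (#|[set v | rev G u v && (margin p q G s v <= eB * d)%R]| <= k)%N.
  case/and5P => _ _ _ _ /andP[_ g6] u; rewrite leqNgt; apply: contra g6 => h.
  by apply/existsP; exists u.
have good_deg s G : good s G -> forall u, \sum_v (rev G u v)%:R <= K * d.
  case/and5P => _ g2 _ _ _ u; rewrite leNgt; apply: contra g2 => h.
  by apply/existsP; exists u.
pose A := K / t * expR (- (cB * d / 2)).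
have A1 : 0 <= A by rewrite mulr_ge0 ?expR_ge0// divr_ge0// ltW.
have sus u := suspicious_prob hp hq ha t0 hpq alphaE d1 eBc (ltn0Sn _) kn large_d C u (ltW K0).
have := two_step_genie_dist hp hq ha (spec := fun G => sign_vector (u1 n G)) n4 large_C good_spec
  good_few good_nbr good_deg good_prob A1 sus.
move=> main; rewrite (Err_two_step p q _ (fun G => sign_vector (u1 n G))) Err_genie// -/alpha.
split; last first.
  apply: (model_E_ge0 hp hq ha) => s G.
  by case/andP: (min_misclass01 (R := R) [ffun u => 0 <= evidence p q G s u] s).
have AE : A * (2 * (1 + expR C)) = A0 * expR (- (cB / 2 * d)).
  by rewrite /A /A0 (_ : cB * d / 2 = cB / 2 * d); ring.
apply: le_trans main _; rewrite AE lerD2l mulrA; apply: ler_wpM2r; first exact: expR_ge0.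
apply: ler_wpM2r => //; rewrite lerD2l -[leRHS]mulr1; apply: ler_wpM2l => //.
rewrite -[leRHS]expR0 ler_expR oppr_le0 mulr_ge0 ?divr_ge0// ltW//.
Qed.

Local Open Scope classical_set_scope.

Lemma ln_natr_ge_near (R : realType) (M : R) : \forall n \near \oo, M <= ln n%:R.
Proof.
near=> n; rewrite -[M]expRK ler_ln ?posrE ?expR_gt0//.
  by near: n; exact: nbhs_infty_ger.
by apply: lt_le_trans (expR_gt0 M) _; near: n; exact: nbhs_infty_ger.
Unshelve. all: by end_near. Qed.

Lemma exp_ln_small_near (R : realType) (A c e : R) : 0 <= A -> 0 < c -> 0 < e ->
  \forall n \near \oo, A * expR (- (c * ln n%:R)) <= e.
Proof.
move=> A0 c0 e0; near=> n.
have hd : A / (c * e) <= ln n%:R by near: n; exact: ln_natr_ge_near.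
rewrite expRN ler_pdivrMr ?expR_gt0//.
apply: (@le_trans _ _ (e * (c * ln n%:R))).
  by move: hd; rewrite ler_pdivrMr ?mulr_gt0// mulrC mulrAC [e * _]mulrC => /le_trans; apply;
    rewrite mulrAC.
rewrite ler_wpM2l ?(ltW e0)//; apply: le_trans (expR_ge1Dx _).
by rewrite lerDr.
Unshelve. all: by end_near. Qed.

Theorem theorem2p4 (R : realType) (p q t : R)
    (hp : 0 < p < 1) (hq : 0 < q < 1) (hpq : p != q) (ht : 0 < t)
    (u1 : forall n : nat, observation n -> 'rV[R]_n)
    (hu1 : forall (n : nat) (G : observation n), (0 < n)%N ->
       top_unit_eigenvector (spectral_matrix p q G) (u1 n G)) :
  let ErrTwoStep (n : nat) : R :=
    Err p q (reveal_prob t n) (fun w : sample n =>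
      let G := observe w in two_step p p q G (sign_vector (u1 n G))) in
  let ErrBest (n : nat) : R :=
    Err p q (reveal_prob t n) (@genie R p q (reveal_prob t n) n) in
  exists eps delta : nat -> R,
    [/\ eps n @[n --> \oo] --> (0 : R),
        n%:R * delta n @[n --> \oo] --> (0 : R) &
        \forall n \near \oo, ErrTwoStep n = (1 + eps n) * ErrBest n + delta n].
Proof.
move=> ErrTwoStep ErrBest.
have [c0 [A0 [B0 [D0 [c00 A00 B00 bound]]]]] := two_step_genie_rate hp hq hpq ht hu1.
pose a n : R := A0 * expR (- (c0 * ln n%:R)).
pose b n : R := B0 * expR (- (2 * ln n%:R)).
pose D n := ErrTwoStep n - ErrBest n.
(* The difference [D n] is shared between relative and absolute error in proportion to the two terms
   of its bound [w n]; [b n > 0] keeps the denominator positive even if [ErrBest n] vanishes. *)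
pose w n := a n * ErrBest n + b n.
have a0 n : 0 <= a n by rewrite mulr_ge0// expR_ge0.
have b0 n : 0 < b n by rewrite mulr_gt0// expR_gt0.
have bnd n : D0 <= ln n%:R -> [/\ `|D n| <= w n, 0 <= ErrBest n & 0 < w n].
  move=> /bound[h e0]; split=> //.
  by rewrite ltr_wpDl// mulr_ge0.
have frac n x : D0 <= ln n%:R -> 0 <= x -> `|D n * x / w n| <= x.
  move=> /bnd[h _ w0] x0; rewrite normrM normfV (gtr0_norm w0) ler_pdivrMr//.
  by rewrite normrM (ger0_norm x0) mulrC ler_wpM2l.
exists (fun n => D n * a n / w n), (fun n => D n * b n / w n); split.
- apply/cvgrPdist_le => e e0; near=> n; rewrite sub0r normrN.
  apply: (@le_trans _ _ (a n)).
    by apply: frac => //; near: n; exact: ln_natr_ge_near.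
  by near: n; exact: exp_ln_small_near.
- apply/cvgrPdist_le => e e0; near=> n; rewrite sub0r normrN normrM normr_nat.
  apply: (@le_trans _ _ (n%:R * b n)).
    apply: ler_wpM2l => //; apply: frac; last exact: ltW.
    by near: n; exact: ln_natr_ge_near.
  have n0 : 0 < ln n%:R :> R.
    by apply: lt_le_trans ltr01 _; near: n; exact: ln_natr_ge_near.
  (* [n * b n] is [B0 / n]. *)
  rewrite (natr_expR_ln n0) /b mulrCA -expRD.
  rewrite (_ : ln n%:R + _ = - (1 * ln n%:R)); last by ring.
  by near: n; apply: exp_ln_small_near => //; exact: ltW.
near=> n.
have [_ _ w0] : [/\ `|D n| <= w n, 0 <= ErrBest n & 0 < w n].
  by apply: bnd; near: n; exact: ln_natr_ge_near.
rewrite mulrDl mul1r -addrA [X in _ = _ + X](_ : _ = D n); first by rewrite /D addrC subrK.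
have w_neq0 : w n != 0 by rewrite gt_eqF.
apply: (mulIf w_neq0); rewrite mulrDl divfK// mulrAC divfK//.
by rewrite -mulrA -mulrDr.
Unshelve. all: by end_near. Qed.
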